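(* Let $X\subset\mathbb{R}^d$, let $K$ be a continuous positive definite kernel on $X$ with RKHS $\mathcal{H}$, and let $y_i=f_0(x_i)+\epsilon_i$, $i=1,\dots,n$. Suppose that: (A1) $X$ is a compact subset of $\mathbb{R}^d$ and the predictors $\{x_i\}_{i=1}^n$ are i.i.d. random vectors with distribution $v$ supported on all of $X$ (i.e. $v(O)>0$ for every non-empty relatively open $O\subset X$). (A2) The loss $\rho:\mathbb{R}\to\mathbb{R}$ is convex and absolutely continuous with derivative $\psi$ existing almost everywhere. (A3) There exist constants $\kappa,M_1>0$ such that for all $|y|\le\kappa$, $|\psi(x+y)-\psi(x)|\le M_1$ uniformly in $x\in\mathbb{R}$. (A4) The errors $\{\epsilon_i\}_{i=1}^n$ are i.i.d., independent of $\{x_i\}_{i=1}^n$, satisfy $\mathbb{E}[\psi(\epsilon_1)]=0$, $\mathbb{E}[|\psi(\epsilon_1)|^2]<\infty$, and there exists $\gamma>0$ such that $\mathbb{E}[\psi(\epsilon_1+t)]=\gamma t+o(t)$ as $t\to0$. (A5) There exists $\beta\in(0,1]$ such that $f_0\in[\mathcal{H}]^\beta$. (A6) There exists $\alpha\in(0,\beta)$ such that the inclusion $[\mathcal{H}]^\alpha\hookrightarrow\mathcal{L}^\infty_v(X)$ is continuous. Let $\lambda=\lambda_n>0$ and let $$\widehat f_n=\operatorname*{argmin}_{f\in\mathcal{H}}\Big[\frac1n\sum_{i=1}^n\rho(y_i-f(x_i))+\lambda\|f\|_{\mathcal{H}}^2\Big].$$ Suppose that $\lambda\to0$ in such a way that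 $\mathcal{N}_\infty^2(\lambda)/n\to0$ and $\lambda^\beta\mathcal{N}_\infty(\lambda)\to0$ as $n\to\infty$. Then $$\int_X\{\widehat f_n(x)-f_0(x)\}^2\,v(dx)=O_{\mathbb{P}}\Big(\frac{\mathcal{N}_\infty(\lambda)}{n}\Big)+O_{\mathbb{P}}(\lambda^\beta),\qquad n\to\infty.$$
   Context: A symmetric kernel $K:X\times X\to\mathbb{R}$ is positive definite if $\sum_{j,k=1}^N a_ja_kK(w_j,w_k)>0$ for all $N\in\mathbb{N}$, all pairwise distinct $w_1,\dots,w_N\in X$ and all $a\in\mathbb{R}^N\setminus\{0\}$. $\mathcal{H}$ is its reproducing kernel Hilbert space of real functions on $X$, with norm $\|\cdot\|_{\mathcal{H}}$. The objects $X,K,v,\rho,f_0$ and the law of $\epsilon_1$ do not depend on $n$. $\psi:\mathbb{R}\to\mathbb{R}$ denotes a fixed Borel version of the a.e. derivative of $\rho$. Eigensystem: $(\mu_j,\phi_j)_{j\ge1}$ are the (positive) eigenvalues and corresponding $\mathcal{L}^2_v(X)$-orthonormal (continuous) eigenfunctions of the integral operator $T_K f(x)=\int_X K(x,y)f(y)\,v(dy)$ on $\mathcal{L}^2_v(X)$, so that $K(x,y)=\sum_j\mu_j\phi_j(x)\phi_j(y)$ (Mercer) and $\mathcal{H}=\{\sum_j f_j\phi_j:\sum_j f_j^2/\mu_j<\infty\}$ with $\|\sum_j f_j\phi_j\|_{\mathcal{H}}^2=\sum_j f_j^2/\mu_j$. Power spaces: for $\beta\in(0,1]$, $[\mathcal{H}]^\beta=\{\sum_j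 f_j\mu_j^{\beta/2}\phi_j:\sum_j|f_j|^2<\infty\}$, with norm $\|\sum_j f_j\mu_j^{\beta/2}\phi_j\|_\beta=(\sum_j f_j^2)^{1/2}$ (series converging in $\mathcal{L}^2_v(X)$). For $\lambda>0$: $\|f\|_{\mathcal{H},\lambda}^2=\|f\|_{\mathcal{L}^2_v(X)}^2+\lambda\|f\|_{\mathcal{H}}^2$ for $f\in\mathcal{H}$. The spectral complexity is $\mathcal{N}_\infty(\lambda)=\sup_{f\in\mathcal{H},f\ne0}\|f\|_\infty^2/\|f\|_{\mathcal{H},\lambda}^2$, where $\|f\|_\infty=\sup_{x\in X}|f(x)|$. $Z_n=O_{\mathbb{P}}(a_n)$ means $Z_n/a_n$ is bounded in probability as $n\to\infty$; the displayed conclusion means the left side is bounded by the sum of two such terms. *)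

(* Defs.v *)
From HB Require Import structures.
From mathcomp Require Import all_boot all_order all_algebra.
From mathcomp Require Import all_classical all_reals all_analysis.

Set Implicit Arguments.
Unset Strict Implicit.
Unset Printing Implicit Defensive.

Import Order.TTheory GRing.Theory Num.Theory.
Import numFieldNormedType.Exports.

Local Open Scope classical_set_scope.
Local Open Scope ring_scope.

(* A subset X of R^d is used as a type, with the relative topology, so that
   real functions on X are the functions X -> R. Measurable types being
   pointed, the Borel structure on X needs some point x0 of X; the
   sigma-algebra does not depend on it. *)
Definition pointed_at (T : choiceType) (x0 : T) : Type := T.
HB.instance Definition _ (T : choiceType) (x0 : T) :=
  Choice.on (pointed_at x0).
HB.instance Definition _ (T : choiceType) (x0 : T) :=
  isPointed.Build (pointed_at x0) x0.

Definition borel (T : topologicalType) (x0 : T) :=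
  g_sigma_algebraType (@open T : set (set (pointed_at x0))).

Section Kernels.
Context {R : realType} {S : Type}.
Implicit Types (K : S -> S -> R) (H : set (S -> R)).
Implicit Types (ip : (S -> R) -> (S -> R) -> R) (f g h : S -> R).

Definition symmetric_kernel K := forall s t, K s t = K t s.

Definition positive_definite K :=
  forall (N : nat) (w : 'I_N -> S) (a : 'rV[R]_N), injective w -> a != 0 ->
  0 < \sum_(j < N) \sum_(k < N) a ord0 j * a ord0 k * K (w j) (w k).

Definition ip_norm ip f : R := Num.sqrt (ip f f).

(* H is the underlying set of functions, ip the inner product; the values of
   ip outside of H are irrelevant. *)
Record is_rkhs K H ip : Prop := {
  rkhs0 : H (fun=> 0) ;
  rkhs_lin : forall a f g, H f -> H g -> H (fun s => a * f s + g s) ;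
  rkhs_ipC : forall f g, H f -> H g -> ip f g = ip g f ;
  rkhs_ip_lin : forall a f g h, H f -> H g -> H h ->
    ip (fun s => a * f s + g s) h = a * ip f h + ip g h ;
  rkhs_ip_gt0 : forall f, H f -> f <> (fun=> 0) -> 0 < ip f f ;
  rkhs_complete : forall u : nat -> S -> R, (forall n, H (u n)) ->
    (forall e : R, 0 < e -> exists N, forall m n, (N <= m)%N -> (N <= n)%N ->
       ip_norm ip (u m \- u n) < e) ->
    exists2 f : S -> R, H f & ip_norm ip (u n \- f) @[n --> \oo] --> (0 : R) ;
  rkhs_section : forall s, H (K s) ;
  rkhs_reproducing : forall f s, H f -> ip f (K s) = f s }.

Definition sup_norm f : R := sup [set `|f s| | s in [set: S]].

Definition is_argmin H (obj : (S -> R) -> R) f :=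
  H f /\ forall g, H g -> obj f <= obj g.

End Kernels.

Section Spectral.
Context {R : realType} {d : measure_display} {S : measurableType d}.
Variable v : probability S R.

Definition integral_operator (K : S -> S -> R) (f : S -> R) (x : S) : R :=
  \int[v]_y (K x y * f y).

(* J is the set of indices: nat itself, or a finite set when S is finite.
   Each positive eigenvalue occurs as often as its (finite) multiplicity. *)
Record eigensystem (K : S -> S -> R) (J : pred nat) (mu : nat -> R)
    (phi : nat -> S -> R) : Prop := {
  eigen_gt0 : forall j, J j -> 0 < mu j ;
  eigen_L2 : forall j, J j -> phi j \in Lfun v 2%:E ;
  eigen_orthonormal : forall i j, J i -> J j ->
    \int[v]_x (phi i x * phi j x) = (i == j)%:R ;
  eigen_eq : forall j, J j ->
    {ae v, forall x, integral_operator K (phi j) x = mu j * phi j x} ;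
  eigen_all : forall (c : R) (f : S -> R), 0 < c -> f \in Lfun v 2%:E ->
    {ae v, forall x, integral_operator K f x = c * f x} ->
    exists (n : nat) (a : nat -> R), {ae v, forall x,
      f x = \sum_(0 <= j < n | J j && (mu j == c)) a j * phi j x} }.

(* f = \sum_(j in J) c_j mu_j^(b/2) phi_j in L^2(v), with c square-summable. *)
Definition power_expansion (J : pred nat) (mu : nat -> R)
    (phi : nat -> S -> R) (b : R) (f : S -> R) (c : nat -> R) :=
  [/\ f \in Lfun v 2%:E,
      cvgn (fun n => \sum_(0 <= j < n | J j) (c j) ^+ 2) &
      ('N[v]_(2%:E)[(fun x => (f x -
          \sum_(0 <= j < n | J j) c j * mu j `^ (b / 2) * phi j x)%:E)])%E
        @[n --> \oo] --> 0%E].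

Definition power_space J mu phi b : set (S -> R) :=
  [set f | exists c, power_expansion J mu phi b f c].

(* If power_expansion J mu phi b f c, this is the norm of f in the power space
   of exponent b: by orthonormality, f determines c on J. *)
Definition coef_norm (J : pred nat) (c : nat -> R) : R :=
  Num.sqrt (limn (fun n => \sum_(0 <= j < n | J j) (c j) ^+ 2)).

(* Continuity of the linear inclusion, as boundedness. *)
Definition power_embeds_Linfty J mu phi b :=
  exists C : R, forall f c, power_expansion J mu phi b f c ->
    ('N[v]_+oo[EFin \o f] <= (C * coef_norm J c)%:E)%E.

Definition reg_norm2 (ip : (S -> R) -> (S -> R) -> R) (lam : R)
    (f : S -> R) : R :=
  \int[v]_x (f x ^+ 2) + lam * ip_norm ip f ^+ 2.

(* For lam > 0 and a bounded positive definite kernel K on a nonempty space,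
   this supremum and the ones defining sup_norm are those of nonempty bounded
   sets, because |f x| <= sqrt (K x x) * ip_norm ip f. *)
Definition spectral_complexity (H : set (S -> R)) ip (lam : R) : R :=
  sup [set sup_norm f ^+ 2 / reg_norm2 ip lam f
      | f in [set f | H f /\ f <> (fun=> 0)]].

End Spectral.

(* Local absolute continuity, that is, on every compact interval. *)
Definition absolutely_continuous {R : realType} (f : R -> R) :=
  forall a b : R, a < b -> forall e : R, 0 < e -> exists2 delta : R, 0 < delta &
  forall (n : nat) (s t : 'I_n -> R),
    (forall i, [/\ a <= s i, s i < t i & t i <= b]) ->
    (forall i j, i != j -> t i <= s j \/ t j <= s i) ->
    \sum_(i < n) (t i - s i) < delta ->
    \sum_(i < n) `|f (t i) - f (s i)| < e.

Section Probability.
Context {R : realType} {dO : measure_display} {Omega : measurableType dO}.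
Variable P : probability Omega R.
Local Open Scope ereal_scope.

Definition mutually_independent d (T : measurableType d)
    (X : nat -> Omega -> T) :=
  forall (I : seq nat) (B : nat -> set T), uniq I ->
  (forall i, measurable (B i)) ->
  P (\bigcap_(i in [set` I]) X i @^-1` B i)
  = \prod_(i <- I) P (X i @^-1` B i).

Definition identically_distributed d (T : measurableType d)
    (X : nat -> Omega -> T) :=
  forall i (B : set T), measurable B -> P (X i @^-1` B) = P (X 0%N @^-1` B).

Definition sigma_generated d (T : measurableType d) (X : nat -> Omega -> T) :
    set (set Omega) :=
  <<s \bigcup_i preimage_set_system setT (X i) measurable >>.

Definition independent_sequences d1 (T1 : measurableType d1) d2
    (T2 : measurableType d2) (X : nat -> Omega -> T1) (Y : nat -> Omega -> T2) :=
  forall A B, sigma_generated X A -> sigma_generated Y B ->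
  P (A `&` B) = P A * P B.

(* Z_n = O_P(a_n). The event {|Z_n| > M a_n} is only required to be covered by
   a measurable event of small probability, as Z_n is not assumed to be
   measurable. *)
Definition big_O_P (Z : nat -> Omega -> R) (a : nat -> R) :=
  forall e : R, (0 < e)%R -> exists2 M : R, (0 < M)%R &
  \forall n \near \oo, exists E : set Omega,
    [/\ measurable E, P E <= e%:E & [set w | (M * a n < `|Z n w|)%R] `<=` E].

End Probability.

(* Main.v *)
(* Cutting the expansion of f0 at the eigenvalues mu_j >= lambda gives fl in the
   RKHS with ||f0 - fl||_2^2 and lambda ||fl||^2 of order lambda^beta, and
   f0 - fl is uniformly small by the embedding hypothesis. By convexity it is
   enough that, with large probability, the objective at fl + g exceeds its
   value at fl for all g on a sphere of radius delta, delta^2 proportional to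
   N/n + lambda^beta, of the norm ||g||_2^2 + lambda ||g||^2.
   The expected increment is bounded below by a multiple of ||g||_2^2, because
   E[psi(eps + t)] ~ gamma t. The deviation from it is controlled uniformly in
   g by symmetrisation and contraction: the loss increments are Lipschitz with
   a square-integrable constant, and the Rademacher average over the ball is
   at most delta times the root of the sum of the ||k_{x_i}||^2 <= N, where
   k_x represents the evaluation at x for the regularised inner product.
   The predictors and the errors are first replaced by finite-valued
   approximations. Expectations become finite sums, and no measurability of
   suprema over the ball is needed.
   As psi is only an almost everywhere derivative, it is replaced by the left
   derivative of rho, a subgradient at every point; by Fubini's theorem and
   monotonicity this preserves the expansion of the mean. *)

Require Import Defs.
From HB Require Import structures.
From mathcomp Require Import all_boot all_order all_algebra.
From mathcomp Require Import all_classical all_reals all_analysis.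
From mathcomp Require Import measurable_realfun ess_sup_inf ring lra.
Import Order.TTheory GRing.Theory Num.Theory.
Import numFieldNormedType.Exports.
Local Open Scope classical_set_scope.
Local Open Scope ring_scope.

Set Implicit Arguments.
Unset Strict Implicit.
Unset Printing Implicit Defensive.

(** * Subgradients of the loss *)

(** The two growth conditions say exactly that [N * C] tends to 0, where [N] is the spectral
    complexity and [C = N / n + lambda^beta]. A squared sup norm is at most [N] times the squared
    regularised norm, so a ball whose squared radius is proportional to [C] shrinks uniformly. Its
    elements thus end up inside the window [kappa] where the loss increments are Lipschitz, and
    inside the neighbourhood of 0 where the mean of the subgradient is nearly linear. One
    subgradient inequality gives a lower bound without curvature; each increment is therefore split
    into two halves, and the second half produces the quadratic term. The deviation bound does not
    depend on the number of cells of the discretisation. The mesh may thus depend on [n], [lambda]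
    and the radius, and the discretisation error is simply made at most [C]. Markov's inequality is
    enough for the deviations, since boundedness in probability allows a constant proportional to
    the inverse of the exceptional probability. The resulting bound by a multiple of [C] is split at
    the end, by sharing the loss in the ratio of [N / n] to [lambda^beta]. *)

Section Subgradient.
Context {R : realType}.
Implicit Types (rho psi : R -> R) (s t u : R).

(** For convex [rho] the backward quotients increase as [s] decreases to 0, so this supremum is the
    left derivative. *)
Definition left_slope rho t : R :=
  sup [set (rho t - rho (t - s)) / s | s in [set s | 0 < s]].

Lemma convex_ineq rho (a x y : R) : convex_function [set: R^o] rho ->
  0 <= a <= 1 -> rho (a * x + (1 - a) * y) <= a * rho x + (1 - a) * rho y.
Proof.
move=> rho_convex /andP[a0 a1].
have := rho_convex (Itv01 a0 a1) x y (mem_setT _) (mem_setT _).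
by rewrite !convRE.
Qed.

(** [t] is the convex combination of [t - s] and [t + u] with weights [u / (s + u)] and
    [s / (s + u)]. *)
Lemma convex_slopes rho t s u : convex_function [set: R^o] rho ->
  0 < s -> 0 < u -> (rho t - rho (t - s)) / s <= (rho (t + u) - rho t) / u.
Proof.
move=> rho_convex s0 u0; have su0 : 0 < s + u by rewrite addr_gt0.
have : 0 <= u / (s + u) <= 1.
  by rewrite divr_ge0 ?(ltW u0) ?(ltW su0)//= ler_pdivrMr// mul1r lerDr ltW.
move/(@convex_ineq rho _ (t - s) (t + u) rho_convex).
have -> : u / (s + u) * (t - s) + (1 - u / (s + u)) * (t + u) = t.
  by field; rewrite gt_eqF.
have -> : u / (s + u) * rho (t - s) + (1 - u / (s + u)) * rho (t + u)
  = (u * rho (t - s) + s * rho (t + u)) / (s + u).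
  by field; rewrite gt_eqF.
rewrite ler_pdivlMr// => h.
rewrite ler_pdivrMr// -mulrA [_^-1 * _]mulrC mulrA ler_pdivlMr//; nra.
Qed.

(** Every forward quotient bounds all backward ones. Hence the supremum is finite and below the
    forward quotients, which settles [u > 0]; for [u < 0] the quotient with [s = - u] is one of its
    members. *)
Lemma left_slope_subgradient rho t u : convex_function [set: R^o] rho ->
  rho t + left_slope rho t * u <= rho (t + u).
Proof.
move=> rho_convex; rewrite -lerBrDl.
have nonempty : [set (rho t - rho (t - s)) / s | s in [set s | 0 < s]] !=set0.
  by exists ((rho t - rho (t - 1)) / 1); exists 1 => /=.
have ub v : 0 < v -> ubound [set (rho t - rho (t - s)) / s | s in [set s | 0 < s]]
    ((rho (t + v) - rho t) / v).
  by move=> v0 _ [s /= s0 <-]; exact: convex_slopes.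
have [u0|u0|->] := ltgtP u 0; last by rewrite mulr0 addr0 subrr.
- have : (rho t - rho (t - - u)) / - u <= left_slope rho t.
    apply: ub_le_sup; first by exists ((rho (t + 1) - rho t) / 1); exact: ub.
    by exists (- u) => //=; rewrite oppr_gt0.
  rewrite opprK ler_pdivrMr ?oppr_gt0//; nra.
- by rewrite -ler_pdivlMr//; apply: ge_sup => //; exact: ub.
Qed.

(** The difference quotients are at least [g] for positive steps and at most [g] for negative ones,
    so their common limit can only be [g]. *)
Lemma subgradient_derive rho (g l : R) t :
  (forall u, rho t + g * u <= rho (t + u)) -> is_derive t (1 : R) rho l ->
  g = l.
Proof.
move=> sub [+ <-]; rewrite /derivable /derive => /= /cvg_ex[D cD].
rewrite (cvg_lim _ cD)//; apply/eqP; rewrite eq_le; apply/andP; split;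
  rewrite leNgt; apply/negP => Dg.
- have [e /= e0 he] := cvgr_lt _ cD _ Dg.
  have e2 : 0 < e / 2 by rewrite divr_gt0.
  have := he (e / 2).
  rewrite /ball_/= sub0r normrN gtr0_norm// gtr_pMr// invf_lt1// ltr1n.
  rewrite gt_eqF// => /(_ isT isT).
  rewrite /shift /GRing.scale/= mulr1 [_ + t]addrC ltNge ler_pdivlMl//.
  by have := sub (e / 2); lra.
- have [e /= e0 he] := cvgr_gt _ cD _ Dg.
  have e2 : 0 < e / 2 by rewrite divr_gt0.
  have := he (- (e / 2)).
  rewrite /ball_/= sub0r normrN normrN gtr0_norm// gtr_pMr// invf_lt1// ltr1n.
  rewrite oppr_eq0 gt_eqF// => /(_ isT isT).
  rewrite /shift /GRing.scale/= mulr1 [_ + t]addrC ltNge.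
  rewrite invrN mulNr lerNl ler_pdivlMl//.
  by have := sub (- (e / 2)); lra.
Qed.

Lemma subgradient_mono rho dl : (forall t u, rho t + dl t * u <= rho (t + u)) ->
  {homo dl : s t / s <= t}.
Proof.
move=> sub s t; rewrite le_eqVlt => /orP[/eqP->//|st].
have := sub s (t - s); have := sub t (s - t).
rewrite [t + (s - t)]addrC [s + (t - s)]addrC !subrK => h1 h2.
have h : 0 < t - s by rewrite subr_gt0.
rewrite -(ler_pM2r h); lra.
Qed.

(** A null set contains no open interval. This supplies good points on both sides of any given
    point, between which monotone functions are squeezed. *)
Lemma ae_dense (Q : R -> Prop) (a b : R) :
  {ae @lebesgue_measure R, forall t, Q t} -> a < b ->
  exists t, [/\ a < t, t < b & Q t].
Proof.
move=> [N [mN N0 QN]] ab; apply: contrapT => nex.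
have abN : `]a, b[ `<=` N.
  move=> t /=; rewrite in_itv/= => /andP[at_ tb]; apply: QN => /= Qt.
  by apply: nex; exists t.
have : (@lebesgue_measure R `]a, b[ <= lebesgue_measure N)%E.
  by apply: le_measure => //; rewrite ?inE//; exact: measurable_itv.
by rewrite N0 lebesgue_measure_itv/= lte_fin ab -EFinB lee_fin subr_le0 leNgt ab.
Qed.

Lemma subgradient_ae rho dl psi :
  (forall t u, rho t + dl t * u <= rho (t + u)) ->
  {ae @lebesgue_measure R, forall t, is_derive t (1 : R) rho (psi t)} ->
  {ae @lebesgue_measure R, forall t, dl t = psi t}.
Proof.
move=> sub [N [mN N0 QN]]; exists N; split => // t /= ne; apply: QN => /= h.
by apply: ne; exact: subgradient_derive h.
Qed.

(** Monotonicity squeezes [dl t] between its values at two points within [kappa] of [t] where it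
    equals [psi]; there [psi] is within [M] of [psi t]. *)
Lemma subgradient_near rho dl psi (kappa M : R) :
  (forall t u, rho t + dl t * u <= rho (t + u)) ->
  {ae @lebesgue_measure R, forall t, is_derive t (1 : R) rho (psi t)} ->
  0 < kappa ->
  (forall s, `|s| <= kappa -> forall t, `|psi (t + s) - psi t| <= M) ->
  forall t, `|dl t - psi t| <= M.
Proof.
move=> sub rho_psi kappa0 psiM t.
have dlm := subgradient_mono sub.
have ae := subgradient_ae sub rho_psi.
have [s1 [s1t ts1 e1]] : exists s, [/\ t - kappa < s, s < t & dl s = psi s].
  by apply: ae_dense => //; lra.
have [s2 [s2t ts2 e2]] : exists s, [/\ t < s, s < t + kappa & dl s = psi s].
  by apply: ae_dense => //; lra.
have := dlm _ _ (ltW ts1); have := dlm _ _ (ltW s2t); rewrite e1 e2 => h1 h2.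
have : `|psi (t + (s1 - t)) - psi t| <= M.
  by apply: psiM; rewrite ler_norml; apply/andP; split; lra.
have : `|psi (t + (s2 - t)) - psi t| <= M.
  by apply: psiM; rewrite ler_norml; apply/andP; split; lra.
rewrite [t + (s1 - t)]addrC [t + (s2 - t)]addrC !subrK !ler_norml => /andP[? ?] /andP[? ?].
by apply/andP; split; lra.
Qed.

(** One [M] for the increment of [psi], and one for each of the two replacements of [psi] by
    [dl]. *)
Lemma subgradient_increments rho dl psi (kappa M : R) :
  (forall t u, rho t + dl t * u <= rho (t + u)) ->
  {ae @lebesgue_measure R, forall t, is_derive t (1 : R) rho (psi t)} ->
  0 < kappa ->
  (forall s, `|s| <= kappa -> forall t, `|psi (t + s) - psi t| <= M) ->
  forall s t, `|s| <= kappa -> `|dl (t + s) - dl t| <= 3 * M.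
Proof.
move=> sub rho_psi kappa0 psiM s t sk.
have near := subgradient_near sub rho_psi kappa0 psiM.
have := near (t + s); have := near t; have := psiM s sk t.
rewrite !ler_norml => /andP[? ?] /andP[? ?] /andP[? ?].
by apply/andP; split; lra.
Qed.

(** The image of Lebesgue measure under a translation has the same values on half-open intervals,
    which determine it. *)
Lemma lebesgue_measure_shift (c : R) (A : set R) : measurable A ->
  lebesgue_measure ((fun s : R => c + s) @^-1` A) = lebesgue_measure A.
Proof.
move=> mA; have mc : measurable_fun [set: R] (fun s : R => c + s).
  exact: measurable_funD.
pose m := pushforward (@lebesgue_measure R)
  (fun s : measurableTypeR R => c + s : measurableTypeR R).
have -> : lebesgue_measure ((fun s : R => c + s) @^-1` A) = m A by [].
apply/esym/lebesgue_measure_unique => //= _ [[a b]] _ <-.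
rewrite /m /pushforward.
have -> : [eta +%R c] @^-1` [set` Interval (BRight a) (BRight b)]
    = [set` Interval (BRight (a - c)) (BRight (b - c))].
  apply/seteqP; split=> s /=; rewrite !in_itv/= => /andP[? ?];
  by apply/andP; split; lra.
rewrite !lebesgue_measure_itv/= !lte_fin ltrD2r.
by case: ifP => // _; rewrite -!EFinB; congr (_%:E); ring.
Qed.
End Subgradient.

(** [f t] lies between values of [m] at points [s1 < t < s2] closer than [dd] to [t]. The linear
    approximation at those points costs an extra [(|gamma| + eta) * dd], and [dd] is arbitrarily
    small. In the application [m] is the mean of [psi] and [f] that of the subgradient. *)
Lemma monotone_linear_approx {R : realType} (f m : R -> R) (kappa r gamma eta : R) :
  0 < kappa -> 0 < r -> 0 < eta ->
  (forall s t, `|s| <= kappa -> `|t| <= kappa -> s <= t -> f s <= f t) ->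
  (forall a b, a < b -> exists s, [/\ a < s, s < b & f s = m s]) ->
  (forall s, `|s| < r -> `|m s - gamma * s| <= eta * `|s|) ->
  exists2 t0, 0 < t0 & forall t, `|t| <= t0 -> `|f t - gamma * t| <= eta * `|t|.
Proof.
move=> kappa0 r0 eta0 fmono fm bound.
have t00 : 0 < Num.min kappa r / 2 by rewrite divr_gt0// lt_min kappa0 r0.
exists (Num.min kappa r / 2) => // t tt0.
have tk : `|t| <= kappa / 2.
  by rewrite (le_trans tt0)// ler_pM2r// ge_min lexx.
have tr : `|t| <= r / 2.
  by rewrite (le_trans tt0)// ler_pM2r// ge_min lexx orbT.
have key dd : 0 < dd -> dd <= kappa / 2 -> dd <= r / 2 ->
    `|f t - gamma * t| <= eta * `|t| + (`|gamma| + eta) * dd.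
  move=> dd0 ddk ddr.
  have near s : t - dd < s -> s < t + dd -> [/\ `|s| < r, `|s| <= kappa,
      `|s| <= `|t| + dd & `|gamma * (s - t)| <= `|gamma| * dd].
    move=> l u; have sd : `|s - t| < dd by rewrite ltr_distl l u.
    have st : `|s| <= `|t| + `|s - t|.
      by have := ler_normD t (s - t); rewrite addrC subrK.
    split; [lra|lra|lra|by rewrite normrM ler_wpM2l// ltW].
  have [s1 [l1 u1 e1]] := fm (t - dd) t (ltac:(lra) : t - dd < t).
  have [s2 [l2 u2 e2]] := fm t (t + dd) (ltac:(lra) : t < t + dd).
  have [s1r s1k s1d g1] := near s1 l1 (ltac:(lra) : s1 < t + dd).
  have [s2r s2k s2d g2] := near s2 (ltac:(lra) : t - dd < s2) u2.
  have tk' : `|t| <= kappa by lra.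
  have f1 := fmono s1 t s1k tk' (ltW u1); have f2 := fmono t s2 tk' s2k (ltW l2).
  have b1 := bound s1 s1r; have b2 := bound s2 s2r.
  have h1 : eta * `|s1| <= eta * (`|t| + dd) by rewrite ler_pM2l.
  have h2 : eta * `|s2| <= eta * (`|t| + dd) by rewrite ler_pM2l.
  rewrite e1 in f1; rewrite e2 in f2.
  clear - f1 f2 b1 b2 h1 h2 g1 g2.
  move: b1 b2 g1 g2; rewrite !ler_norml => /andP[? ?] /andP[? ?] /andP[? ?] /andP[? ?].
  by apply/andP; split; lra.
apply/ler_addgt0Pr => h h0.
have ge0 : 0 < `|gamma| + eta by rewrite ltr_wpDl.
(* The first entry makes the extra cost at most [h], the second keeps [s1] and [s2] in the range of
   the hypotheses. *)
pose dd := Num.min (h / (`|gamma| + eta)) (Num.min kappa r / 2).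
apply: (le_trans (key dd _ _ _)).
- by rewrite lt_min divr_gt0.
- by rewrite ge_min ler_pM2r// ge_min lexx orbT.
- by rewrite ge_min ler_pM2r// ge_min lexx !orbT.
- rewrite lerD2l; apply: (@le_trans _ _ ((`|gamma| + eta) * (h / (`|gamma| + eta)))).
    by rewrite ler_pM2l// ge_min lexx.
  by rewrite mulrCA divff ?mulr1// gt_eqF.
Qed.

(** * Mean of the subgradient at shifted errors *)

Section MeanShift.
Context {R : realType} {d : measure_display} {Om : measurableType d}.
Variable P : probability Om R.
Implicit Types (e : Om -> R) (rho psi dl : R -> R) (s t u : R).

Lemma integrable_bound (f g : Om -> R) : measurable_fun [set: Om] f ->
  P.-integrable [set: Om] (EFin \o g) -> (forall w, `|f w| <= g w) ->
  P.-integrable [set: Om] (EFin \o f).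
Proof.
move=> mf ig fg; apply: le_integrable ig => //; first exact/measurable_EFinP.
by move=> w _ /=; rewrite lee_fin (le_trans (fg w))// ler_norm.
Qed.

Lemma integrable_add (f g : Om -> R) :
  P.-integrable [set: Om] (EFin \o f) -> P.-integrable [set: Om] (EFin \o g) ->
  P.-integrable [set: Om] (EFin \o (fun w => f w + g w)).
Proof. by move=> fi gi; exact: (integrableD measurableT fi gi). Qed.

Lemma integrable_scale (f : Om -> R) (c : R) :
  P.-integrable [set: Om] (EFin \o f) ->
  P.-integrable [set: Om] (EFin \o (fun w => c * f w)).
Proof. by move=> fi; exact: (integrableZl measurableT _ fi). Qed.

Lemma integrable_const (c : R) :
  P.-integrable [set: Om] (EFin \o (fun _ => c)).
Proof. exact: finite_measure_integrable_cst. Qed.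

Lemma integrable_abs (f : Om -> R) :
  P.-integrable [set: Om] (EFin \o f) ->
  P.-integrable [set: Om] (EFin \o (fun w => `|f w|)).
Proof. by move=> fi; exact: (integrable_norm fi). Qed.

(** The law of [e] may charge [N], so a given shift can be bad. For fixed [w], however, the set of
    [s] with [e w + s] in [N] is a translate of [N], hence null, and Tonelli's theorem exchanges the
    two conditions. *)
Lemma ae_shift (N : set R) e : measurable_fun [set: Om] e ->
  measurable N -> lebesgue_measure N = 0%E ->
  {ae @lebesgue_measure R, forall s, P [set w | N (e w + s)] = 0%E}.
Proof.
move=> me mN N0.
have mes : measurable_fun [set: Om * R] (fun p : Om * R => e p.1 + p.2).
  by apply: measurable_funD => //; apply: measurableT_comp.
pose A := [set p : Om * R | N (e p.1 + p.2)].
have mA : measurable A by have := mes measurableT _ mN; rewrite setTI.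
pose f := fun p : Om * R => (\1_A p)%:E : \bar R.
have mf : measurable_fun [set: Om * R] f.
  by apply/measurable_EFinP; exact: measurable_indic.
have f0 : forall p, (0 <= f p)%E by move=> p; rewrite lee_fin.
have mNs s : measurable [set w | N (e w + s)].
  rewrite -[X in measurable X]setTI.
  have -> : [set: Om] `&` [set w | N (e w + s)]
     = [set: Om] `&` (fun w => e w + s) @^-1` N by [].
  by apply: (measurable_funD me (@measurable_cst _ _ _ _ setT s)).
have mNw w : measurable [set s | N (e w + s)].
  rewrite -[X in measurable X]setTI.
  have : measurable_fun [set: R] (fun s : R => e w + s) by exact: measurable_funD.
  by move/(_ measurableT _ mN).
have H1 w : (\int[@lebesgue_measure R]_s f (w, s))%E = 0%E.
  rewrite -N0 -(lebesgue_measure_shift (e w) mN).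
  rewrite -[X in _ = lebesgue_measure X]setIT -integral_indic//.
  exact: mNw.
have H2 s : (\int[P]_w f (w, s))%E = P [set w | N (e w + s)].
  by rewrite -[[set w | _]]setIT -integral_indic.
have := @fubini_tonelli _ _ _ _ R P (@lebesgue_measure R) f mf f0.
under eq_integral do rewrite H1.
rewrite integral0 => /esym h.
pose G := fun y : R => P [set w | N (e w + y)].
have h2 : (\int[@lebesgue_measure R]_y `|G y|)%E = 0%E.
  by rewrite -[RHS]h; apply: eq_integral => s _; rewrite gee0_abs /G// H2.
have mP : measurable_fun [set: R] G.
  have := @measurable_fun_fubini_tonelli_G _ _ _ _ R P f mf f0.
  by apply: eq_measurable_fun => s _; rewrite /fubini_G H2.
have [+ _] := ae_eq_integral_abs (@lebesgue_measure R) (@measurableT _ R) mP.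
move=> /(_ h2) [M [mM M0 sub]].
by exists M; split => // s /= ns; apply: sub => /= h3; apply: ns; exact: h3.
Qed.


(** For almost every shift the means of [dl] and [psi] agree; the mean of [dl] is monotone in the
    shift, which extends the expansion from these shifts to all small ones. *)
Lemma mean_subgradient e rho psi dl (kappa M gamma : R) :
  measurable_fun [set: Om] e -> measurable_fun [set: R] psi ->
  (forall t u, rho t + dl t * u <= rho (t + u)) ->
  {ae @lebesgue_measure R, forall t, is_derive t (1 : R) rho (psi t)} ->
  0 < kappa ->
  (forall s, `|s| <= kappa -> forall t, `|psi (t + s) - psi t| <= M) ->
  P.-integrable [set: Om] (EFin \o (psi \o e)) ->
  (fun t : R => \int[P]_w psi (e w + t) : R^o)
     = (fun t : R => gamma * t : R^o) +o_ (0 : R) (fun t : R => t : R^o) ->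
  forall eta, 0 < eta -> exists2 t0, 0 < t0 & forall t, `|t| <= t0 ->
    `|\int[P]_w dl (e w + t) - gamma * t| <= eta * `|t|.
Proof.
move=> me mpsi sub rho_psi kappa0 psiM ipsi /eqaddoP lo eta eta0.
have M0 : 0 <= M.
  have := psiM 0 _ 0; rewrite normr0 => /(_ (ltW kappa0)); exact: le_trans.
have dlmono := subgradient_mono sub.
have mdl : measurable_fun [set: R] dl by exact: nondecreasing_measurable.
have dlpsi := subgradient_near sub rho_psi kappa0 psiM.
have met t : measurable_fun [set: Om] (fun w => e w + t).
  by apply: measurable_funD.
have idl t : `|t| <= kappa ->
    P.-integrable [set: Om] (EFin \o (fun w => dl (e w + t))).
  move=> tk; apply: (@integrable_bound _ (fun w => `|psi (e w)| + (M + M))).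
  - exact: (measurableT_comp mdl (met t)).
  - by apply: integrable_add; [exact: integrable_abs|exact: integrable_const].
  - move=> w; have := dlpsi (e w + t); have := psiM _ tk (e w).
    rewrite !ler_norml => /andP[? ?] /andP[? ?].
    have := ler_norm (psi (e w)); have := lerNnormlW (lexx `|psi (e w)|).
    by move=> ? ?; apply/andP; split; lra.
have [N [mN N0 subN]] := subgradient_ae sub rho_psi.
have aeN := ae_shift me mN N0.
have eqN s : P [set w | N (e w + s)] = 0%E ->
    \int[P]_w dl (e w + s) = \int[P]_w psi (e w + s).
  move=> PN; congr fine; apply: ae_eq_integral => //.
  - by apply/measurable_EFinP; exact: (measurableT_comp mdl (met s)).
  - by apply/measurable_EFinP; exact: (measurableT_comp mpsi (met s)).
  - exists [set w | N (e w + s)]; split => //.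
      by have := met s measurableT _ mN; rewrite setTI.
    move=> w /= ne; apply: subN => /= h; apply: ne => _; by rewrite h.
have /= [r r0 hr] := lo eta eta0.
apply: (@monotone_linear_approx _ _ (fun s => \int[P]_w psi (e w + s)) kappa r) => //.
- move=> s t sk tk st; apply: le_Rintegral => //; [exact: idl|exact: idl|].
  by move=> w _; apply: dlmono; rewrite lerD2l.
- move=> a b ab; have [s [as_ sb Ps]] := ae_dense aeN ab.
  by exists s; split => //; exact: eqN.
- by move=> s sr; apply: hr; rewrite /ball_/= sub0r normrN.
Qed.
End MeanShift.

(** * Hilbert spaces of functions *)

(** The kernel is left out because the same facts are needed for the regularised inner product, for
    which [K] is not the reproducing kernel. *)
Record is_hilbert {R : realType} {S : Type} (H : set (S -> R))
    (ip : (S -> R) -> (S -> R) -> R) : Prop := {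
  hilbert0 : H (fun=> 0) ;
  hilbert_lin : forall a f g, H f -> H g -> H (fun s => a * f s + g s) ;
  hilbert_ipC : forall f g, H f -> H g -> ip f g = ip g f ;
  hilbert_ip_lin : forall a f g h, H f -> H g -> H h ->
    ip (fun s => a * f s + g s) h = a * ip f h + ip g h ;
  hilbert_ip_gt0 : forall f, H f -> f <> (fun=> 0) -> 0 < ip f f ;
  hilbert_complete : forall u : nat -> S -> R, (forall n, H (u n)) ->
    (forall e : R, 0 < e -> exists N, forall m n, (N <= m)%N -> (N <= n)%N ->
       ip_norm ip (u m \- u n) < e) ->
    exists2 f : S -> R, H f & ip_norm ip (u n \- f) @[n --> \oo] --> (0 : R) }.

Lemma rkhs_is_hilbert {R : realType} {S : Type} (K : S -> S -> R)
    (H : set (S -> R)) ip : is_rkhs K H ip -> is_hilbert H ip.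
Proof. by case=> *; split. Qed.

Lemma quadratic_ge0 {R : realType} (a b c : R) : 0 <= c ->
  (forall t, 0 <= a + t * (b *+ 2) + t ^+ 2 * c) -> b ^+ 2 <= a * c.
Proof.
rewrite le_eqVlt => /orP[/eqP<- h|c0 h].
  rewrite mulr0; have [->|b0] := eqVneq b 0; first by rewrite expr0n.
  (* With [c = 0] the expression is affine in [t], and this [t] would give it the value [-1]. *)
  have := h (- (a + 1) / (b *+ 2)).
  by rewrite divfK ?mulrn_eq0// mulr0 addr0; lra.
have := h (- b / c).
have -> : a + - b / c * (b *+ 2) + (- b / c) ^+ 2 * c = (a * c - b ^+ 2) / c.
  by field; rewrite gt_eqF.
by rewrite pmulr_lge0 ?invr_gt0// subr_ge0.
Qed.

Section Hilbert.
Context {R : realType} {S : Type}.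
Variables (H : set (S -> R)) (ip : (S -> R) -> (S -> R) -> R).
Hypothesis hH : is_hilbert H ip.
Implicit Types (f g h u : S -> R) (a : R).

Let H0 := hilbert0 hH.
Let Hlin := hilbert_lin hH.

Lemma hilbertZ a f : H f -> H (fun s => a * f s).
Proof.
move=> Hf; have := Hlin a Hf H0.
by congr (H _); apply/funext => s; rewrite addr0.
Qed.

Lemma hilbertD f g : H f -> H g -> H (fun s => f s + g s).
Proof.
move=> Hf Hg; have := Hlin 1 Hf Hg.
by congr (H _); apply/funext => s; rewrite mul1r.
Qed.

Lemma hilbertB f g : H f -> H g -> H (fun s => f s - g s).
Proof.
move=> Hf Hg; have := Hlin (-1) Hg Hf.
by congr (H _); apply/funext => s; rewrite mulN1r addrC.
Qed.

Lemma ip_lin_l a f g h : H f -> H g -> H h ->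
  ip (fun s => a * f s + g s) h = a * ip f h + ip g h.
Proof. exact: hilbert_ip_lin. Qed.

Lemma ipC f g : H f -> H g -> ip f g = ip g f.
Proof. exact: hilbert_ipC. Qed.

Lemma ipD_l f g h : H f -> H g -> H h ->
  ip (fun s => f s + g s) h = ip f h + ip g h.
Proof.
move=> Hf Hg Hh; rewrite -[ip f h]mul1r -ip_lin_l//.
by congr ip; apply/funext => s; rewrite mul1r.
Qed.

Lemma ip0_l h : H h -> ip (fun=> 0) h = 0.
Proof.
move=> Hh; have := ip_lin_l 1 H0 H0 Hh.
have -> : (fun s : S => 1 * 0 + 0 : R) = fun=> 0.
  by apply/funext => s; rewrite mulr0 addr0.
by rewrite mul1r; lra.
Qed.

Lemma ipZ_l a f h : H f -> H h -> ip (fun s => a * f s) h = a * ip f h.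
Proof.
move=> Hf Hh; rewrite -[RHS]addr0 -(ip0_l Hh) -ip_lin_l//.
by congr ip; apply/funext => s; rewrite addr0.
Qed.

Lemma ipB_l f g h : H f -> H g -> H h ->
  ip (fun s => f s - g s) h = ip f h - ip g h.
Proof.
move=> Hf Hg Hh; rewrite addrC -mulN1r -ip_lin_l//.
by congr ip; apply/funext => s; rewrite mulN1r addrC.
Qed.

Lemma ipD_r f g h : H f -> H g -> H h ->
  ip h (fun s => f s + g s) = ip h f + ip h g.
Proof.
move=> Hf Hg Hh.
by rewrite ipC ?ipD_l// ?(ipC Hf) ?(ipC Hg)//; exact: hilbertD.
Qed.

Lemma ipZ_r a f h : H f -> H h -> ip h (fun s => a * f s) = a * ip h f.
Proof.
move=> Hf Hh; rewrite ipC ?ipZ_l// ?(ipC Hf)//; exact: hilbertZ.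
Qed.

Lemma ipB_r f g h : H f -> H g -> H h ->
  ip h (fun s => f s - g s) = ip h f - ip h g.
Proof.
move=> Hf Hg Hh.
by rewrite ipC ?ipB_l// ?(ipC Hf) ?(ipC Hg)//; exact: hilbertB.
Qed.

Lemma ip_ge0 f : H f -> 0 <= ip f f.
Proof.
move=> Hf; have [->|/eqP f0] := pselect (f = fun=> 0); first by rewrite ip0_l.
by apply/ltW/(hilbert_ip_gt0 hH) => //; exact/eqP.
Qed.

Lemma ip_sqrD f g : H f -> H g ->
  ip (fun s => f s + g s) (fun s => f s + g s) = ip f f + ip f g *+ 2 + ip g g.
Proof.
move=> Hf Hg; have Hfg := hilbertD Hf Hg.
by rewrite ipD_l// !ipD_r// (ipC Hg Hf); ring.
Qed.

Lemma ip_sqrB f g : H f -> H g ->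
  ip (fun s => f s - g s) (fun s => f s - g s) = ip f f - ip f g *+ 2 + ip g g.
Proof.
move=> Hf Hg; have Hfg := hilbertB Hf Hg.
by rewrite ipB_l// !ipB_r// (ipC Hg Hf); ring.
Qed.

Lemma ip_CS f g : H f -> H g -> ip f g ^+ 2 <= ip f f * ip g g.
Proof.
move=> Hf Hg; apply: quadratic_ge0; first exact: ip_ge0.
move=> t; have Hg' := hilbertZ t Hg.
have := ip_ge0 (hilbertD Hf Hg'); rewrite ip_sqrD// ipZ_r// ipZ_l// ipZ_r//.
by congr (_ <= _); ring.
Qed.

Lemma ip_norm_ge0 f : 0 <= ip_norm ip f.
Proof. exact: sqrtr_ge0. Qed.

Lemma sqr_ip_norm f : H f -> ip_norm ip f ^+ 2 = ip f f.
Proof. by move=> Hf; rewrite sqr_sqrtr// ip_ge0. Qed.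

Lemma ip_le_norm f g : H f -> H g -> `|ip f g| <= ip_norm ip f * ip_norm ip g.
Proof.
move=> Hf Hg; rewrite -sqrtrM ?ip_ge0// -sqrtr_sqr ler_wsqrtr//.
exact: ip_CS.
Qed.

(** The representer is obtained by minimising the quadratic functional [J f = ip f f - 2 * l f],
    whose derivative vanishes exactly where [ip f] equals [l]. *)
Lemma riesz (l : (S -> R) -> R) (C : R) :
  (forall a f g, H f -> H g -> l (fun s => a * f s + g s) = a * l f + l g) ->
  (forall f, H f -> `|l f| <= C * ip_norm ip f) ->
  exists2 k, H k & forall g, H g -> ip k g = l g.
Proof.
move=> llin lC.
have lZ a f : H f -> l (fun s => a * f s) = a * l f.
  move=> Hf; have l0 : l (fun=> 0) = 0.
    have := llin 1 _ _ H0 H0.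
    have -> : (fun s : S => 1 * 0 + 0 : R) = fun=> 0.
      by apply/funext => s; rewrite mulr0 addr0.
    by rewrite mul1r; lra.
  rewrite -[RHS]addr0 -l0 -llin//.
  by congr l; apply/funext => s; rewrite addr0.
have lD f g : H f -> H g -> l (fun s => f s + g s) = l f + l g.
  move=> Hf Hg; rewrite -[l f]mul1r -llin//.
  by congr l; apply/funext => s; rewrite mul1r.
pose J f := ip f f - l f *+ 2.
have JD f g t : H f -> H g ->
    J (fun s => f s + t * g s) = J f + t * ((ip f g - l g) *+ 2) + t ^+ 2 * ip g g.
  move=> Hf Hg; have Htg := hilbertZ t Hg.
  by rewrite /J ip_sqrD// lD// lZ// ipZ_r// ipZ_l// ipZ_r//; ring.
have Jlb f : H f -> - C ^+ 2 <= J f.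
  move=> Hf; have := lC f Hf; rewrite /J -sqr_ip_norm// ler_norml => /andP[_ h].
  have := sqr_ge0 (ip_norm ip f - C); rewrite sqrrB; lra.
pose E := [set J f | f in H].
have hE : has_inf E.
  split; first by exists (J (fun=> 0)); exists (fun=> 0).
  by exists (- C ^+ 2) => _ [f Hf <-]; exact: Jlb.
have Jinf f : H f -> inf E <= J f.
  by move=> Hf; apply: ge_inf; [exact: hE.2|exists f].
have /choice[u hu] : forall n, exists f, H f /\ J f < inf E + n.+1%:R^-1.
  move=> n; have n0 : 0 < n.+1%:R^-1 :> R by rewrite invr_gt0 ltr0n.
  by have [_ [f Hf <-] lt] := inf_adherent n0 hE; exists f.
have Hu n : H (u n) by case: (hu n).
have uJ n : J (u n) < inf E + n.+1%:R^-1 by case: (hu n).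
(* Parallelogram identity: [J] at the midpoint of [u m] and [u n] is at least the infimum. *)
have cauchy m n : ip_norm ip (u m \- u n) ^+ 2 <= 2 * (m.+1%:R^-1 + n.+1%:R^-1).
  rewrite sqr_ip_norm; last exact: hilbertB.
  rewrite (ip_sqrB (Hu m) (Hu n)).
  have Hmn := hilbertD (Hu m) (Hu n).
  have := Jinf _ (hilbertZ (1 / 2) Hmn).
  rewrite {1}/J ipZ_l//; last exact: hilbertZ.
  rewrite ipZ_r// ip_sqrD// lZ// lD//.
  have := uJ m; have := uJ n; rewrite /J; move: (n.+1%:R^-1) (m.+1%:R^-1) => rn rm; lra.
have [f Hf cf] : exists2 f, H f & ip_norm ip (u n \- f) @[n --> \oo] --> (0 : R).
  apply: (hilbert_complete hH) => // e e0.
  have e20 : 0 < e ^+ 2 / 4 by rewrite divr_gt0// exprn_gt0.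
  have [N _ hN] := near_infty_natSinv_lt (PosNum e20).
  exists N => m n Nm Nn.
  rewrite -(@ltr_pXn2r _ 2)// ?nnegrE ?ip_norm_ge0 ?ltW//.
  apply: (le_lt_trans (cauchy m n)).
  have := hN m Nm; have := hN n Nn; rewrite /=.
  by move: (n.+1%:R^-1) (m.+1%:R^-1) => rn rm; lra.
exists f => // g Hg.
(* Moving from the near-minimiser [u n] in the direction [g] gains at most [1 / (n + 1)]; the
   discriminant of this quadratic in the step bounds its slope at 0. *)
have b n : (ip (u n) g - l g) ^+ 2 <= n.+1%:R^-1 * ip g g.
  apply: quadratic_ge0; first exact: ip_ge0.
  move=> t; have := Jinf _ (hilbertD (Hu n) (hilbertZ t Hg)).
  rewrite JD//; have := uJ n; move: (n.+1%:R^-1) => rn; lra.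
have c n : `|ip (u n) g - ip f g| <= ip_norm ip (u n \- f) * ip_norm ip g.
  rewrite -ipB_l//; apply: ip_le_norm => //; exact: hilbertB.
pose v n := (ip_norm ip (u n \- f) * ip_norm ip g) ^+ 2 *+ 2
  + (harmonic n * ip g g) *+ 2.
have v0 : v n @[n --> \oo] --> (0 : R).
  rewrite [X in _ --> X](_ : _ = (0 * ip_norm ip g) ^+ 2 *+ 2 + (0 * ip g g) *+ 2).
    apply: cvgD; apply: cvgMn; last exact: cvgMl cvg_harmonic.
    by rewrite !expr2; apply: cvgM; apply: cvgMl.
  by rewrite !mul0r expr0n !mul0rn addr0.
have le n : (ip f g - l g) ^+ 2 <= v n.
  have h1 := b n; have h2 : (ip (u n) g - ip f g) ^+ 2
      <= (ip_norm ip (u n \- f) * ip_norm ip g) ^+ 2.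
    by rewrite -real_normK ?num_real// lerXn2r// ?nnegrE ?mulr_ge0 ?ip_norm_ge0.
  rewrite /v /harmonic/=; move: h1 h2.
  move: ((ip_norm ip _ * _) ^+ 2) (n.+1%:R^-1 * _) => X Y.
  have := sqr_ge0 ((ip (u n) g - ip f g) + (ip (u n) g - l g)).
  move: (ip (u n) g) (ip f g) (l g) => p q r.
  lra.
apply/eqP; rewrite -subr_eq0 -sqrf_eq0 eq_le sqr_ge0 andbT.
rewrite -(cvg_lim _ v0)//; apply: limr_ge; first by apply/cvg_ex; exists 0.
by apply: nearW => n; exact: le.
Qed.
End Hilbert.

(** * Symmetrisation and contraction over a finite probability space *)

Section Contraction.
Context {R : realType} {T : Type} (t0 : T) {F : finType}.
Variables (p : F -> R) (xi l : F -> T -> R).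
Hypothesis p0 : forall z, 0 <= p z.
Hypothesis p1 : \sum_z p z = 1.

Definition bounded_on (B : T -> R) := exists M, forall g, `|B g| <= M.

Hypothesis xi_bounded : forall z, bounded_on (xi z).
Hypothesis l_bounded : forall z, bounded_on (l z).
Hypothesis xi_l : forall z g g', `|xi z g - xi z g'| <= `|l z g - l z g'|.

Definition sup_on (B : T -> R) : R := sup (range B).

Lemma sup_on_ub B g : bounded_on B -> B g <= sup_on B.
Proof.
move=> [M BM]; apply: ub_le_sup; last by exists g.
by exists M => _ [h _ <-]; rewrite (le_trans (ler_norm _)).
Qed.

Lemma sup_on_le B c : (forall g, B g <= c) -> sup_on B <= c.
Proof.
by move=> Bc; apply: ge_sup; [exists (B t0); exists t0|move=> _ [g _ <-]].
Qed.

Lemma bounded_onD B B' : bounded_on B -> bounded_on B' ->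
  bounded_on (fun g => B g + B' g).
Proof.
by move=> [M BM] [M' BM']; exists (M + M') => g; rewrite (le_trans (ler_normD _ _))// lerD.
Qed.

Lemma bounded_onZ c B : bounded_on B -> bounded_on (fun g => c * B g).
Proof. by move=> [M BM]; exists (`|c| * M) => g; rewrite normrM ler_wpM2l. Qed.

Lemma bounded_onB B B' : bounded_on B -> bounded_on B' ->
  bounded_on (fun g => B g - B' g).
Proof.
move=> bB bB'; have := bounded_onD bB (bounded_onZ (-1) bB').
by congr bounded_on; apply/funext => g; rewrite mulN1r.
Qed.

Lemma bounded_on_sum (I : Type) (r : seq I) (f : I -> T -> R) :
  (forall i, bounded_on (f i)) -> bounded_on (fun g => \sum_(i <- r) f i g).
Proof.
move=> bf; elim: r => [|i r IH].
  by exists 0 => g; rewrite big_nil normr0.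
have := bounded_onD (bf i) IH.
by congr bounded_on; apply/funext => g; rewrite big_cons.
Qed.

Definition xi_mean g : R := \sum_z p z * xi z g.

Lemma xi_mean_bounded : bounded_on xi_mean.
Proof. by apply: bounded_on_sum => z; exact: bounded_onZ. Qed.

(** The expected supremum of [B] plus [n] independent centred terms, integrated one draw at a time.
    The terms already drawn are stored in [B], which is what the inductions vary. *)
Fixpoint centered_sup n (B : T -> R) : R :=
  if n is n'.+1 then
    \sum_z p z * centered_sup n' (fun g => B g + (xi_mean g - xi z g))
  else sup_on B.

(* The Rademacher signs are averaged out explicitly. *)
Fixpoint signed_sup n (B : T -> R) : R :=
  if n is n'.+1 then
    \sum_z p z * (2^-1 * (signed_sup n' (fun g => B g + 2 * l z g) +
                          signed_sup n' (fun g => B g - 2 * l z g)))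
  else sup_on B.

(** The left side is a supremum over pairs of [B g + B g' + 2 * (xi z g - xi z g')]. The last
    difference is at most [|l z g - l z g'|], and the sign of [l z g - l z g'] tells which of [g],
    [g'] is to be used with the plus sign on the right. *)
Lemma sup_on_swap B z : bounded_on B ->
  sup_on (fun g => B g + 2 * xi z g) + sup_on (fun g => B g - 2 * xi z g) <=
  sup_on (fun g => B g + 2 * l z g) + sup_on (fun g => B g - 2 * l z g).
Proof.
move=> bB; set c := (X in _ <= X).
have bp : bounded_on (fun g => B g + 2 * l z g).
  by apply: bounded_onD => //; exact: bounded_onZ.
have bm : bounded_on (fun g => B g - 2 * l z g).
  by apply: bounded_onB => //; exact: bounded_onZ.
have pair g g' : B g + 2 * xi z g + (B g' - 2 * xi z g') <= c.
  have := le_trans (ler_norm _) (xi_l z g g').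
  have := sup_on_ub g bp; have := sup_on_ub g' bm.
  have := sup_on_ub g' bp; have := sup_on_ub g bm.
  rewrite /c; move: (sup_on _) (sup_on _) => s1 s2.
  by have [h|h] := ger0P (l z g - l z g'); lra.
rewrite -lerBrDr; apply: sup_on_le => g.
rewrite lerBrDr -lerBrDl; apply: sup_on_le => g'.
by rewrite lerBrDl.
Qed.

(** Symmetrisation without a ghost sample: [B + (mean - xi)] is half the sum of [B + 2 * mean] and
    [B - 2 * xi], and the supremum of a mean is at most the mean of the suprema. This is the origin
    of the factor 2 in [signed_sup]. The contraction [sup_on_swap] then replaces [xi] by [l]. *)
Lemma one_step B : bounded_on B ->
  \sum_z p z * sup_on (fun g => B g + (xi_mean g - xi z g)) <=
  \sum_z p z * (2^-1 * (sup_on (fun g => B g + 2 * l z g) +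
                        sup_on (fun g => B g - 2 * l z g))).
Proof.
move=> bB.
pose U z := sup_on (fun g => B g + 2 * xi z g).
pose V z := sup_on (fun g => B g - 2 * xi z g).
have bU z : bounded_on (fun g => B g + 2 * xi z g).
  by apply: bounded_onD => //; exact: bounded_onZ.
have bV z : bounded_on (fun g => B g - 2 * xi z g).
  by apply: bounded_onB => //; exact: bounded_onZ.
have step z : sup_on (fun g => B g + (xi_mean g - xi z g)) <=
    2^-1 * ((\sum_w p w * U w) + V z).
  apply: sup_on_le => g.
  have h1 : B g + 2 * xi_mean g <= \sum_w p w * U w.
    have -> : B g = \sum_z p z * B g by rewrite -mulr_suml p1 mul1r.
    rewrite /xi_mean mulr_sumr -big_split/=.
    apply: ler_sum => w _; rewrite mulrCA -mulrDr ler_wpM2l//.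
    exact: (sup_on_ub g (bU w)).
  by have := sup_on_ub g (bV z); rewrite -/(V z); lra.
have -> : \sum_z p z * (2^-1 * (sup_on (fun g => B g + 2 * l z g) +
                        sup_on (fun g => B g - 2 * l z g))) =
  2^-1 * \sum_z p z * (sup_on (fun g => B g + 2 * l z g) +
                        sup_on (fun g => B g - 2 * l z g)).
  by rewrite mulr_sumr; apply: eq_bigr => z _; rewrite mulrCA.
apply: (@le_trans _ _ (2^-1 * \sum_z p z * (U z + V z))).
  apply: (@le_trans _ _ (\sum_z p z * (2^-1 * ((\sum_w p w * U w) + V z)))).
    by apply: ler_sum => z _; rewrite ler_wpM2l.
  under eq_bigr do rewrite mulrCA mulrDr.
  rewrite -mulr_sumr big_split/= -mulr_suml p1 mul1r -big_split/=.
  by under [in leRHS]eq_bigr do rewrite mulrDr.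
rewrite ler_pM2l ?invr_gt0// ler_sum// => z _.
by rewrite ler_wpM2l// sup_on_swap.
Qed.

(** Averages over independent draws commute, so the centred draw can be moved inside all signed
    ones, down to a bare supremum where [one_step] applies. *)
Lemma signed_sup_step n B : bounded_on B ->
  \sum_z p z * signed_sup n (fun g => B g + (xi_mean g - xi z g)) <=
  signed_sup n.+1 B.
Proof.
elim: n B => [B|n IH B bB]; first exact: one_step.
have -> : \sum_z p z * signed_sup n.+1 (fun g => B g + (xi_mean g - xi z g)) =
  \sum_w p w * (2^-1 * (
    (\sum_z p z * signed_sup n (fun g => (B g + 2 * l w g) + (xi_mean g - xi z g)))
  + (\sum_z p z * signed_sup n (fun g => (B g - 2 * l w g) + (xi_mean g - xi z g))))).
  rewrite /=; under eq_bigr do rewrite mulr_sumr.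
  rewrite exchange_big/=; apply: eq_bigr => w _.
  rewrite mulrDr mulrDr !mulr_sumr -big_split/=; apply: eq_bigr => z _.
  have sw c : signed_sup n (fun g => B g + (xi_mean g - xi z g) + c * l w g) =
      signed_sup n (fun g => B g + c * l w g + (xi_mean g - xi z g)).
    by congr signed_sup; apply/funext => g; ring.
  have sw' : signed_sup n (fun g => B g + (xi_mean g - xi z g) - 2 * l w g) =
      signed_sup n (fun g => B g - 2 * l w g + (xi_mean g - xi z g)).
    by congr signed_sup; apply/funext => g; ring.
  by rewrite sw sw'; ring.
rewrite [leRHS]/=; apply: ler_sum => w _; rewrite ler_wpM2l// ler_pM2l ?invr_gt0//.
apply: lerD; apply: IH.
- by apply: bounded_onD => //; exact: bounded_onZ.
- by apply: bounded_onB => //; exact: bounded_onZ.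
Qed.

Lemma rademacher_contraction n B : bounded_on B -> centered_sup n B <= signed_sup n B.
Proof.
elim: n B => [//|n IH B bB].
apply: le_trans (signed_sup_step n bB) => /=.
apply: ler_sum => z _; rewrite ler_wpM2l// IH//.
apply: bounded_onD => //; apply: bounded_onB => //; exact: xi_mean_bounded.
Qed.

End Contraction.

Section HilbertContraction.
Context {R : realType} {T : Type} (t0 : T) {F : finType} {S : Type}.
Variables (p : F -> R) (l : F -> T -> R).
Hypothesis p0 : forall z, 0 <= p z.
Hypothesis p1 : \sum_z p z = 1.
Variables (H : set (S -> R)) (ip : (S -> R) -> (S -> R) -> R).
Hypothesis hH : is_hilbert H ip.
Variables (val : T -> S -> R) (delta theta A : R) (k : F -> S -> R).
Hypothesis theta0 : 0 < theta.
Hypothesis delta0 : 0 <= delta.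
Hypothesis val_ball : forall g, H (val g) /\ ip_norm ip (val g) <= delta.
Hypothesis Hk : forall z, H (k z).
Hypothesis lE : forall z g, l z g = ip (val g) (k z).
Hypothesis kA : \sum_z p z * ip (k z) (k z) <= A.

(** A linear functional is at most [delta * ||V||] on the ball, and
    [||V|| <= (theta + ||V||^2 / theta) / 2]. The right side is affine in [||V||^2], so no
    inequality for square roots of averages is needed. The cross terms of [||V + 2 k||^2] and
    [||V - 2 k||^2] cancel, and each draw adds [4 * A] at most. The value of [theta] is optimised
    later. *)
Lemma signed_sup_hilbert n V : H V ->
  signed_sup p l n (fun g => ip (val g) V) <=
  delta * (theta + (ip V V + n%:R * (4 * A)) / theta) / 2.
Proof.
have Hval g : H (val g) by case: (val_ball g).
elim: n V => [|n IH] V HV /=.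
  apply: (sup_on_le t0) => g.
  apply: (le_trans (ler_norm _)); apply: (le_trans (ip_le_norm hH (Hval g) HV)).
  apply: (@le_trans _ _ (delta * ip_norm ip V)).
    by rewrite ler_wpM2r ?ip_norm_ge0//; case: (val_ball g).
  rewrite mul0r addr0 -mulrA ler_wpM2l// -(sqr_ip_norm hH HV).
  rewrite ler_pdivlMr// -(ler_pM2r theta0) mulrDl divfK ?gt_eqF//.
  have := sqr_ge0 (ip_norm ip V - theta); rewrite sqrrB; nra.
pose b V := delta * (theta + (ip V V + n%:R * (4 * A)) / theta) / 2.
apply: (@le_trans _ _ (\sum_z p z * (delta * (theta +
   (ip V V + 4 * ip (k z) (k z) + n%:R * (4 * A)) / theta) / 2))).
  apply: ler_sum => z _; rewrite ler_wpM2l//.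
  have H2k := hilbertZ hH 2 (Hk z).
  have e1 : (fun g => ip (val g) V + 2 * l z g) =
      (fun g => ip (val g) (fun s => V s + 2 * k z s)).
    by apply/funext => g; rewrite (ipD_r hH HV H2k)// (ipZ_r hH)// lE.
  have e2 : (fun g => ip (val g) V - 2 * l z g) =
      (fun g => ip (val g) (fun s => V s - 2 * k z s)).
    by apply/funext => g; rewrite (ipB_r hH HV H2k)// (ipZ_r hH)// lE.
  rewrite e1 e2.
  have := IH _ (hilbertD hH HV H2k); have := IH _ (hilbertB hH HV H2k).
  rewrite (ip_sqrD hH HV H2k) (ip_sqrB hH HV H2k) (ipZ_r hH _ (Hk z) HV).
  rewrite (ipZ_l hH _ (Hk z) H2k) (ipZ_r hH _ (Hk z) (Hk z)).
  move=> h1 h2; have := lerD h1 h2.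
  move: (signed_sup _ _ _ _) (signed_sup _ _ _ _) => s1 s2.
  by move: (theta^-1) => th; lra.
pose c0 := delta * (theta + (ip V V + n%:R * (4 * A)) / theta) / 2.
pose c1 := delta * 2 / theta.
have -> : \sum_z p z * (delta * (theta + (ip V V + 4 * ip (k z) (k z) +
      n%:R * (4 * A)) / theta) / 2) = c0 + c1 * \sum_z p z * ip (k z) (k z).
  have -> : c0 = \sum_z p z * c0 by rewrite -mulr_suml p1 mul1r.
  rewrite mulr_sumr -big_split/=.
  by apply: eq_bigr => z _; rewrite /c0 /c1; field; rewrite gt_eqF.
have c10 : 0 <= c1 by rewrite /c1 !mulr_ge0// invr_ge0 ltW.
have := ler_wpM2l c10 kA; rewrite /c0 /c1.
have -> : n.+1%:R = n%:R + 1 :> R by rewrite natr1.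
by move: (theta^-1) => th; lra.
Qed.

End HilbertContraction.

(** * Markov's inequality for the supremum of the deviations *)

Section FiniteDeviation.
Context {R : realType} {T : Type} (t0 : T) {F : finType}.
Variables (p : F -> R) (xi : F -> T -> R).
Hypothesis p0 : forall z, 0 <= p z.
Hypothesis xi_bounded : forall z, bounded_on (xi z).
Hypothesis xi0 : forall z, xi z t0 = 0.

Fixpoint words n : seq (seq F) :=
  if n is n'.+1 then [seq z :: s | z <- enum F, s <- words n'] else [:: [::]].

Lemma mem_words s : s \in words (size s).
Proof.
elim: s => [|z s IH] /=; first by rewrite inE.
by apply/allpairsP; exists (z, s); rewrite mem_enum.
Qed.

Definition weight s : R := \prod_(z <- s) p z.

Definition deviation s g : R := \sum_(z <- s) (xi_mean p xi g - xi z g).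

(** Turns the iterated average into one sum over samples, to which Markov's inequality applies. *)
Lemma centered_supE n B : centered_sup p xi n B =
  \sum_(s <- words n) weight s * sup_on (fun g => B g + deviation s g).
Proof.
elim: n B => [|n IH] B /=.
  rewrite big_seq1 /weight big_nil mul1r; congr sup_on; apply/funext => g.
  by rewrite /deviation big_nil addr0.
rewrite big_allpairs_dep/= big_enum/=; apply: eq_bigr => z _.
rewrite IH mulr_sumr; apply: eq_bigr => s _.
rewrite /weight big_cons mulrA; congr (_ * sup_on _); apply/funext => g.
by rewrite /deviation big_cons -!addrA.
Qed.

Lemma weight_ge0 s : 0 <= weight s.
Proof. by rewrite /weight; apply: prodr_ge0 => z _; exact: p0. Qed.

Lemma deviation_bounded s : bounded_on (deviation s).
Proof.
by apply: bounded_on_sum => z; apply: bounded_onB => //; exact: xi_mean_bounded.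
Qed.

Lemma deviation0 s : deviation s t0 = 0.
Proof.
rewrite /deviation big1// => z _; rewrite xi0 subr0 /xi_mean big1// => w _.
by rewrite xi0 mulr0.
Qed.

(** Samples outside the event contribute a nonnegative amount, because the deviation vanishes at
    [t0] and the supremum is therefore at least 0. *)
Lemma deviation_markov n t : 0 < t ->
  \sum_(s <- words n | `[< exists g, t < deviation s g >]) weight s <=
  centered_sup p xi n (fun=> 0) / t.
Proof.
move=> tgt0; rewrite ler_pdivlMr// centered_supE mulr_suml big_mkcond/=.
apply: ler_sum => s _.
have -> : (fun g => 0 + deviation s g) = deviation s by apply/funext => g; rewrite add0r.
have ub g := sup_on_ub g (deviation_bounded s).
case: ifPn => [/asboolP[g tg]|_].
- by rewrite ler_wpM2l ?weight_ge0// (le_trans (ltW tg)).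
- by rewrite mulr_ge0 ?weight_ge0// -(deviation0 s).
Qed.

Context {dO : measure_display} {Om : measurableType dO} (P : probability Om R).
Variable zeta : nat -> Om -> F.
Hypothesis zeta_law : forall s,
  measurable [set w | [seq zeta i w | i <- iota 0 (size s)] = s] /\
  P [set w | [seq zeta i w | i <- iota 0 (size s)] = s] = (weight s)%:E.

Lemma measure_bigsetU_le (I : eqType) (r : seq I) (Q : pred I)
    (A : I -> set Om) (a : I -> R) :
  (forall i, i \in r -> measurable (A i) /\ P (A i) = (a i)%:E) ->
  measurable (\big[setU/set0]_(i <- r | Q i) A i) /\
  (P (\big[setU/set0]_(i <- r | Q i) A i) <= (\sum_(i <- r | Q i) a i)%:E)%E.
Proof.
elim: r => [|i r IH] hA; first by rewrite !big_nil measure0.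
have [|mA PA] := IH; first by move=> j jr; apply: hA; rewrite inE jr orbT.
rewrite !big_cons; case: ifP => // _.
have [mi Pi] := hA i (mem_head _ _).
split; first exact: measurableU.
apply: (le_trans (measureU2 _ mi mA)).
by rewrite EFinD -Pi leeD2l.
Qed.

(** The exceptional event is a finite union over sample words, so it is measurable even though the
    supremum runs over an arbitrary class. *)
Lemma deviation_event n t : 0 < t -> exists E, [/\ measurable E,
  (P E <= (centered_sup p xi n (fun=> 0) / t)%:E)%E &
  forall w, ~ E w -> forall g,
    \sum_(i < n) (xi_mean p xi g - xi (zeta i w) g) <= t].
Proof.
move=> tgt0.
pose A s := [set w | [seq zeta i w | i <- iota 0 n] = s].
have size_words s : s \in words n -> size s = n.
  elim: n s {A} => [|n IH] s /=; first by rewrite inE => /eqP->.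
  by move/allpairsP => [[z s'] [/= _ /IH <- ->]].
have [|mE PE] := @measure_bigsetU_le _ (words n)
    (fun s => `[< exists g, t < deviation s g >]) A weight.
  by move=> s /size_words sn; rewrite /A -sn; exact: zeta_law.
exists (\big[setU/set0]_(s <- words n | `[< exists g, t < deviation s g >]) A s).
split => //.
  by apply: (le_trans PE); rewrite lee_fin deviation_markov.
move=> w nE g; rewrite leNgt; apply/negP => tg; apply: nE.
pose s := [seq zeta i w | i <- iota 0 n].
have sE : deviation s g = \sum_(i < n) (xi_mean p xi g - xi (zeta i w) g).
  rewrite /deviation big_map -{1}[n]subn0 -/(index_iota 0 n) big_mkord.
  by [].
have sw : s \in words n.
  by have := mem_words s; rewrite size_map size_iota.
rewrite (big_rem s)//= ifT; first by left.
by apply/asboolP; exists g; rewrite sE.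
Qed.

End FiniteDeviation.

(** * Finite-valued images of i.i.d. samples *)

Section FiniteValued.
Context {R : realType} {d : measure_display} {T : measurableType d}
  (Q : probability T R) {F : finType} (chi : T -> F).
Hypothesis chi_meas : forall a, measurable (chi @^-1` [set a]).

Definition fiber_prob (a : F) : R := fine (Q (chi @^-1` [set a])).

Lemma fiber_probE a : Q (chi @^-1` [set a]) = (fiber_prob a)%:E.
Proof. by rewrite /fiber_prob fineK// fin_num_measure. Qed.

Lemma fiber_prob_ge0 a : 0 <= fiber_prob a.
Proof. exact: fine_ge0. Qed.

Lemma fiber_prob_sum_seq (r : seq F) : uniq r ->
  measurable (chi @^-1` [set` r]) /\
  Q (chi @^-1` [set` r]) = (\sum_(a <- r) fiber_prob a)%:E.
Proof.
elim: r => [_|a r IH /= /andP[ar ur]].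
  by rewrite set_nil preimage_set0 big_nil measure0.
have [mr Qr] := IH ur.
have -> : [set` a :: r] = [set a] `|` [set` r].
  apply/seteqP; split => b /=; rewrite inE.
    by move=> /orP[/eqP->|]; [left|right].
  by move=> [->|->]; rewrite ?eqxx ?orbT.
rewrite preimage_setU big_cons EFinD -Qr -fiber_probE; split.
  exact: measurableU.
apply: measureU => //; apply/seteqP; split => // w [/= -> ].
by rewrite (negbTE ar).
Qed.

Lemma fiber_prob_sum1 : \sum_a fiber_prob a = 1.
Proof.
have [_] := fiber_prob_sum_seq (enum_uniq F).
have -> : chi @^-1` [set` enum F] = setT.
  by apply/seteqP; split => // w _ /=; rewrite mem_enum.
by rewrite probability_setT big_enum => -[].
Qed.

End FiniteValued.

Section JointLaw.
Context {R : realType} {dO : measure_display} {Om : measurableType dO}.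
Variable P : probability Om R.

Lemma sigma_generated_bigcap d (T : measurableType d) (X : nat -> Om -> T)
    (I : seq nat) (B : nat -> set T) : (forall i, measurable (B i)) ->
  sigma_generated X (\bigcap_(i in [set` I]) X i @^-1` B i).
Proof.
move=> mB; rewrite bigcap_seq.
pose G := \bigcup_i preimage_set_system [set: Om] (X i) measurable.
suff : @measurable _ (g_sigma_algebraType G)
  (\big[setI/[set: Om]]_(t <- I) X t @^-1` B t) by [].
elim: I => [|i I IH]; first by rewrite big_nil; exact: measurableT.
rewrite big_cons; apply: measurableI => //.
apply: sub_sigma_algebra; exists i => //.
by exists (B i) => //; rewrite setTI.
Qed.

Context {d1 d2 : measure_display} {T1 : measurableType d1}
  {T2 : measurableType d2}.
Variables (X : nat -> {mfun Om >-> T1}) (Y : nat -> {mfun Om >-> T2}).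
Variables (Q1 : probability T1 R) (Q2 : probability T2 R).
Hypothesis X_law : forall i B, measurable B -> P (X i @^-1` B) = Q1 B.
Hypothesis Y_law : forall i B, measurable B -> P (Y i @^-1` B) = Q2 B.
Hypothesis X_indep : mutually_independent P (fun i => X i).
Hypothesis Y_indep : mutually_independent P (fun i => Y i).
Hypothesis XY_indep : independent_sequences P (fun i => X i) (fun i => Y i).

Variables (F1 F2 : finType) (chi1 : T1 -> F1) (chi2 : T2 -> F2).
Hypothesis chi1_meas : forall a, measurable (chi1 @^-1` [set a]).
Hypothesis chi2_meas : forall a, measurable (chi2 @^-1` [set a]).

Definition pair_prob (z : F1 * F2) : R := fiber_prob Q1 chi1 z.1 * fiber_prob Q2 chi2 z.2.

Lemma pair_prob_ge0 z : 0 <= pair_prob z.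
Proof. by rewrite mulr_ge0 ?fiber_prob_ge0. Qed.

Lemma pair_prob_sumE (h : F1 * F2 -> R) : \sum_z pair_prob z * h z =
  \sum_a fiber_prob Q1 chi1 a * \sum_b fiber_prob Q2 chi2 b * h (a, b).
Proof.
rewrite [LHS](eq_bigr (fun z => (fun a b => fiber_prob Q1 chi1 a * (fiber_prob Q2 chi2 b * h (a, b))) z.1 z.2)).
  rewrite -(pair_bigA _ (fun a b => fiber_prob Q1 chi1 a * (fiber_prob Q2 chi2 b * h (a, b))))/=.
  by apply: eq_bigr => a _; rewrite mulr_sumr.
by move=> [a b] _; rewrite /pair_prob/= mulrA.
Qed.

Lemma pair_prob_sum1 : \sum_z pair_prob z = 1.
Proof.
have := pair_prob_sumE (fun=> 1).
under eq_bigr do rewrite mulr1.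
move=> ->; under eq_bigr do under eq_bigr do rewrite mulr1.
by under eq_bigr do rewrite fiber_prob_sum1// mulr1; exact: fiber_prob_sum1.
Qed.

(** The event is a condition on the [X i] intersected with one on the [Y i]. Independence of the two
    sequences separates them, and mutual independence factorises each. The empty word is treated
    apart because [nth] needs a default letter. *)
Lemma pair_law (s : seq (F1 * F2)) :
  let E := [set w | [seq (chi1 (X i w), chi2 (Y i w)) | i <- iota 0 (size s)] = s] in
  measurable E /\ P E = (weight pair_prob s)%:E.
Proof.
move=> E; case: s @E => [|z0 s0] E.
  have -> : E = [set: Om] by apply/seteqP.
  by rewrite /weight big_nil probability_setT; split.
move: (z0 :: s0) @E => {}s0 E; set s := s0 in E *.
pose I := iota 0 (size s).
pose B i := chi1 @^-1` [set (nth z0 s i).1].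
pose C i := chi2 @^-1` [set (nth z0 s i).2].
have mB i : measurable (B i) by exact: chi1_meas.
have mC i : measurable (C i) by exact: chi2_meas.
have EE : E = \bigcap_(i in [set` I]) X i @^-1` B i `&`
    \bigcap_(i in [set` I]) Y i @^-1` C i.
  apply/seteqP; split => w /=.
    move=> Ew; split => i /=; rewrite mem_iota add0n => /andP[_ ilt];
    by rewrite /B /C /= -Ew (nth_map 0%N) ?size_iota// nth_iota.
  move=> [hB hC]; apply: (@eq_from_nth _ z0); rewrite size_map size_iota//.
  move=> i ilt; rewrite (nth_map 0%N) ?size_iota// nth_iota//.
  have iI : i \in I by rewrite mem_iota.
  by rewrite (hB i iI) (hC i iI) -surjective_pairing.
have mI : measurable E.
  rewrite EE !bigcap_seq; apply: measurableI.
    elim: I {E EE} => [|i I IH]; first by rewrite big_nil; exact: measurableT.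
    rewrite big_cons; apply: measurableI => //.
    by rewrite -[X in measurable X]setTI; exact: measurable_funP.
  elim: I {E EE} => [|i I IH]; first by rewrite big_nil; exact: measurableT.
  rewrite big_cons; apply: measurableI => //.
  by rewrite -[X in measurable X]setTI; exact: measurable_funP.
split => //; rewrite EE XY_indep; last 2 first.
- exact: sigma_generated_bigcap.
- exact: sigma_generated_bigcap.
rewrite X_indep ?iota_uniq// Y_indep ?iota_uniq//.
rewrite /weight (big_nth z0) /index_iota subn0 -/I.
elim: I {E EE mI} => [|i I IH]; first by rewrite !big_nil mule1.
rewrite !big_cons EFinM -IH X_law// Y_law// /B /C !fiber_probE// /pair_prob EFinM.
by rewrite muleACA.
Qed.

End JointLaw.

(** * Finite measurable partitions *)

Lemma compact_set_type (T : topologicalType) (A : set T) :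
  compact A -> compact [set: A].
Proof.
move=> cA F PF _.
have PG : ProperFilter ((@set_val T A) @ F) by exact: fmap_proper_filter.
have GA : ((@set_val T A) @ F) A.
  by apply: (@filterS _ F _ setT) => //; [move=> t _; exact: set_valP|exact: filterT].
have [x [Ax clx]] := cA _ PG GA.
pose x' : A := exist _ x (mem_set Ax).
exists x'; split => // B C FB [D [[E oE <-] /= Ex EC]].
have : ((@set_val T A) @ F) (set_val @` B).
  by apply: (@filterS _ F _ B) => // t Bt; exists t.
move/clx => /(_ E) [].
  by move: Ex; rewrite set_valE/= => Ex; exact: open_nbhs_nbhs.
by move=> _ [[t Bt <-] Et]; exists t; split => //; exact: EC.
Qed.

Lemma continuous_borel_measurable (R : realType) (T : topologicalType) (x0 : T)
  (f : T -> R) : continuous f -> measurable_fun [set: borel x0] f.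
Proof.
move=> /continuousP cf.
apply: (measurability (@RGenOpens.G R)); first exact: RGenOpens.measurableE.
move=> _ [_ [a [b ->]] <-]; rewrite setTI.
by apply: sub_sigma_algebra; apply: cf; exact: interval_open.
Qed.

Section FinitePartition.
Context {d : measure_display} {T : measurableType d}.

(** A point is sent to the least index of a set that contains it, which makes the cover disjoint. *)
Lemma finite_partition n (U : nat -> set T) : (forall i, measurable (U i)) ->
  (forall x, exists2 i, (i < n)%N & U i x) ->
  exists chi : T -> 'I_n.+1, (forall a, measurable (chi @^-1` [set a])) /\
    (forall x, U (chi x) x).
Proof.
move=> mU covU.
have ex x : exists i, `[< U i x >].
  by have [i _ Ui] := covU x; exists i; exact/asboolP.
pose m x := ex_minn (ex x).
have mP x : U (m x) x /\ forall i, U i x -> (m x <= i)%N.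
  rewrite /m; case: ex_minnP => k /asboolP Uk mk; split => // i Ui.
  by apply: mk; exact/asboolP.
have mn x : (m x < n.+1)%N.
  have [i ilt Ui] := covU x; have [_ /(_ i Ui)] := mP x.
  by move=> /leq_ltn_trans -> //; exact: ltnW.
exists (fun x => Ordinal (mn x)); split; last by move=> x; case: (mP x).
move=> a.
have -> : (fun x => Ordinal (mn x)) @^-1` [set a] =
    U a `\` \bigcup_(i in `I_a) U i.
  apply/seteqP; split => x /=.
    move=> <- /=; have [Ux min] := mP x; split => // -[i /= ilt Ui].
    by have := min i Ui; rewrite leqNgt ilt.
  move=> [Ua nU]; apply: val_inj => /=; have [Ux min] := mP x.
  apply/eqP; rewrite eqn_leq min//= leqNgt; apply/negP => lt.
  by apply: nU; exists (m x).
by apply: measurableD => //; apply: bigcup_measurable.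
Qed.

Lemma finite_approximation (R : realType) (f : T -> R) (b h : R) :
  measurable_fun [set: T] f -> (forall x, `|f x| <= b) -> 0 < h ->
  exists (n : nat) (chi : T -> 'I_n.+1) (rep : 'I_n.+1 -> R),
    (forall a, measurable (chi @^-1` [set a])) /\
    (forall x, `|f x - rep (chi x)| <= h) /\ (forall a, `|rep a| <= b).
Proof.
move=> mf fb h0.
have b0 : 0 <= b := le_trans (normr_ge0 _) (fb point).
(* A grid of mesh [h] starting at [- b]; the minimum keeps every representative in [[- b, b]]. *)
pose rep0 i := Num.min b (- b + i%:R * h).
pose U i := [set x | `|f x - rep0 i| <= h].
pose n := (Num.truncn ((b + b) / h)).+1.
have [||chi [mchi Uchi]] := @finite_partition n U.
- move=> i; rewrite -[U i]setTI.
  have -> : U i = (fun x => f x - rep0 i) @^-1` `[- h, h].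
    by apply/seteqP; split => x; rewrite /U/= in_itv/= ler_norml.
  have : measurable_fun [set: T] (fun x => f x - rep0 i).
    by apply: measurable_funB.
  by apply => //; exact: measurable_itv.
- move=> x; have := fb x; rewrite ler_norml => /andP[fb1 fb2].
  have y0 : 0 <= (f x + b) / h by rewrite divr_ge0 ?(ltW h0)//; lra.
  exists (Num.truncn ((f x + b) / h)).
    by rewrite ltnS; apply: le_truncn; rewrite ler_pM2r ?invr_gt0// lerD2r.
  have := truncn_itv y0 => /andP[]; rewrite /U /rep0 /=.
  move: (Num.truncn _) => k; rewrite ler_pdivlMr// ltr_pdivrMr// -natr1.
  rewrite mulrDl mul1r; move: (k%:R * h) => kh ? ?.
  by rewrite minElt; case: ifP => ?; rewrite ler_norml; apply/andP; split; lra.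
exists n, chi, (fun a => rep0 a); split => //; split => // a.
rewrite ler_norml /rep0 ge_min lexx le_min andbT; apply/andP; split; first lra.
by rewrite lerDl mulr_ge0// ltW.
Qed.

End FinitePartition.

(** [D] need not be a metric: it will be the squared kernel distance, and once the difference of two
    diagonal values of [K]. *)
Lemma compact_partition (R : realType) (T : topologicalType) (x0 : T)
    (D : T -> T -> R) (h : R) : compact [set: T] ->
  (forall s, continuous (D s)) -> (forall s, D s s = 0) -> 0 < h ->
  exists (n : nat) (chi : T -> 'I_n.+1) (rep : 'I_n.+1 -> T),
    (forall a, measurable (chi @^-1` [set a] : set (borel x0))) /\
    (forall x, D (rep (chi x)) x < h).
Proof.
move=> cT cD D0 h0.
have oU s : open [set x | D s x < h].
  have -> : [set x | D s x < h] = D s @^-1` [set y | y < h] by [].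
  by move/continuousP: (cD s); apply; exact: open_lt.
pose Tp : ptopologicalType := HB.pack (Topological.sort T) (Topological.class T) (isPointed.Build T x0).
have : @compact Tp setT by exact: cT.
rewrite compact_cover => /(_ T setT (fun s => [set x | D s x < h])).
case=> [s _|x _|]; [exact: oU|by exists x => //=; rewrite D0|].
move=> I _ covI.
pose sq := finmap.enum_fset I.
pose U i : set (borel x0) := [set x | D (nth x0 sq i) x < h].
have [||chi [mchi Uchi]] := @finite_partition _ (borel x0) (size sq) U.
- by move=> i; apply: sub_sigma_algebra; exact: oU.
- move=> x; have [s /= sI Ds] := covI x Logic.I.
  exists (index s sq); first by rewrite index_mem.
  by rewrite /U/= nth_index.
by exists (size sq), chi, (fun a => nth x0 sq a).
Qed.

(** * Square-integrable functions *)

Section SquareIntegrable.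
Context {R : realType} {d : measure_display} {T : measurableType d}.
Variable Q : probability T R.
Implicit Types (f g h : T -> R) (a c : R).

Definition sq_int f := measurable_fun [set: T] f /\
  Q.-integrable [set: T] (EFin \o (fun x => f x ^+ 2)).

Lemma RintD f g : Q.-integrable [set: T] (EFin \o f) ->
  Q.-integrable [set: T] (EFin \o g) ->
  \int[Q]_x (f x + g x) = \int[Q]_x f x + \int[Q]_x g x.
Proof. by move=> fi gi; rewrite RintegralD. Qed.

Lemma RintZ a f : Q.-integrable [set: T] (EFin \o f) ->
  \int[Q]_x (a * f x) = a * \int[Q]_x f x.
Proof. by move=> fi; rewrite RintegralZl. Qed.

Lemma Rint_cst c : \int[Q]_x c = c.
Proof.
by rewrite /Rintegral integral_cst// [X in (_ * X)%E](@probability_setT _ _ _ Q) mule1.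
Qed.

Lemma le_Rint f g : Q.-integrable [set: T] (EFin \o f) ->
  Q.-integrable [set: T] (EFin \o g) -> (forall x, f x <= g x) ->
  \int[Q]_x f x <= \int[Q]_x g x.
Proof. by move=> fi gi fg; apply: le_Rintegral. Qed.

Lemma sq_int_mul f g : sq_int f -> sq_int g ->
  Q.-integrable [set: T] (EFin \o (fun x => f x * g x)).
Proof.
move=> [mf fi] [mg gi].
apply: (@integrable_bound _ _ _ _ _ (fun x => f x ^+ 2 + g x ^+ 2)).
- exact: measurable_funM.
- exact: integrable_add.
- move=> x; have := sqr_ge0 (f x + g x); have := sqr_ge0 (f x - g x).
  rewrite sqrrB sqrrD ler_norml => h1 h2.
  have := sqr_ge0 (f x); have := sqr_ge0 (g x) => ? ?.
  by apply/andP; split; lra.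
Qed.

Lemma sq_int_lin a f g : sq_int f -> sq_int g -> sq_int (fun x => a * f x + g x).
Proof.
move=> sf sg; have [mf fi] := sf; have [mg gi] := sg; split.
  by apply: measurable_funD => //; exact: measurable_funM.
have := integrable_add (integrable_scale (a ^+ 2) fi)
  (integrable_add (integrable_scale (a *+ 2) (sq_int_mul sf sg)) gi).
by congr (integrable _ _ (EFin \o _)); apply/funext => x; ring.
Qed.

Lemma sq_int_bounded f c : measurable_fun [set: T] f ->
  (forall x, `|f x| <= c) -> sq_int f.
Proof.
move=> mf fc; split => //.
apply: (@integrable_bound _ _ _ _ _ (fun=> c ^+ 2)).
- exact: measurable_funX.
- exact: integrable_const.
- move=> x; rewrite normrX lerXn2r// nnegrE//.
  exact: le_trans (fc x).
Qed.

Lemma sq_int_cst c : sq_int (fun=> c).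
Proof. exact: (@sq_int_bounded _ `|c|). Qed.

Lemma sq_int_integrable f : sq_int f -> Q.-integrable [set: T] (EFin \o f).
Proof.
move=> sf; have := sq_int_mul sf (sq_int_cst 1).
by congr (integrable _ _ (EFin \o _)); apply/funext => x; rewrite mulr1.
Qed.

Lemma sq_int_abs f : sq_int f -> sq_int (fun x => `|f x|).
Proof.
move=> [mf fi]; split; first exact: measurableT_comp.
by move: fi; congr (integrable _ _ (EFin \o _)); apply/funext => x; rewrite real_normK ?num_real.
Qed.

Lemma Rint_sqr_ge0 f : 0 <= \int[Q]_x (f x ^+ 2).
Proof. by apply: Rintegral_ge0 => x _; rewrite sqr_ge0. Qed.

Lemma Rint_sqr_lin a f g : sq_int f -> sq_int g ->
  \int[Q]_x ((a * f x + g x) ^+ 2) =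
  a ^+ 2 * \int[Q]_x (f x ^+ 2) + a * (\int[Q]_x (f x * g x)) *+ 2
  + \int[Q]_x (g x ^+ 2).
Proof.
move=> sf sg; have [mf fi] := sf; have [mg gi] := sg.
have i1 := integrable_scale (a ^+ 2) fi.
have i2 := integrable_scale (a *+ 2) (sq_int_mul sf sg).
rewrite -RintZ// -addrA -mulrnAl -RintZ; last exact: sq_int_mul.
rewrite -RintD// -RintD//; last exact: integrable_add.
by apply: eq_Rintegral => x _; ring.
Qed.

Lemma Rint_CS f g : sq_int f -> sq_int g ->
  (\int[Q]_x (f x * g x)) ^+ 2 <= \int[Q]_x (f x ^+ 2) * \int[Q]_x (g x ^+ 2).
Proof.
move=> sf sg; rewrite mulrC; apply: quadratic_ge0; first exact: Rint_sqr_ge0.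
move=> t; have := Rint_sqr_ge0 (fun x => t * f x + g x).
by rewrite Rint_sqr_lin//; congr (_ <= _); ring.
Qed.

Lemma Rint_CS_norm f g : sq_int f -> sq_int g ->
  `|\int[Q]_x (f x * g x)| <=
  Num.sqrt (\int[Q]_x (f x ^+ 2)) * Num.sqrt (\int[Q]_x (g x ^+ 2)).
Proof.
move=> sf sg; rewrite -sqrtrM ?Rint_sqr_ge0// -sqrtr_sqr ler_wsqrtr//.
exact: Rint_CS.
Qed.

Lemma Rint_sqrD2 f g : sq_int f -> sq_int g ->
  \int[Q]_x ((f x + g x) ^+ 2) <=
  2 * \int[Q]_x (f x ^+ 2) + 2 * \int[Q]_x (g x ^+ 2).
Proof.
move=> sf sg; have [mf fi] := sf; have [mg gi] := sg.
rewrite -!RintZ// -RintD; try exact: integrable_scale.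
apply: le_Rint.
- have [_] := sq_int_lin 1 sf sg.
  by congr (integrable _ _ (EFin \o _)); apply/funext => x; rewrite mul1r.
- by apply: integrable_add; exact: integrable_scale.
- by move=> x; have := sqr_ge0 (f x - g x); rewrite sqrrB sqrrD; lra.
Qed.

Lemma Lnorm2E f : sq_int f ->
  ('N[Q]_2%:E[EFin \o f])%E = (Num.sqrt (\int[Q]_x (f x ^+ 2)))%:E.
Proof.
move=> [mf fi].
rewrite unlock.
have -> : (\int[Q]_x `|(EFin \o f) x| `^ 2)%E = (\int[Q]_x (f x ^+ 2))%:E.
  rewrite /Rintegral fineK; last first.
    exact: integrable_fin_num.
  apply: eq_integral => x _ /=.
  by rewrite powR_mulrn// real_normK ?num_real.
by rewrite /= powR12_sqrt// Rint_sqr_ge0.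
Qed.

Lemma Lfun2P f : f \in Lfun Q 2%:E <-> sq_int f.
Proof.
split=> [lf|sf].
  split; last exact: Lfun2_integrable_sqr.
  by move: lf; rewrite inE => /andP[]; rewrite inE.
have [mf fi] := sf; rewrite inE; apply/andP; split; rewrite inE//=.
by rewrite /finite_norm Lnorm2E// ltry.
Qed.

End SquareIntegrable.

(** * Reproducing kernel Hilbert spaces *)

Section RKHS.
Context {R : realType} {T : topologicalType} (x0 : T).
Variables (K : T -> T -> R) (H : set (T -> R)) (ip : (T -> R) -> (T -> R) -> R).
Hypothesis T_compact : compact [set: T].
Hypothesis K_continuous : continuous (fun p : T * T => K p.1 p.2).
Hypothesis H_rkhs : is_rkhs K H ip.
Implicit Types (f g h : T -> R) (s x : T).

Let hH := rkhs_is_hilbert H_rkhs.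
Let HK s : H (K s) := rkhs_section H_rkhs s.

Lemma reproduce g s : H g -> g s = ip g (K s).
Proof. by move=> Hg; rewrite (rkhs_reproducing H_rkhs). Qed.

Lemma K_sym s x : K s x = K x s.
Proof. by rewrite (reproduce x (HK s)) (ipC hH)// -reproduce. Qed.

(** The squared distance between [K s] and [K x] in the RKHS, in a form whose continuity can be read
    off from that of [K]. *)
Definition kernel_dist s x : R := K s s - K s x *+ 2 + K x x.

Lemma kernel_distE s x : kernel_dist s x =
  ip (fun t => K s t - K x t) (fun t => K s t - K x t).
Proof.
rewrite (ip_sqrB hH (HK s) (HK x)).
by rewrite -!reproduce// [K x s]K_sym.
Qed.

Lemma kernel_dist_ge0 s x : 0 <= kernel_dist s x.
Proof. by rewrite kernel_distE; apply: (ip_ge0 hH); exact: (hilbertB hH). Qed.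

Lemma kernel_dist_diag s : kernel_dist s s = 0.
Proof. by rewrite /kernel_dist; ring. Qed.

Lemma kernel_section_continuous s : continuous (K s).
Proof.
move=> x; have := @K_continuous (s, x).
apply: (@continuous_comp _ _ _ (fun x => (s, x)) (fun p : T * T => K p.1 p.2)).
by apply: cvg_pair => //=; exact: cvg_cst.
Qed.

Lemma kernel_diag_continuous : continuous (fun x => K x x).
Proof.
move=> x; have := @K_continuous (x, x).
apply: (@continuous_comp _ _ _ (fun x => (x, x)) (fun p : T * T => K p.1 p.2)).
by apply: cvg_pair => //=; exact: cvg_id.
Qed.

Lemma kernel_dist_continuous s : continuous (kernel_dist s).
Proof.
move=> x; apply: cvgD; last exact: kernel_diag_continuous.
by apply: cvgB; [exact: cvg_cst|apply: cvgMn; exact: kernel_section_continuous].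
Qed.

(** A modulus of continuity shared by a whole ball, so that one partition of the predictors serves
    all its elements. *)
Lemma rkhs_lipschitz g s x : H g ->
  `|g s - g x| <= ip_norm ip g * Num.sqrt (kernel_dist s x).
Proof.
move=> Hg; rewrite (reproduce s Hg) (reproduce x Hg) -(ipB_r hH)//.
apply: (le_trans (ip_le_norm hH Hg (hilbertB hH (HK s) (HK x)))).
by rewrite /ip_norm -kernel_distE.
Qed.

Lemma rkhs_continuous g : H g -> continuous g.
Proof.
move=> Hg s; apply/cvgrPdist_le => e e0.
have a0 : 0 < ip_norm ip g + 1 by rewrite ltr_pwDr ?ip_norm_ge0.
have e1 : 0 < (e / (ip_norm ip g + 1)) ^+ 2 by rewrite exprn_gt0// divr_gt0.
have := @kernel_dist_continuous s s; rewrite /continuous_at kernel_dist_diag.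
move/cvgr_lt => /(_ _ e1); apply: filterS => x xe.
apply: (le_trans (rkhs_lipschitz s x Hg)).
apply: (@le_trans _ _ (ip_norm ip g * (e / (ip_norm ip g + 1)))).
  have q0 : 0 <= e / (ip_norm ip g + 1) by rewrite divr_ge0// ltW.
  rewrite ler_wpM2l ?ip_norm_ge0// -[leRHS](ger0_norm q0) -sqrtr_sqr.
  by rewrite ler_wsqrtr// ltW.
rewrite mulrCA ger_pMr// ler_pdivrMr// mul1r lerDl//.
Qed.

(** The bound is written as a square because [sqrt (K x x)] is the norm of evaluation at [x]. The
    constant found is at least 1, hence below its own square. *)
Lemma kernel_bounded : exists2 kap, 0 < kap & forall x, K x x <= kap ^+ 2.
Proof.
pose D s x := `|K s s - K x x|.
have [||n [chi [rep [_ hrep]]]] :=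
    @compact_partition R T x0 D 1 T_compact _ _ ltr01.
- move=> s x; apply: cvg_norm; apply: cvgB; first exact: cvg_cst.
  exact: kernel_diag_continuous.
- by move=> s; rewrite /D subrr normr0.
pose M := 1 + \sum_a `|K (rep a) (rep a)|.
have M1 : 1 <= M by rewrite lerDl sumr_ge0.
exists M; first exact: lt_le_trans M1.
move=> x; apply: (@le_trans _ _ M); last first.
  by rewrite expr2 ler_pMl// (lt_le_trans ltr01).
have := hrep x; rewrite /D /M (bigD1 (chi x))//= => h.
have h1 : 0 <= \sum_(i | i != chi x) `|K (rep i) (rep i)| by rewrite sumr_ge0.
have := ler_norm (K (rep (chi x)) (rep (chi x))).
have := lerNnormlW (lexx `|K (rep (chi x)) (rep (chi x)) - K x x|).
move: h h1; move: (\sum_(i | _) _) => S; lra.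
Qed.

Lemma rkhs_sup g x kap : H g -> 0 < kap -> (forall x, K x x <= kap ^+ 2) ->
  `|g x| <= kap * ip_norm ip g.
Proof.
move=> Hg kap0 Kkap; rewrite (reproduce x Hg) mulrC.
apply: (le_trans (ip_le_norm hH Hg (HK x))).
rewrite ler_wpM2l ?ip_norm_ge0// /ip_norm -reproduce//.
by rewrite -[leRHS](ger0_norm (ltW kap0)) -sqrtr_sqr ler_wsqrtr.
Qed.

Variable v : probability (borel x0) R.

Lemma rkhs_sq_int g : H g -> sq_int v g.
Proof.
move=> Hg; have [kap kap0 Kkap] := kernel_bounded.
apply: (@sq_int_bounded _ _ _ _ _ (kap * ip_norm ip g)).
  by apply: continuous_borel_measurable; exact: rkhs_continuous.
by move=> x; exact: rkhs_sup.
Qed.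

Variable lam : R.
Hypothesis lam0 : 0 < lam.

Definition reg_ip f g : R := \int[v]_x (f x * g x) + lam * ip f g.

Lemma reg_ipE g : H g -> reg_ip g g = reg_norm2 v ip lam g.
Proof. by move=> Hg; rewrite /reg_norm2 (sqr_ip_norm hH). Qed.

Lemma reg_ip_ge g : H g -> lam * ip g g <= reg_ip g g.
Proof. by move=> Hg; rewrite lerDr; exact: Rint_sqr_ge0. Qed.

(** Completeness is inherited because the two norms are equivalent: the squared regularised norm
    lies between [lam] and [kap^2 + lam] times the squared RKHS norm. *)
Lemma reg_ip_hilbert : is_hilbert H reg_ip.
Proof.
have [kap kap0 Kkap] := kernel_bounded.
have le g : H g -> ip_norm reg_ip g <= Num.sqrt (kap ^+ 2 + lam) * ip_norm ip g.
  move=> Hg; rewrite -sqrtrM ?addr_ge0 ?sqr_ge0 ?(ltW lam0)// ler_wsqrtr//.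
  rewrite mulrDl lerD2r -(sqr_ip_norm hH)// -exprMn.
  apply: (@le_trans _ _ (\int[v]_x ((kap * ip_norm ip g) ^+ 2))); last first.
    by rewrite Rint_cst.
  apply: le_Rint; [by have [] := rkhs_sq_int Hg|exact: integrable_const|].
  move=> x; rewrite -expr2 -real_normK ?num_real// lerXn2r ?nnegrE ?mulr_ge0 ?ip_norm_ge0 ?(ltW kap0)//.
  exact: rkhs_sup.
have ge g : H g -> ip_norm ip g <= Num.sqrt (lam^-1) * ip_norm reg_ip g.
  move=> Hg; rewrite -sqrtrM ?invr_ge0 ?(ltW lam0)// ler_wsqrtr//.
  by rewrite mulrC ler_pdivlMr// mulrC reg_ip_ge.
split.
- exact: hilbert0 hH.
- exact: hilbert_lin hH.
- move=> f g Hf Hg; rewrite /reg_ip (ipC hH)//; congr (_ + _).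
  by apply: eq_Rintegral => x _; rewrite mulrC.
- move=> a f g h Hf Hg Hh; rewrite /reg_ip (ip_lin_l hH)//.
  have [sf [sg sh]] := (rkhs_sq_int Hf, (rkhs_sq_int Hg, rkhs_sq_int Hh)).
  have -> : \int[v]_x ((a * f x + g x) * h x) =
      a * \int[v]_x (f x * h x) + \int[v]_x (g x * h x).
    rewrite -RintZ; last exact: sq_int_mul.
    rewrite -RintD; [|apply: integrable_scale; exact: sq_int_mul|exact: sq_int_mul].
    by apply: eq_Rintegral => x _; ring.
  by ring.
- move=> f Hf f0; apply: (lt_le_trans _ (reg_ip_ge Hf)).
  by rewrite mulr_gt0//; exact: (hilbert_ip_gt0 hH).
- move=> u Hu cu; have [e e0|f Hf cf] := hilbert_complete hH Hu.
    have s0 : 0 < Num.sqrt (lam^-1) by rewrite sqrtr_gt0 invr_gt0.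
    have [N hN] := cu _ (divr_gt0 e0 s0); exists N => m n Nm Nn.
    apply: (le_lt_trans (ge _ (hilbertB hH (Hu m) (Hu n)))).
    by rewrite mulrC -ltr_pdivlMr//; exact: hN.
  exists f => //.
  have c0 : Num.sqrt (kap ^+ 2 + lam) * ip_norm ip (u n \- f) @[n --> \oo] --> (0 : R).
    by rewrite -[X in _ --> X](mulr0 (Num.sqrt (kap ^+ 2 + lam))); apply: cvgMr.
  apply: (squeeze_cvgr _ (@cvg_cst _ 0 _ _ _) c0).
  by apply: nearW => n; rewrite ip_norm_ge0 le//; exact: (hilbertB hH).
Qed.

Local Notation N := (spectral_complexity v H ip lam).

(** All the quotients are at most [kap^2 / lam], so the real-valued [sup] is a genuine upper
    bound. *)
Lemma complexity_ub g x : H g -> (g x) ^+ 2 <= N * reg_ip g g.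
Proof.
move=> Hg; have [kap kap0 Kkap] := kernel_bounded.
have [->|/eqP g0] := pselect (g = fun=> 0).
  by rewrite expr0n /= (ip0_l reg_ip_hilbert) ?mulr0//; exact: hilbert0 hH.
have reg0 f : H f -> f <> (fun=> 0) -> 0 < reg_ip f f.
  by move=> Hf f0; exact: (hilbert_ip_gt0 reg_ip_hilbert).
have supb f : H f -> has_ubound [set `|f s| | s in [set: T]].
  by move=> Hf; exists (kap * ip_norm ip f) => _ [s _ <-]; exact: rkhs_sup.
have g_sup : `|g x| <= sup_norm g by apply: ub_le_sup; [exact: supb|exists x].
apply: (@le_trans _ _ (sup_norm g ^+ 2)).
  by rewrite -real_normK ?num_real// lerXn2r ?nnegrE ?(le_trans _ g_sup).
rewrite -ler_pdivrMr; last by apply: reg0 => //; exact/eqP.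
rewrite reg_ipE//; apply: ub_le_sup; last by exists g => //; split => //; exact/eqP.
exists (kap ^+ 2 / lam) => _ [f [Hf f0] <-]; rewrite -reg_ipE//.
rewrite ler_pdivrMr ?reg0// mulrAC ler_pdivlMr//.
apply: (@le_trans _ _ ((kap * ip_norm ip f) ^+ 2 * lam)).
  rewrite ler_pM2r// lerXn2r ?nnegrE ?mulr_ge0 ?ip_norm_ge0 ?(ltW kap0)//.
    by apply: (le_trans (normr_ge0 (f x))); apply: ub_le_sup; [exact: supb|exists x].
  apply: ge_sup; first by exists `|f x|; exists x.
  by move=> _ [s _ <-]; exact: rkhs_sup.
rewrite exprMn -mulrA (sqr_ip_norm hH)// ler_wpM2l ?sqr_ge0//.
by rewrite mulrC reg_ip_ge.
Qed.

Lemma complexity_ge0 : 0 <= N.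
Proof.
rewrite /spectral_complexity; set E := (X in sup X).
(* For an empty or unbounded set [sup] takes its default value 0. *)
have [[[? [f [Hf f0] _]] ub]|/sup_out ->//] := pselect (has_sup E).
apply: (le_trans _ (ub_le_sup ub _)); last by exists f; [split|reflexivity].
rewrite divr_ge0 ?sqr_ge0// -reg_ipE//.
exact: (ip_ge0 reg_ip_hilbert).
Qed.

(** Evaluation at [x] has norm at most [sqrt N]. Applied to [k] itself, whose value at [x] is its
    squared norm, this gives [||k||^4 <= N * ||k||^2]. *)
Lemma representer x : exists2 k, H k &
  (forall g, H g -> g x = reg_ip g k) /\ reg_ip k k <= N.
Proof.
have [|f Hf|k Hk kE] := riesz reg_ip_hilbert (l := fun g => g x)
    (C := Num.sqrt N) _ _.
- by [].
- have /ler_wsqrtr := complexity_ub x Hf.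
  by rewrite sqrtr_sqr sqrtrM ?complexity_ge0.
exists k => //; split.
  by move=> g Hg; rewrite (ipC reg_ip_hilbert)// kE.
have := complexity_ub x Hk; rewrite -(kE k Hk).
have := ip_ge0 reg_ip_hilbert Hk; rewrite le_eqVlt => /orP[/eqP<- _|q0].
  exact: complexity_ge0.
by rewrite expr2 ler_pM2r.
Qed.

End RKHS.

(** * Eigenfunctions and spectral cut-off *)

(** Pythagoras for a symmetric bilinear form, stated so as to serve both the RKHS product and the
    product of [L^2]. *)
Lemma orthogonal_sum (R : realType) (S : Type) (H : set (S -> R))
    (B : (S -> R) -> (S -> R) -> R) (Q : pred nat) (phi : nat -> S -> R)
    (c a : nat -> R) :
  H (fun=> 0) ->
  (forall a f g, H f -> H g -> H (fun s => a * f s + g s)) ->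
  (forall f g, H f -> H g -> B f g = B g f) ->
  (forall a f g h, H f -> H g -> H h ->
     B (fun s => a * f s + g s) h = a * B f h + B g h) ->
  (forall j, Q j -> H (phi j)) ->
  (forall i j, Q i -> Q j -> B (phi i) (phi j) = (i == j)%:R * c j) ->
  forall n, let f := fun s => \sum_(0 <= j < n | Q j) a j * phi j s in
  H f /\ B f f = \sum_(0 <= j < n | Q j) (a j) ^+ 2 * c j.
Proof.
move=> H0 Hlin BC Blin Hphi orth.
have B0 h : H h -> B (fun=> 0) h = 0.
  move=> Hh; have := Blin 1 _ _ _ H0 H0 Hh.
  have -> : (fun s : S => 1 * 0 + 0 : R) = fun=> 0.
    by apply/funext => s; rewrite mulr0 addr0.
  by rewrite mul1r; lra.
pose f n := fun s => \sum_(0 <= j < n | Q j) a j * phi j s.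
have f0 : f 0%N = fun=> 0 by apply/funext => s; rewrite /f big_nil.
have fS n : f n.+1 = if Q n then fun s => a n * phi n s + f n s else f n.
  apply/funext => s; rewrite /f big_mkcond/= big_nat_recr//= -big_mkcond/=.
  by case: (Q n); rewrite ?addr0// addrC.
have Hf n : H (f n).
  by elim: n => [|n IH]; rewrite ?f0// fS; case: ifP => // Qn; apply: Hlin; auto.
have fphi n k : (n <= k)%N -> Q k -> B (f n) (phi k) = 0.
  move=> + Qk; elim: n => [_|n IH nk]; first by rewrite f0 B0//; exact: Hphi.
  rewrite fS; case: ifP => Qn; last by rewrite IH// ltnW.
  rewrite Blin//; [|exact: Hphi|exact: Hphi].
  by rewrite orth// ltn_eqF// mul0r mulr0 add0r IH// ltnW.
move=> n /=; split; first exact: Hf.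
rewrite -/(f n); elim: n => [|n IH]; first by rewrite f0 B0// big_nil.
rewrite [RHS]big_mkcond/= big_nat_recr//= -big_mkcond/= -IH fS.
case: ifP => Qn; last by rewrite addr0.
have Hn := Hphi n Qn; have Hf1 := Hlin (a n) _ _ Hn (Hf n).
rewrite Blin// (BC _ _ Hn Hf1) (BC _ _ (Hf n) Hf1) !Blin//.
rewrite fphi// (BC _ _ Hn (Hf n)) fphi// orth// eqxx mul1r; ring.
Qed.

Section Eigen.
Context {R : realType} {T : topologicalType} (x0 : T).
Variables (K : T -> T -> R) (H : set (T -> R)) (ip : (T -> R) -> (T -> R) -> R).
Hypothesis T_compact : compact [set: T].
Hypothesis K_continuous : continuous (fun p : T * T => K p.1 p.2).
Hypothesis H_rkhs : is_rkhs K H ip.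
Variable v : probability (borel x0) R.
Hypothesis v_support : forall O : set T, open O -> O !=set0 -> (0 < v O)%E.
Variables (J : pred nat) (mu : nat -> R) (phi : nat -> T -> R).
Hypothesis phi_continuous : forall j, J j -> continuous (phi j).
Hypothesis mu_phi : eigensystem v K J mu phi.

Let hH := rkhs_is_hilbert H_rkhs.
Let HK s : H (K s) := rkhs_section H_rkhs s.
Let sqH g : H g -> sq_int v g := @rkhs_sq_int _ _ x0 _ _ _ T_compact K_continuous H_rkhs v g.

(** The set where the functions differ is open and null, hence empty by the full support of [v]. *)
Lemma continuous_ae_eq (f g : T -> R) : continuous f -> continuous g ->
  {ae v, forall x, f x = g x} -> f = g.
Proof.
move=> cf cg [N [mN N0 sub]]; apply/funext => x; apply: contrapT => ne.
pose O := [set y | f y - g y != 0].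
have oO : open O.
  have -> : O = (fun y => f y - g y) @^-1` [set~ 0].
    by apply/seteqP; split => y /= /eqP.
  have cfg : continuous (fun y => f y - g y) by move=> y; apply: cvgB; [exact: cf|exact: cg].
  by move/continuousP: cfg; apply; rewrite openC; exact: closed_eq.
have vO : (0 < v O)%E.
  by apply: v_support => //; exists x; rewrite /O /= subr_eq0; exact/eqP.
have : (v O <= v N)%E.
  apply: le_measure; rewrite ?inE//.
    by apply: sub_sigma_algebra.
  by move=> y; rewrite /O /= subr_eq0 => /eqP fg; apply: sub.
by rewrite N0 leNgt vO.
Qed.

Lemma eigen_sq_int j : J j -> sq_int v (phi j).
Proof. by move=> Jj; apply/Lfun2P; exact: (eigen_L2 mu_phi). Qed.

(** Let [e] represent the functional [h |-> int phi_j h] in [H]. Its value at [s] is its product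
    with [K s], which is the integral operator applied to [phi_j]; so [e = mu_j phi_j] almost
    everywhere, and everywhere by continuity. *)
Lemma eigen_H j : J j -> H (phi j) /\
  forall h, H h -> ip (phi j) h = (mu j)^-1 * \int[v]_x (phi j x * h x).
Proof.
move=> Jj; have sphi := eigen_sq_int Jj.
have [kap kap0 Kkap] := kernel_bounded x0 T_compact K_continuous.
have mu0 := eigen_gt0 mu_phi Jj.
have [a f g Hf Hg|h Hh|e He eE] := riesz hH (l := fun h => \int[v]_x (phi j x * h x))
    (C := kap) _ _.
- rewrite -RintZ; last by apply: sq_int_mul => //; exact: sqH.
  rewrite -RintD; [|apply: integrable_scale; apply: sq_int_mul => //; exact: sqH
                   |apply: sq_int_mul => //; exact: sqH].
  by apply: eq_Rintegral => x _; ring.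
- apply: (le_trans (Rint_CS_norm sphi (sqH Hh))).
  have -> : \int[v]_x (phi j x ^+ 2) = 1.
    by have := eigen_orthonormal mu_phi Jj Jj; rewrite eqxx.
  rewrite sqrtr1 mul1r.
  have k0 : 0 <= kap * ip_norm ip h by rewrite mulr_ge0 ?ip_norm_ge0 ?(ltW kap0).
  rewrite -[leRHS](ger0_norm k0) -sqrtr_sqr ler_wsqrtr//.
  rewrite -[leRHS](Rint_cst v); apply: le_Rint.
  + by have [] := sqH Hh.
  + exact: integrable_const.
  + move=> x; rewrite -real_normK ?num_real// lerXn2r ?nnegrE//.
    exact: (rkhs_sup H_rkhs).
have ephi : e = fun s => mu j * phi j s.
  apply: continuous_ae_eq.
  - exact: (rkhs_continuous K_continuous H_rkhs He).
  - by move=> x; apply: cvgMr; exact: phi_continuous.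
  - have [N [mN N0 sub]] := eigen_eq mu_phi Jj.
    exists N; split => // s /= ne; apply: sub => /= h; apply: ne.
    rewrite -h (reproduce H_rkhs)// eE//.
    by apply: eq_Rintegral => x _; rewrite mulrC.
have -> : phi j = fun s => (mu j)^-1 * e s.
  by apply/funext => s; rewrite ephi mulKf// gt_eqF.
split; first exact: (hilbertZ hH).
move=> h Hh; rewrite (ipZ_l hH)// eE//; congr (_ * _).
by apply: eq_Rintegral => x _; rewrite ephi mulKf// gt_eqF.
Qed.

(** [phi_j] has squared RKHS norm [1 / mu_j], so [phi_j^2 <= kap^2 / mu_j] pointwise, while its
    integral is 1. *)
Lemma eigen_bounded : exists2 M, 0 < M & forall j, J j -> mu j <= M.
Proof.
have [kap kap0 Kkap] := kernel_bounded x0 T_compact K_continuous.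
exists (kap ^+ 2); first by rewrite exprn_gt0.
move=> j Jj; have mu0 := eigen_gt0 mu_phi Jj; have [Hphi phiE] := eigen_H Jj.
have o : \int[v]_x (phi j x * phi j x) = 1.
  by have := eigen_orthonormal mu_phi Jj Jj; rewrite eqxx.
have ipphi : ip (phi j) (phi j) = (mu j)^-1 by rewrite phiE// o mulr1.
have : \int[v]_x (phi j x * phi j x) <= \int[v]_x (kap ^+ 2 * (mu j)^-1).
  apply: le_Rint; [apply: sq_int_mul; exact: eigen_sq_int|exact: integrable_const|].
  move=> x; rewrite -expr2 -real_normK ?num_real// -ipphi -(sqr_ip_norm hH)// -exprMn.
  rewrite lerXn2r ?nnegrE ?mulr_ge0 ?ip_norm_ge0 ?(ltW kap0)//.
  exact: (rkhs_sup H_rkhs).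
by rewrite o Rint_cst ler_pdivlMr// mul1r.
Qed.

Lemma eigen_sum (Q : pred nat) (a : nat -> R) n : (forall j, Q j -> J j) ->
  let f := fun s => \sum_(0 <= j < n | Q j) a j * phi j s in
  [/\ H f, \int[v]_x (f x ^+ 2) = \sum_(0 <= j < n | Q j) (a j) ^+ 2 &
      ip f f = \sum_(0 <= j < n | Q j) (a j) ^+ 2 / mu j].
Proof.
move=> QJ.
have [||||||Hf ipf] := @orthogonal_sum R T H ip Q phi (fun j => (mu j)^-1) a _ _ _ _ _ _ n.
- exact: (hilbert0 hH).
- exact: (hilbert_lin hH).
- exact: (hilbert_ipC hH).
- exact: (hilbert_ip_lin hH).
- by move=> j /QJ/eigen_H[].
- move=> i j /QJ Ji /QJ Jj; have [_ ->] := eigen_H Ji; last by have [] := eigen_H Jj.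
  rewrite (eigen_orthonormal mu_phi)//; case: eqVneq => [->|_].
    by rewrite mulrC.
  by rewrite mul0r mulr0.
have [||||||_ intf] := @orthogonal_sum R T H (fun f g => \int[v]_x (f x * g x)) Q phi (fun j => 1) a _ _ _ _ _ _ n.
- exact: (hilbert0 hH).
- exact: (hilbert_lin hH).
- by move=> f g _ _; apply: eq_Rintegral => x _; rewrite mulrC.
- move=> b f g h Hf' Hg Hh.
  have [sf [sg sh]] := (sqH Hf', (sqH Hg, sqH Hh)).
  rewrite -RintZ; last exact: sq_int_mul.
  rewrite -RintD; [|apply: integrable_scale; exact: sq_int_mul|exact: sq_int_mul].
  by apply: eq_Rintegral => x _; ring.
- by move=> j /QJ/eigen_H[].
- by move=> i j /QJ Ji /QJ Jj; rewrite (eigen_orthonormal mu_phi)// mulr1.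
split => //.
by rewrite /= -[LHS]/(\int[v]_x ((\sum_(0 <= j < n | Q j) a j * phi j x) *
   (\sum_(0 <= j < n | Q j) a j * phi j x))) intf; apply: eq_bigr => j _; rewrite mulr1.
Qed.

End Eigen.

(** This amounts to [l^(1 - b) <= m^(1 - b)]. With [l = lambda] it bounds the penalty of the
    eigenfunctions that are kept. *)
Lemma powR_ratio (R : realType) (l m b : R) : 0 < l -> l <= m -> b <= 1 ->
  l * (m `^ b / m) <= l `^ b.
Proof.
move=> l0 lm b1; have m0 : 0 < m := lt_le_trans l0 lm.
have split_powR t : 0 < t -> t = t `^ b * t `^ (1 - b).
  move=> t0; rewrite -powRD; last by rewrite (gt_eqF t0) implybT.
  by rewrite [b + _]addrC subrK powRr1// ltW.
rewrite mulrA ler_pdivrMr// {1}(split_powR l l0) [X in _ <= _ * X](split_powR m m0).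
rewrite -!mulrA ler_pM2l ?powR_gt0// mulrC ler_pM2l ?powR_gt0//.
by rewrite ge0_ler_powR ?nnegrE ?subr_ge0 ?(ltW l0) ?(ltW m0).
Qed.

Section SpectralApproximation.
Context {R : realType} {T : topologicalType} (x0 : T).
Variables (K : T -> T -> R) (H : set (T -> R)) (ip : (T -> R) -> (T -> R) -> R).
Hypothesis T_compact : compact [set: T].
Hypothesis K_continuous : continuous (fun p : T * T => K p.1 p.2).
Hypothesis H_rkhs : is_rkhs K H ip.
Variable v : probability (borel x0) R.
Hypothesis v_support : forall O : set T, open O -> O !=set0 -> (0 < v O)%E.
Variables (J : pred nat) (mu : nat -> R) (phi : nat -> T -> R).
Hypothesis phi_continuous : forall j, J j -> continuous (phi j).
Hypothesis mu_phi : eigensystem v K J mu phi.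
Variables (alpha beta C : R) (f0 : T -> R) (c : nat -> R).
Hypothesis alpha_beta : 0 < alpha < beta.
Hypothesis beta1 : beta <= 1.
Hypothesis f0_c : power_expansion v J mu phi beta f0 c.
Hypothesis embed : forall f c, power_expansion v J mu phi alpha f c ->
    ('N[v]_+oo[EFin \o f] <= (C * coef_norm J c)%:E)%E.

Let hH := rkhs_is_hilbert H_rkhs.
Let sqH g : H g -> sq_int v g := @rkhs_sq_int _ _ x0 _ _ _ T_compact K_continuous H_rkhs v g.
Let beta0 : 0 < beta. Proof. by case/andP: alpha_beta => /lt_trans; apply. Qed.
Let mu_gt0 j : J j -> 0 < mu j. Proof. exact: (eigen_gt0 mu_phi). Qed.

Lemma partial_sum_le (Q : pred nat) (a : nat -> R) n m : (n <= m)%N ->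
  (forall j, Q j -> 0 <= a j) ->
  \sum_(0 <= j < n | Q j) a j <= \sum_(0 <= j < m | Q j) a j.
Proof.
move=> nm a0; rewrite [leRHS](@big_cat_nat _ _ _ n)//= lerDl.
by apply: sumr_ge0.
Qed.

Let s n := \sum_(0 <= j < n | J j) (c j) ^+ 2.
Let s_cvg : cvgn s. Proof. by case: f0_c. Qed.

Lemma coef_sum_le n : s n <= limn s.
Proof.
apply: nondecreasing_cvgn_le => // i j ij.
by apply: partial_sum_le => // k _; rewrite sqr_ge0.
Qed.

(** The eigenvalues come in no particular order, so the kept indices are those with [lam <= mu j]
    and [j < m]. Dropped indices with [mu j < lam] contribute [lam^q * limn s] at most. The others
    lie beyond [m], where the sum of the [c_j^2] is so small that they add at most [lam^q]; hence
    the [+ 1]. The exponent [beta] serves the [L^2] error and [beta - alpha] the uniform one. *)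
Lemma coef_tail_sum lam : 0 < lam -> exists m, forall (Q : pred nat) q n,
  (q = beta \/ q = beta - alpha) ->
  (forall j, Q j -> J j && ((lam <= mu j) ==> (m <= j)%N)) ->
  \sum_(0 <= j < n | Q j) (c j) ^+ 2 * mu j `^ q <= lam `^ q * (limn s + 1).
Proof.
move=> lam0.
have [M M0 muM] := eigen_bounded T_compact K_continuous H_rkhs v_support phi_continuous mu_phi.
(* The bound [e * M^q <= lam^q] is needed for both exponents, with [M] above all eigenvalues. *)
pose e := Num.min (lam `^ beta / M `^ beta)
   (lam `^ (beta - alpha) / M `^ (beta - alpha)).
have e0 : 0 < e by rewrite lt_min !divr_gt0 ?powR_gt0.
have [m _ hm] := cvgr_gt (limn s) s_cvg (limn s - e) (ltac:(lra) : limn s - e < limn s).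
exists m => Q q n qq QJ.
have qe : e * M `^ q <= lam `^ q.
  rewrite -ler_pdivlMr ?powR_gt0// /e ge_min.
  by case: qq => ->; rewrite lexx ?orbT.
have q0 : 0 <= q by case/andP: alpha_beta => ? ?; case: qq => ->; lra.
have step n' : \sum_(0 <= j < n' | Q j) (c j) ^+ 2 * mu j `^ q <=
    lam `^ q * s n' + M `^ q * (\sum_(0 <= j < n' | J j && (m <= j)%N) (c j) ^+ 2).
  rewrite /s !mulr_sumr [X in _ <= X + _]big_mkcond [X in _ <= _ + X]big_mkcond.
  rewrite [leLHS]big_mkcond -big_split/=; apply: ler_sum => j _.
  have c0 := sqr_ge0 (c j); have l0 := powR_ge0 lam q; have M0' := powR_ge0 M q.
  case: ifPn => [/QJ/andP[Jj]|_]; last first.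
    by apply: addr_ge0; case: ifP => // _; rewrite mulr_ge0.
  rewrite Jj/=; have [lm /= mj|ml _] := leP lam (mu j).
    rewrite mj/=; apply: ler_wpDl; first by rewrite mulr_ge0.
    rewrite mulrC ler_wpM2r//.
    by rewrite ge0_ler_powR ?nnegrE ?(ltW M0) ?(ltW (mu_gt0 Jj))// muM.
  apply: ler_wpDr; first by case: ifP => _//; rewrite mulr_ge0.
  by rewrite mulrC ler_wpM2r// ge0_ler_powR ?nnegrE ?(ltW (mu_gt0 Jj)) ?(ltW lam0) ?(ltW ml).
apply: (le_trans (step n)).
have tail : \sum_(0 <= j < n | J j && (m <= j)%N) c j ^+ 2 <= e.
  have [nm|mn] := leqP n m.
    rewrite big_nat_cond big_pred0 ?(ltW e0)// => j.
    apply/negbTE/negP => /andP[/andP[_ jn] /andP[_ mj]].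
    by have := leq_trans (leq_ltn_trans mj jn) nm; rewrite ltnn.
  have hm' : limn s - e < s m by exact: hm m (leqnn _).
  have : s n = s m + \sum_(0 <= j < n | J j && (m <= j)%N) c j ^+ 2.
    rewrite /s [LHS](@big_cat_nat _ _ _ m)//=; last exact: ltnW.
    congr (_ + _); rewrite [RHS](@big_cat_nat _ _ _ m)//=; last exact: ltnW.
    rewrite [X in _ = X + _]big_nat_cond [X in _ = X + _]big_pred0 ?add0r; last first.
      move=> j; apply/negbTE/negP => /andP[/andP[_ jm] /andP[_ mj]].
      by have := leq_ltn_trans mj jm; rewrite ltnn.
    rewrite [LHS]big_nat_cond [RHS]big_nat_cond; apply: eq_bigl => j.
    by case: (leqP m j) => //= _; rewrite ?andbT ?andbF.
  have := coef_sum_le n; lra.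
rewrite mulrDr mulr1 lerD//.
  by rewrite ler_wpM2l ?powR_ge0// coef_sum_le.
by apply: (le_trans _ qe); rewrite mulrC ler_wpM2r ?powR_ge0.
Qed.

(** For the uniform bound, [f0 - fl] is expanded in the power space of exponent [alpha]: its
    coefficients there are those of [f0] times [mu_j^((beta - alpha) / 2)], and the embedding
    applies. *)
Lemma spectral_approximation lam : 0 < lam ->
  exists fl : T -> R, [/\ H fl,
    lam * ip fl fl <= lam `^ beta * (limn s + 1),
    sq_int v (fun x => f0 x - fl x),
    \int[v]_x ((f0 x - fl x) ^+ 2) <= 2 * (lam `^ beta * (limn s + 1)) &
    {ae v, forall x, `|f0 x - fl x| <=
      `|C| * Num.sqrt (lam `^ (beta - alpha) * (limn s + 1))}].
Proof.
move=> lam0; have [m hm] := coef_tail_sum lam0.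
have s0 : 0 <= limn s by apply: le_trans (coef_sum_le 0); rewrite /s big_nil.
pose sel j := (lam <= mu j) && (j < m)%N.
pose a j := c j * mu j `^ (beta / 2).
pose fl := fun x => \sum_(0 <= j < m | J j && sel j) a j * phi j x.
pose S n := fun x => \sum_(0 <= j < n | J j) a j * phi j x.
pose D n := fun x => \sum_(0 <= j < n | J j && ~~ sel j) a j * phi j x.
have QJ : forall j, J j && sel j -> J j by move=> j /andP[].
have QJ' : forall j, J j && ~~ sel j -> J j by move=> j /andP[].
have esum := eigen_sum T_compact K_continuous H_rkhs v_support phi_continuous mu_phi.
have [Hfl _ ipfl] := esum _ a m QJ.
have aE j : J j -> (a j) ^+ 2 = c j ^+ 2 * mu j `^ beta.
  move=> Jj; rewrite /a exprMn; congr (_ * _).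
  rewrite -powR_mulrn ?powR_ge0// -powRrM divfK//.
have flE n x : (m <= n)%N -> S n x = fl x + D n x.
  move=> mn; rewrite /S (bigID sel)/=; congr (_ + _).
  rewrite (@big_cat_nat _ _ _ m)//= [X in _ + X]big_nat_cond [X in _ + X]big_pred0 ?addr0//.
  move=> j; apply/negbTE/negP => /andP[/andP[mj _] /andP[_ /andP[_ jm]]].
  by have := leq_ltn_trans mj jm; rewrite ltnn.
have nsel j : J j && ~~ sel j -> J j && ((lam <= mu j) ==> (m <= j)%N).
  by move=> /andP[-> /=]; rewrite /sel negb_and -leqNgt -ltNge implybE -ltNge.
have [lf0 _ cf0] := f0_c.
have sf0 : sq_int v f0 by apply/Lfun2P.
have sr : sq_int v (fun x => f0 x - fl x).
  have := sq_int_lin (-1) (sqH Hfl) sf0.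
  by congr sq_int; apply/funext => x; rewrite mulN1r addrC.
have HD n : H (D n) by have [] := esum _ a n QJ'.
have HS n : H (S n) by have [] := esum J a n (fun _ => id).
have ID n : \int[v]_x (D n x ^+ 2) <= lam `^ beta * (limn s + 1).
  have [_ -> _] := esum _ a n QJ'.
  rewrite (eq_bigr (fun j => c j ^+ 2 * mu j `^ beta)); last by move=> j /QJ' /aE.
  by apply: hm => //; left.
exists fl; split => //.
- rewrite [X in _ * X](_ : _ = \sum_(0 <= j < m | J j && sel j) (a j) ^+ 2 / mu j)//.
  rewrite mulr_sumr; apply: (@le_trans _ _ (\sum_(0 <= j < m | J j && sel j) lam `^ beta * (c j) ^+ 2)).
    apply: ler_sum => j /andP[Jj /andP[lj _]].
    rewrite aE// -[_ / mu j]mulrA mulrCA [leRHS]mulrC ler_wpM2l ?sqr_ge0//.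
    exact: powR_ratio.
  rewrite -mulr_sumr ler_wpM2l ?powR_ge0//.
  apply: (@le_trans _ _ (limn s)); last by rewrite lerDl.
  apply: le_trans (coef_sum_le m); rewrite /s.
  rewrite [leRHS](bigID sel)/= lerDl; apply: sumr_ge0 => j _.
  exact: sqr_ge0.
(* For [n >= m], [f0 - fl] is [f0 - S n], small in [L^2], plus the finite sum [D n] of dropped
   terms. The factor 2 comes from [(a + b)^2 <= 2 a^2 + 2 b^2]. *)
- apply/ler_addgt0Pr => e e0.
  have e20 : 0 < e / 2 by rewrite divr_gt0.
  have [n mn hn] : exists2 n, (m <= n)%N & \int[v]_x ((f0 x - S n x) ^+ 2) <= e / 2.
    have sD k : sq_int v (fun x => f0 x - S k x).
      have := sq_int_lin (-1) (sqH (HS k)) sf0.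
      by congr sq_int; apply/funext => x; rewrite mulN1r addrC.
    have cu : (fun k => Num.sqrt (\int[v]_x ((f0 x - S k x) ^+ 2))) @ \oo --> (0 : R).
      have -> : (fun k => Num.sqrt (\int[v]_x ((f0 x - S k x) ^+ 2))) =
          fine \o (fun k => 'N[v]_2%:E[EFin \o (fun x => (f0 x - S k x)%R)]%E).
        by apply/funext => k /=; rewrite Lnorm2E.
      exact: fine_cvg cf0.
    have e3 : 0 < Num.sqrt (e / 2) by rewrite sqrtr_gt0.
    have [k _ hk] := cvgr_lt _ cu _ e3.
    exists (maxn m k); first exact: leq_maxl.
    by have := hk (maxn m k) (leq_maxr m k); rewrite /= ltr_sqrt// => /ltW.
  have sfS : sq_int v (fun x => f0 x - S n x).
    have := sq_int_lin (-1) (sqH (HS n)) sf0.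
    by congr sq_int; apply/funext => x; rewrite mulN1r addrC.
  have -> : \int[v]_x ((f0 x - fl x) ^+ 2) =
      \int[v]_x (((f0 x - S n x) + D n x) ^+ 2).
    by apply: eq_Rintegral => x _; rewrite flE//; congr (_ ^+ 2); ring.
  apply: (le_trans (Rint_sqrD2 sfS (sqH (HD n)))).
  have := ID n; move: (\int[v]_x _) (\int[v]_x _) hn => I1 I2 hn h.
  by move: (lam `^ beta * (limn s + 1)) h => L h; lra.
- pose c' j := if sel j then 0 else c j * mu j `^ ((beta - alpha) / 2).
  have c'E n : \sum_(0 <= j < n | J j) (c' j) ^+ 2 =
      \sum_(0 <= j < n | J j && ~~ sel j) c j ^+ 2 * mu j `^ (beta - alpha).
    rewrite (bigID sel)/= big1 ?add0r; last first.
      by move=> j /andP[_ sj]; rewrite /c' sj expr0n.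
    apply: eq_bigr => j /andP[_ sj]; rewrite /c' (negbTE sj) exprMn; congr (_ * _).
    by rewrite -powR_mulrn ?powR_ge0// -powRrM divfK.
  have c'le n : \sum_(0 <= j < n | J j) (c' j) ^+ 2 <=
      lam `^ (beta - alpha) * (limn s + 1).
    by rewrite c'E; apply: hm => //; right.
  have c'nd : {homo (fun n => \sum_(0 <= j < n | J j) (c' j) ^+ 2) : i j / (i <= j)%N >-> i <= j}.
    by move=> i j ij; apply: partial_sum_le => // k _; rewrite sqr_ge0.
  have c'cvg : cvgn (fun n => \sum_(0 <= j < n | J j) (c' j) ^+ 2).
    apply: nondecreasing_is_cvgn => //.
    by exists (lam `^ (beta - alpha) * (limn s + 1)) => _ [n _ <-]; exact: c'le.
  have c'lim : coef_norm J c' <= Num.sqrt (lam `^ (beta - alpha) * (limn s + 1)).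
    rewrite ler_wsqrtr//; apply: limr_le => //.
    by apply: nearW => n; exact: c'le.
  have pe : power_expansion v J mu phi alpha (fun x => f0 x - fl x) c'.
    split => //; first exact/Lfun2P.
    have eS n : (m <= n)%N -> (fun x => (f0 x - fl x -
        \sum_(0 <= j < n | J j) c' j * mu j `^ (alpha / 2) * phi j x)%:E) =
        (fun x => (f0 x - S n x)%:E).
      move=> mn; apply/funext => x; congr (_%:E).
      rewrite (flE n)//; rewrite opprD addrA; congr (_ - _).
      rewrite (bigID sel)/= big1 ?add0r; last first.
        by move=> j /andP[_ sj]; rewrite /c' sj !mul0r.
      apply: eq_bigr => j /andP[Jj sj]; rewrite /c' (negbTE sj) /a.
      have -> : beta / 2 = (beta - alpha) / 2 + alpha / 2.
        by rewrite -mulrDl subrK.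
      rewrite powRD; last by rewrite (gt_eqF (mu_gt0 Jj)) implybT.
      by rewrite !mulrA.
    apply: cvg_trans cf0; apply: near_eq_cvg.
    by exists m => // n /= mn; rewrite eS.
  have := embed pe; rewrite unlock.
  have vT : (0 < v [set: borel x0])%E by rewrite probability_setT lte01.
  rewrite ifT// => /ess_supP.
  move=> [N [mN N0 sub]]; exists N; split => // x /= ne; apply: sub => /= h.
  apply: ne; move: h; rewrite /= lee_fin => /le_trans; apply.
  apply: (@le_trans _ _ (`|C| * coef_norm J c')).
    by rewrite ler_wpM2r ?sqrtr_ge0// ler_norm.
  by rewrite ler_wpM2l.
Qed.

End SpectralApproximation.

(** * Increments of the loss *)

Section LossIncrements.
Context {R : realType}.
Variables (rho dl : R -> R) (kappa M : R).
Hypothesis sub : forall t u, rho t + dl t * u <= rho (t + u).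
Hypothesis kappa0 : 0 < kappa.
Hypothesis dl_incr : forall s t, `|s| <= kappa -> `|dl (t + s) - dl t| <= M.
Implicit Types (e u s t : R).

Definition loss_incr e u : R := rho (e - u) - rho e.

Let M0 : 0 <= M.
Proof.
by have := @dl_incr 0 0; rewrite normr0 => /(_ (ltW kappa0)); exact: le_trans.
Qed.

Lemma subgradient_diff_ge t t' : dl t' * (t - t') <= rho t - rho t'.
Proof.
have := sub t' (t - t'); have -> : t' + (t - t') = t by ring.
by rewrite -lerBrDl.
Qed.

Lemma dl_bound e u : `|u| <= kappa -> `|dl (e + u)| <= `|dl e| + M.
Proof.
move=> uk; rewrite -lerBlDl (le_trans _ (dl_incr e uk))//.
by rewrite lerBlDl -{1}[dl (e + u)](subrK (dl e)) addrC ler_normD.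
Qed.

Lemma mul_norm_ge (a b c : R) : `|a| <= c -> - (c * `|b|) <= a * b.
Proof.
move=> ac; rewrite lerNl -mulNr; apply: (le_trans (ler_norm _)).
by rewrite normrM normrN ler_wpM2r.
Qed.

(** The subgradients at [e - u] and [e - u'] bound the difference from both sides. The constant
    depends on the error only through [|dl e|], which is square-integrable. *)
Lemma loss_incr_lip e u u' : `|u| <= kappa -> `|u'| <= kappa ->
  `|loss_incr e u - loss_incr e u'| <= (`|dl e| + M) * `|u - u'|.
Proof.
move=> uk uk'.
have -> : loss_incr e u - loss_incr e u' = rho (e - u) - rho (e - u').
  by rewrite /loss_incr; ring.
have h1 := subgradient_diff_ge (e - u) (e - u').
have h2 := subgradient_diff_ge (e - u') (e - u).
have b1 := @dl_bound e (- u); have b2 := @dl_bound e (- u').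
rewrite !normrN in b1 b2.
have := mul_norm_ge (e - u - (e - u')) (b2 uk').
have := mul_norm_ge (e - u' - (e - u)) (b1 uk).
have -> : e - u - (e - u') = - (u - u') by ring.
have -> : e - u' - (e - u) = u - u' by ring.
rewrite normrN => h3 h4; move: h1 h2.
have -> : e - u - (e - u') = - (u - u') by ring.
have -> : e - u' - (e - u) = u - u' by ring.
move: ((_ + M) * _) h3 h4 => X h3 h4 h1 h2.
by rewrite ler_norml; apply/andP; split; lra.
Qed.

(** The four subgradients involved pair up across the two increments: [dl (e - u)] with [dl e'], and
    [dl (e' - u)] with [dl e], at points within [kappa] of each other. Only [M] remains, so
    discretising the errors has a cost independent of their size. *)
Lemma loss_incr_shift e e' u : `|u| + `|e - e'| <= kappa ->
  `|loss_incr e u - loss_incr e' u| <= M * `|e - e'|.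
Proof.
move=> uek.
have -> : loss_incr e u - loss_incr e' u =
    (rho (e - u) - rho (e' - u)) - (rho e - rho e').
  by rewrite /loss_incr; ring.
have h1 := subgradient_diff_ge (e - u) (e' - u).
have h2 := subgradient_diff_ge (e' - u) (e - u).
have h3 := subgradient_diff_ge e e'.
have h4 := subgradient_diff_ge e' e.
have e1 : e - u - (e' - u) = e - e' by ring.
have e2 : e' - u - (e - u) = - (e - e') by ring.
have e3 : e' - e = - (e - e') by ring.
rewrite e1 in h1; rewrite e2 in h2; rewrite e3 in h4.
have d1 : `|dl (e' + (e - e' - u)) - dl e'| <= M.
  by apply: dl_incr; rewrite (le_trans (ler_normB _ _))// addrC.
have d2 : `|dl (e + (e' - e - u)) - dl e| <= M.
  apply: dl_incr; rewrite (le_trans (ler_normB _ _))// addrC.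
  by rewrite [`|e' - e|]distrC.
rewrite (_ : e' + (e - e' - u) = e - u) in d1; last by ring.
rewrite (_ : e + (e' - e - u) = e' - u) in d2; last by ring.
have := mul_norm_ge (e - e') d1; have := mul_norm_ge (e - e') d2.
rewrite distrC in d1; rewrite distrC in d2.
have := mul_norm_ge (e - e') d1; have := mul_norm_ge (e - e') d2.
rewrite !mulrBl; move: h1 h2 h3 h4; rewrite !mulrN.
move: (e - e') => s.
move: (dl _ * s) (dl _ * s) (dl _ * s) (dl _ * s) (M * _) => a b c d X.
by move=> ? ? ? ? ? ? ? ?; rewrite ler_norml; apply/andP; split; lra.
Qed.

(** Two half steps, with subgradients at [e] and at [e - u / 2]. Since [dl] has mean close to
    [gamma] times the shift, the second point yields a term of order [gamma * u^2], which the
    subgradient at [e] alone would miss. *)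
Lemma loss_incr_ge e u :
  - (dl e * u / 2) - dl (e - u / 2) * u / 2 <= loss_incr e u.
Proof.
have h1 := subgradient_diff_ge (e - u) (e - u / 2).
have h2 := subgradient_diff_ge (e - u / 2) e.
have e1 : e - u - (e - u / 2) = - (u / 2) by field.
have e2 : e - u / 2 - e = - (u / 2) by ring.
rewrite e1 in h1; rewrite e2 in h2.
rewrite /loss_incr; move: h1 h2; rewrite !mulrN -!mulrA.
move: (dl _ * _) (dl _ * _) (rho (e - u / 2)) => a b c; lra.
Qed.

(** The crude bound for errors beyond the truncation level, which carry little mass. *)
Lemma loss_incr_ge_lin e u : - (`|dl e| * `|u|) <= loss_incr e u.
Proof.
have := subgradient_diff_ge (e - u) e.
have -> : e - u - e = - u by ring.
have := mul_norm_ge (- u) (lexx `|dl e|); rewrite normrN /loss_incr.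
exact: le_trans.
Qed.

Lemma loss_incr0 e : loss_incr e 0 = 0.
Proof. by rewrite /loss_incr subr0 subrr. Qed.

End LossIncrements.

(** * Mean loss increment at a fixed predictor *)

Section FiniteValuedIntegral.
Context {R : realType} {d : measure_display} {T : measurableType d}.
Variables (Q : probability T R) (F : finType) (chi : T -> F).
Hypothesis chi_meas : forall a, measurable (chi @^-1` [set a]).

Lemma integral_finite_valued (h : F -> R) :
  Q.-integrable [set: T] (EFin \o (fun w => h (chi w))) /\
  \int[Q]_w h (chi w) = \sum_a fiber_prob Q chi a * h a.
Proof.
have e w : h (chi w) = \sum_(a <- enum F) h a * \1_(chi @^-1` [set a]) w.
  rewrite big_enum/= (bigD1 (chi w))//= big1 ?addr0.
    by rewrite indicE mem_set// mulr1.
  by move=> a ne; rewrite indicE memNset ?mulr0//= => /esym/eqP; apply/negP.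
have -> : (fun w => h (chi w)) =
    fun w => \sum_(a <- enum F) h a * \1_(chi @^-1` [set a]) w.
  by apply/funext => w; rewrite e.
rewrite -[\sum_a _]big_enum/=.
elim: (enum F) => [|a r [IHi IHe]].
  rewrite big_nil; split.
    have -> : (fun w => \sum_(a <- [::]) h a * \1_(chi @^-1` [set a]) w) =
        fun=> 0 by apply/funext => w; rewrite big_nil.
    exact: integrable_const.
  under eq_Rintegral do rewrite big_nil.
  by rewrite Rint_cst.
have i1 : Q.-integrable [set: T] (EFin \o (\1_(chi @^-1` [set a]) : T -> R)).
  apply: (@integrable_bound _ _ _ _ _ (fun=> 1)).
  - exact: measurable_indic.
  - exact: integrable_const.
  - by move=> w; rewrite indicE; case: (_ \in _); rewrite ?normr1 ?normr0.
have ia := integrable_scale (h a) i1.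
have E : (fun w => \sum_(b <- a :: r) h b * \1_(chi @^-1` [set b]) w) =
    fun w => h a * \1_(chi @^-1` [set a]) w +
      \sum_(b <- r) h b * \1_(chi @^-1` [set b]) w.
  by apply/funext => w; rewrite big_cons.
rewrite E; split; first exact: integrable_add.
rewrite RintD// IHe big_cons RintZ//; congr (_ + _); rewrite mulrC; congr (_ * _).
by rewrite /fiber_prob /Rintegral integral_indic// setIT.
Qed.

End FiniteValuedIntegral.

Section ConditionalMean.
Context {R : realType} {dO : measure_display} {Om : measurableType dO}.
Variables (P : probability Om R) (e0 : {mfun Om >-> R}).
Variables (rho dl : R -> R) (kappa M gamma t0 : R).
Hypothesis sub : forall t u, rho t + dl t * u <= rho (t + u).
Hypothesis kappa0 : 0 < kappa.
Hypothesis dl_incr : forall s t : R, `|s| <= kappa -> `|dl (t + s) - dl t| <= M.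
Hypothesis dl_sq : sq_int P (fun w => dl (e0 w)).
Hypothesis gamma0 : 0 < gamma.
Hypothesis dl_mean : forall t : R, `|t| <= t0 ->
  `|\int[P]_w dl (e0 w + t) - gamma * t| <= gamma / 4 * `|t|.

(* Dominates the Lipschitz constants of the loss increments. *)
Definition envelope (w : Om) : R := `|dl (e0 w)| + (`|dl 0| + M + M).

Let M0 : 0 <= M.
Proof.
by have := @dl_incr 0 0; rewrite normr0 => /(_ (ltW kappa0)); exact: le_trans.
Qed.

Lemma envelope_sq : sq_int P envelope.
Proof.
have := sq_int_lin 1 (sq_int_abs dl_sq) (sq_int_cst P (`|dl 0| + M + M)).
by congr sq_int; apply/funext => w; rewrite mul1r.
Qed.

Lemma envelope_ge0 w : 0 <= envelope w.
Proof. by rewrite /envelope !addr_ge0. Qed.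

Lemma dl_shift_integrable t : `|t| <= kappa ->
  P.-integrable [set: Om] (EFin \o (fun w => dl (e0 w + t))).
Proof.
move=> tk; apply: (@integrable_bound _ _ _ _ _ (fun w => `|dl (e0 w)| + M)).
- have mdl : measurable_fun [set: R] dl.
    by apply: nondecreasing_measurable => //; exact: subgradient_mono sub.
  by apply: (measurableT_comp mdl); exact: measurable_funD.
- apply: integrable_add; last exact: integrable_const.
  exact: (sq_int_integrable (sq_int_abs dl_sq)).
- by move=> w; apply: (dl_bound dl_incr).
Qed.

Variables (Te h rb U tau : R).
Hypothesis h0 : 0 <= h.
Hypothesis rb0 : 0 <= rb.
Hypothesis U0 : 0 <= U.
Hypothesis U1 : U <= 1.
Hypothesis small : U + rb + h <= kappa.
Hypothesis small_t0 : rb + U <= t0.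
Definition truncation (t : R) : R := if `|t| <= Te then t else 0.
Hypothesis tail : \int[P]_w (\1_[set w | ~~ (`|e0 w| <= Te)] w * envelope w) <= tau.
Variables (F : finType) (chi : R -> F) (rep : F -> R).
Hypothesis chi_meas : forall c, measurable (chi @^-1` [set c]).
Hypothesis rep_near : forall t, `|truncation t - rep (chi t)| <= h.

Let q := fiber_prob (distribution P e0) chi.

Let sum_q (f : F -> R) :
  P.-integrable [set: Om] (EFin \o (fun w => f (chi (e0 w)))) /\
  \sum_c q c * f c = \int[P]_w f (chi (e0 w)).
Proof.
have [|i ->] := @integral_finite_valued R dO Om P F (fun w => chi (e0 w)) _ f.
  move=> c; have mf : measurable_fun [set: Om] e0 by exact: measurable_funP.
  by have := mf measurableT _ (chi_meas c); rewrite setTI.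
by split.
Qed.

(** Within the truncation level the discretised error is close to the true one, and
    [|dl (e0 w)| + M] dominates. Beyond it the error was replaced by 0, which accounts for [|dl 0|]
    in the envelope. *)
Lemma lipschitz_envelope b w : `|b| <= rb ->
  `|dl (rep (chi (e0 w)) + b)| + M <= envelope w.
Proof.
have sm := small; have hh0 := h0; have rbp := rb0; have Up := U0.
move=> brb; have := rep_near (e0 w); rewrite /truncation /envelope.
have dl00 : 0 <= `|dl 0| by [].
case: ifP => _ near.
- have : `|rep (chi (e0 w)) - e0 w + b| <= kappa.
    rewrite (le_trans (ler_normD _ _))// distrC.
    by apply: (le_trans (lerD near brb)); lra.
  move/(dl_bound dl_incr (e0 w)).
  have -> : e0 w + (rep (chi (e0 w)) - e0 w + b) = rep (chi (e0 w)) + b by ring.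
  lra.
- rewrite sub0r normrN in near.
  have : `|rep (chi (e0 w)) + b| <= kappa.
    by rewrite (le_trans (ler_normD _ _))//; lra.
  move/(dl_bound dl_incr 0); rewrite add0r.
  by have : 0 <= `|dl (e0 w)| by []; lra.
Qed.

Lemma lipschitz_second_moment b : `|b| <= rb ->
  \sum_c q c * (`|dl (rep c + b)| + M) ^+ 2 <= \int[P]_w (envelope w ^+ 2).
Proof.
move=> brb; have [i ->] := sum_q (fun c => (`|dl (rep c + b)| + M) ^+ 2).
apply: le_Rint => //; first by have [] := envelope_sq.
move=> w; rewrite lerXn2r ?nnegrE ?addr_ge0 ?envelope_ge0//.
exact: lipschitz_envelope.
Qed.

(** The two half steps have mean about [- gamma * b * u + gamma * u^2 / 4]. The error [gamma / 4] in
    the expansion of the mean costs at most [gamma * |b| * |u| / 4 + gamma * u^2 / 16], leaving more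
    than [gamma * u^2 / 8]. Here [M * h] pays for rounding the errors and [tau] for truncating
    them. *)
Lemma conditional_mean b u : `|b| <= rb -> `|u| <= U ->
  gamma / 8 * u ^+ 2 - 2 * gamma * (`|b| * `|u|) - (M * h + tau) <=
  \sum_c q c * loss_incr rho (rep c + b) u.
Proof.
have sm := small; have smt := small_t0; have hh0 := h0.
have rbp := rb0; have Up := U0; have U1' := U1; have M0' := M0.
move=> brb uU; have [i ->] := sum_q (fun c => loss_incr rho (rep c + b) u).
(* The lower bound of [loss_incr_ge] at the true, undiscretised error. *)
pose Y w := - (u / 2) * (dl (e0 w + b) + dl (e0 w + (b - u / 2))).
have u2 : `|u / 2| <= `|u|.
  by rewrite normrM [`|2^-1|]ger0_norm ?invr_ge0// ler_piMr// invf_le1// ler1n.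
have bu : `|b - u / 2| <= rb + U by rewrite (le_trans (ler_normB _ _))//; lra.
have ib : P.-integrable [set: Om] (EFin \o (fun w => dl (e0 w + b))).
  by apply: dl_shift_integrable; lra.
have ibu : P.-integrable [set: Om] (EFin \o (fun w => dl (e0 w + (b - u / 2)))).
  by apply: dl_shift_integrable; lra.
have iY : P.-integrable [set: Om] (EFin \o Y).
  by apply: integrable_scale; exact: integrable_add.
have YE : \int[P]_w Y w = - (u / 2) *
    (\int[P]_w dl (e0 w + b) + \int[P]_w dl (e0 w + (b - u / 2))).
  by rewrite RintZ ?RintD//; exact: integrable_add.
pose A := [set w | ~~ (`|e0 w| <= Te)].
have mA : measurable A.
  have -> : A = (fun w => `|e0 w|) @^-1` `]Te, +oo[.
    by apply/seteqP; split => w; rewrite /A /= in_itv/= andbT -ltNge.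
  rewrite -[X in measurable X]setTI.
  by apply: (measurableT_comp (@normr_measurable _ setT)); [exact: measurable_funP| |exact: measurable_itv].
(* On large errors the discretised error bears no relation to the true one; both the increment and
   [Y] are then absorbed by the envelope. *)
pose W w := \1_A w * envelope w.
have iW : P.-integrable [set: Om] (EFin \o W).
  apply: (@integrable_bound _ _ _ _ _ envelope).
  - by apply: measurable_funM; [exact: measurable_indic|case: envelope_sq].
  - exact: sq_int_integrable envelope_sq.
  - move=> w; rewrite /W indicE normrM [`|envelope w|]ger0_norm ?envelope_ge0//.
    by case: (_ \in _); rewrite ?normr1 ?normr0 ?mul1r ?mul0r// envelope_ge0.
have pw w : Y w - M * h - W w <= loss_incr rho (rep (chi (e0 w)) + b) u.
  have := rep_near (e0 w); rewrite /truncation /W indicE.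
  have YE' e : - (u / 2) * (dl e + dl (e - u / 2)) =
     - (dl e * u / 2) - dl (e - u / 2) * u / 2 by field.
  case: ifPn => [eT near|eT near].
    rewrite memNset ?mul0r ?subr0; last by rewrite /A /= eT.
    have : `|rep (chi (e0 w)) + b - (e0 w + b)| <= h.
      by rewrite distrC (_ : _ - _ = e0 w - rep (chi (e0 w)))//; ring.
    move=> near'.
    have hk : `|u| + `|rep (chi (e0 w)) + b - (e0 w + b)| <= kappa by lra.
    have := loss_incr_shift sub dl_incr hk.
    have := ler_wpM2l M0 near'.
    have := loss_incr_ge sub (e0 w + b) u.
    rewrite -YE' /Y addrA ler_norml => ? ? /andP[? _]; lra.
  rewrite mem_set ?mul1r//.
  rewrite sub0r normrN in near.
  have n1 : `|rep (chi (e0 w)) + b| <= kappa.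
    by rewrite (le_trans (ler_normD _ _))//; lra.
  have d1 := dl_bound dl_incr 0 n1; rewrite add0r in d1.
  have l1 := loss_incr_ge_lin sub (rep (chi (e0 w)) + b) u.
  have d2 : `|dl (e0 w + b)| <= `|dl (e0 w)| + M.
    by apply: (dl_bound dl_incr); lra.
  have d3 : `|dl (e0 w + (b - u / 2))| <= `|dl (e0 w)| + M.
    by apply: (dl_bound dl_incr); lra.
  have Yle : Y w <= `|u| * (`|dl (e0 w)| + M).
    apply: (le_trans (ler_norm _)); rewrite /Y normrM normrN normrM.
    rewrite [`|2^-1|]ger0_norm ?invr_ge0// -mulrA ler_wpM2l//.
    rewrite mulrC ler_pdivrMr//; apply: (le_trans (ler_normD _ _)); lra.
  have ue : `|u| * envelope w <= envelope w.
    by rewrite ler_piMl ?envelope_ge0//; lra.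
  have ud : `|dl (rep (chi (e0 w)) + b)| * `|u| <= (`|dl 0| + M) * `|u|.
    by rewrite ler_wpM2r.
  have Mh : 0 <= M * h by rewrite mulr_ge0.
  have Mu : 0 <= M * `|u| by rewrite mulr_ge0.
  move: ue; rewrite /envelope; lra.
have iL : P.-integrable [set: Om] (EFin \o (fun w => Y w - M * h - W w)).
  have := integrable_add (integrable_add iY (integrable_const P (- (M * h))))
    (integrable_scale (-1) iW).
  by congr (integrable _ _ (EFin \o _)); apply/funext => w; rewrite mulN1r.
apply: (le_trans _ (le_Rint iL i pw)).
have -> : \int[P]_w (Y w - M * h - W w) = \int[P]_w Y w - M * h - \int[P]_w W w.
  have ic := integrable_const P (- (M * h)).
  have -> : \int[P]_w (Y w - M * h - W w) =
      \int[P]_w ((Y w + - (M * h)) + -1 * W w).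
    by apply: eq_Rintegral => w _; rewrite mulN1r.
  rewrite (RintD (integrable_add iY ic) (integrable_scale (-1) iW)).
  by rewrite (RintD iY ic) Rint_cst (RintZ (-1) iW) mulN1r.
have tl : \int[P]_w W w <= tau by exact: tail.
rewrite YE.
have m1 : `|\int[P]_w dl (e0 w + b) - gamma * b| <= gamma / 4 * `|b|.
  by apply: dl_mean; lra.
have m2 : `|\int[P]_w dl (e0 w + (b - u / 2)) - gamma * (b - u / 2)| <= gamma / 4 * `|b - u / 2|.
  by apply: dl_mean; lra.
move: m1 m2; set m1 := \int[P]_w _; set m2 := \int[P]_w _ => h1 h2.
have hr : `|(m1 - gamma * b) + (m2 - gamma * (b - u / 2))| <=
    gamma / 4 * (2 * `|b| + `|u| / 2).
  have b2 : `|b - u / 2| <= `|b| + `|u| / 2.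
    by rewrite (le_trans (ler_normB _ _))// lerD2l normrM [`|2^-1|]ger0_norm ?invr_ge0.
  have g4 : 0 <= gamma / 4 by rewrite divr_ge0// ltW.
  have := ler_wpM2l g4 b2; have := ler_normD (m1 - gamma * b) (m2 - gamma * (b - u / 2)).
  move: h1 h2 g4; move: (gamma / 4) => g4; lra.
have hu : - (gamma / 4 * (2 * `|b| + `|u| / 2) * `|u|) <=
    ((m1 - gamma * b) + (m2 - gamma * (b - u / 2))) * - u.
  by have := mul_norm_ge (- u) hr; rewrite normrN.
have hbu : gamma * (b * u) <= gamma * (`|b| * `|u|).
  by rewrite ler_pM2l// -normrM ler_norm.
have uu : `|u| * `|u| = u * u by rewrite -normrM ger0_norm// -expr2 sqr_ge0.
have gbu : 0 <= gamma * (`|b| * `|u|) by rewrite !mulr_ge0// ltW.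
have guu : 0 <= gamma * (u * u) by rewrite mulr_ge0 ?(ltW gamma0)// -expr2 sqr_ge0.
have hu' : - (gamma * (`|b| * `|u|) / 2 + gamma * (u * u) / 8) <=
    - (m1 + m2) * u + 2 * (gamma * (b * u)) - gamma * (u * u) / 2.
  have e1 : gamma / 4 * (2 * `|b| + `|u| / 2) * `|u| =
      gamma * (`|b| * `|u|) / 2 + gamma * (u * u) / 8 by rewrite -uu; field.
  have e2 : ((m1 - gamma * b) + (m2 - gamma * (b - u / 2))) * - u =
      - (m1 + m2) * u + 2 * (gamma * (b * u)) - gamma * (u * u) / 2 by field.
  by rewrite e1 e2 in hu.
rewrite expr2; move: tl hbu gbu guu hu'.
rewrite (_ : - (u / 2) * (m1 + m2) = (- (m1 + m2) * u) / 2); last by field.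
rewrite (_ : gamma / 8 * (u * u) = gamma * (u * u) / 8); last by field.
rewrite -[2 * gamma * _]mulrA.
move: (gamma * (`|b| * `|u|)) (gamma * (b * u)) (gamma * (u * u)) => B1 B2 B3.
move: (- (m1 + m2) * u) (\int[P]_w W w) (M * h) => m w Mh.
lra.
Qed.

End ConditionalMean.

(** * Truncation of the errors *)

Section Tails.
Context {R : realType} {dO : measure_display} {Om : measurableType dO}.
Variable P : probability Om R.

Lemma union_bound (A : nat -> set Om) (c : R) n :
  (forall i, measurable (A i) /\ (P (A i) <= c%:E)%E) ->
  exists E, [/\ measurable E, (P E <= (n%:R * c)%:E)%E &
    forall i, (i < n)%N -> A i `<=` E].
Proof.
move=> hA; elim: n => [|n [E [mE PE AE]]].
  by exists set0; split => //; rewrite measure0 mul0r.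
have [mA PA] := hA n; exists (E `|` A n); split.
- exact: measurableU.
- apply: (le_trans (measureU2 _ mE mA)).
  by rewrite -natr1 mulrDl mul1r EFinD leeD.
- move=> i; rewrite ltnS leq_eqVlt => /orP[/eqP->|iltn]; first exact: subsetUr.
  by apply: subset_trans (AE i iltn) _; exact: subsetUl.
Qed.

Variable e0 : {mfun Om >-> R}.

Lemma measurable_tail (Te : R) : measurable [set w | ~~ (`|e0 w| <= Te)].
Proof.
have -> : [set w | ~~ (`|e0 w| <= Te)] = (fun w => `|e0 w| : R) @^-1` `]Te, +oo[%classic.
  by apply/seteqP; split => w; rewrite /= in_itv/= andbT -ltNge.
rewrite -[X in measurable X]setTI.
by apply: (measurableT_comp (@normr_measurable _ setT)); [exact: measurable_funP| |exact: measurable_itv].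
Qed.

(** The events [|e0| > k] decrease to the empty set, so their probabilities tend to 0, and the
    integral over them follows by absolute continuity. *)
Lemma tail_choice (f : Om -> R) (e : R) :
  P.-integrable [set: Om] (EFin \o f) -> (forall w, 0 <= f w) -> 0 < e ->
  exists Te : R, [/\ 0 <= Te,
    \int[P]_w (\1_[set w | ~~ (`|e0 w| <= Te)] w * f w) <= e &
    (P [set w | ~~ (`|e0 w| <= Te)%R] <= e%:E)%E].
Proof.
move=> fi f0 egt0.
have [d [d0 hd]] := integral_normr_continuous fi egt0.
pose A k := [set w | ~~ (`|e0 w| <= k%:R)].
have mA k : measurable (A k) by exact: measurable_tail.
have cA : P (A k) @[k --> \oo] --> 0%E.
  have -> : 0%E = P (\bigcap_k A k).
    rewrite (_ : \bigcap_k A k = set0) ?measure0//.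
    apply/seteqP; split => // w Aw.
    have := Aw (Num.truncn `|e0 w|).+1 Logic.I; rewrite /A /= -ltNge.
    have /andP[_ h1] := truncn_itv (normr_ge0 (e0 w)).
    by move=> /(lt_trans h1); rewrite ltxx.
  apply: nonincreasing_cvg_mu => //.
  - by rewrite (le_lt_trans (probability_le1 _ _))// ltry.
  - exact: bigcap_measurable.
  - apply/nonincreasing_seqP => k; apply/subsetPset => w /=.
    by apply: contra => /le_trans; apply; rewrite ler_nat.
have md0 : 0 < Num.min d e by rewrite lt_min d0.
have [k _ hk] : \forall k \near \oo, (P (A k) < (Num.min d e)%:E)%E.
  have : fine (P (A k)) @[k --> \oo] --> (0 : R) by exact: fine_cvg cA.
  move/cvgr_lt => /(_ _ md0); apply: filterS => k.
  by rewrite -lte_fin fineK// fin_num_measure.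
have := hk k (leqnn _); rewrite EFin_min lt_min => /andP[kd ke].
exists k%:R; split => //; last exact: ltW.
apply: le_trans (ltW (hd _ (mA k) kd)); rewrite le_eqVlt; apply/orP; left; apply/eqP.
rewrite [RHS]/Rintegral integral_mkcond; congr fine; apply: eq_integral => w _.
rewrite patchE indicE /A.
by case: (w \in _); rewrite ?mul1r ?mul0r// ger0_norm.
Qed.

End Tails.

(** * Uniform lower bound for the empirical risk *)

Section UniformDeviation.
Context {R : realType} {T : topologicalType} (x0 : T).
Variables (K : T -> T -> R) (H : set (T -> R)) (ip : (T -> R) -> (T -> R) -> R).
Hypothesis T_compact : compact [set: T].
Hypothesis K_continuous : continuous (fun p : T * T => K p.1 p.2).
Hypothesis H_rkhs : is_rkhs K H ip.
Variable v : probability (borel x0) R.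
Variable lam : R.
Hypothesis lam0 : 0 < lam.
Context {dO : measure_display} {Om : measurableType dO}.
Variable P : probability Om R.
Variables (x : nat -> {mfun Om >-> borel x0}) (eps : nat -> {mfun Om >-> R}).
Hypothesis x_law : forall i (B : set (borel x0)), measurable B -> P (x i @^-1` B) = v B.
Hypothesis eps_law : forall i (B : set R), measurable B ->
  P (eps i @^-1` B) = P (eps 0%N @^-1` B).
Hypothesis x_indep : mutually_independent P (fun i => x i).
Hypothesis eps_indep : mutually_independent P (fun i => eps i).
Hypothesis x_eps_indep : independent_sequences P (fun i => x i) (fun i => eps i).
Variables (rho dl : R -> R) (kappa M gamma t0 : R).
Hypothesis sub : forall t u, rho t + dl t * u <= rho (t + u).
Hypothesis kappa0 : 0 < kappa.
Hypothesis dl_incr : forall s t : R, `|s| <= kappa -> `|dl (t + s) - dl t| <= M.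
Hypothesis dl_sq : sq_int P (fun w => dl (eps 0%N w)).
Hypothesis gamma0 : 0 < gamma.
Hypothesis dl_mean : forall t : R, `|t| <= t0 ->
  `|\int[P]_w dl (eps 0%N w + t) - gamma * t| <= gamma / 4 * `|t|.

Variables (n : nat) (delta rb U Cn : R).
Hypothesis n0 : (0 < n)%N.
Hypothesis delta0 : 0 < delta.
Hypothesis rb0 : 0 <= rb.
Hypothesis U0 : 0 <= U.
Hypothesis U1 : U <= 1.
Hypothesis Cn0 : 0 < Cn.
Hypothesis complexity_Cn : spectral_complexity v H ip lam <= n%:R * Cn.
Let rip := reg_ip ip v lam.
Hypothesis ball_sup : forall g, H g -> rip g g <= delta ^+ 2 -> forall s, `|g s| <= U.
Variables (r : T -> R).
Hypothesis r_meas : measurable_fun [set: borel x0] r.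
Hypothesis r_bound : forall s, `|r s| <= rb.

Variables (Te h tau : R).
Hypothesis h0 : 0 < h.
Hypothesis small : U + rb + h *+ 2 <= kappa.
Hypothesis small_t0 : rb + U <= t0.
Hypothesis tail : \int[P]_w (\1_[set w | ~~ (`|eps 0%N w| <= Te)] w *
  envelope (eps 0%N) dl M w) <= tau.

Variables (A B F2 : finType) (chiA : T -> A) (chiB : T -> B) (chi2 : R -> F2).
Variables (repA : A -> T) (repB : B -> R) (rep2 : F2 -> R).
Hypothesis chiA_meas : forall a, measurable (chiA @^-1` [set a] : set (borel x0)).
Hypothesis chiB_meas : forall b, measurable (chiB @^-1` [set b] : set (borel x0)).
Hypothesis chi2_meas : forall c, measurable (chi2 @^-1` [set c] : set R).
Hypothesis repA_near : forall g, H g -> rip g g <= delta ^+ 2 ->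
  forall s, `|g s - g (repA (chiA s))| <= h.
Hypothesis repB_near : forall s, `|r s - repB (chiB s)| <= h.
Hypothesis repB_bound : forall b, `|repB b| <= rb.
Hypothesis rep2_near : forall t, `|truncation Te t - rep2 (chi2 t)| <= h.

Let hR : is_hilbert H rip := @reg_ip_hilbert _ _ x0 _ _ _ T_compact K_continuous H_rkhs v _ lam0.
Let hH := rkhs_is_hilbert H_rkhs.

Let M0 : 0 <= M.
Proof.
by have := @dl_incr 0 0; rewrite normr0 => /(_ (ltW kappa0)); exact: le_trans.
Qed.

(** Two partitions are needed: the ball is equicontinuous, so compactness gives the first one, while
    the offset [r] is only measurable and gives the second through its values. *)
Definition cell (s : T) : A * B := (chiA s, chiB s).

Lemma cell_meas ab : measurable (cell @^-1` [set ab] : set (borel x0)).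
Proof.
case: ab => a b; rewrite (_ : cell @^-1` [set (a, b)] =
   chiA @^-1` [set a] `&` chiB @^-1` [set b]); first exact: measurableI.
by apply/seteqP; split => s; rewrite /cell /=; [case|case => -> ->].
Qed.

Definition cell_loss (z : A * B * F2) (g : T -> R) : R :=
  loss_incr rho (rep2 z.2 + repB z.1.2) (g (repA z.1.1)).

Definition cell_lip (z : A * B * F2) : R := `|dl (rep2 z.2 + repB z.1.2)| + M.

Definition cell_prob : A * B * F2 -> R :=
  pair_prob v (distribution P (eps 0%N)) cell chi2.

Definition sample_cell i w : A * B * F2 := (cell (x i w), chi2 (eps i w)).

Definition rkhs_ball := {g : T -> R | H g /\ rip g g <= delta ^+ 2}.

Lemma rkhs_ball0 : H (fun=> 0) /\ rip (fun=> 0) (fun=> 0) <= delta ^+ 2.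
Proof.
split; first exact: hilbert0 hH.
by rewrite (ip0_l hR) ?sqr_ge0//; exact: hilbert0 hH.
Qed.

Definition zero_ball : rkhs_ball := exist _ _ rkhs_ball0.

Lemma cell_lip_ge0 z : 0 <= cell_lip z.
Proof. by rewrite addr_ge0. Qed.

Lemma cell_loss_lip z (g g' : rkhs_ball) :
  `|cell_loss z (sval g) - cell_loss z (sval g')| <=
  `|cell_lip z * sval g (repA z.1.1) - cell_lip z * sval g' (repA z.1.1)|.
Proof.
have sm := small; have hh0 := h0; have rbp := rb0.
case: g g' => [g [Hg gd]] [g' [Hg' gd']] /=.
have gU := ball_sup Hg gd (repA z.1.1); have gU' := ball_sup Hg' gd' (repA z.1.1).
rewrite -mulrBr normrM ger0_norm ?cell_lip_ge0//.
apply: (loss_incr_lip sub dl_incr); lra.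
Qed.

Lemma second_moment : \sum_z cell_prob z * cell_lip z ^+ 2 <=
  \int[P]_w (envelope (eps 0%N) dl M w ^+ 2).
Proof.
have sm := small; have hh0 := h0; have rbp := rb0; have Up := U0.
rewrite pair_prob_sumE; set I := \int[P]_w _.
apply: (@le_trans _ _ (\sum_a fiber_prob v cell a * I)).
  apply: ler_sum => a _; rewrite ler_wpM2l ?fiber_prob_ge0//.
  have sm' : U + rb + h <= kappa by lra.
  exact: (lipschitz_second_moment kappa0 dl_incr dl_sq (ltW h0) rb0 U0 sm'
    chi2_meas rep2_near (repB_bound a.2)).
by rewrite -mulr_suml fiber_prob_sum1 ?mul1r//; exact: cell_meas.
Qed.

(** The added 1 makes it positive, so that [theta] below can be divided by. *)
Let A0 := \int[P]_w (envelope (eps 0%N) dl M w ^+ 2) + 1.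

Let A01 : 1 <= A0.
Proof. by rewrite lerDr; exact: Rint_sqr_ge0. Qed.

(** The Lipschitz majorant of the increments is the product with [cell_lip z] times the representer
    of evaluation. The mean squared norm of this vector is at most [A0 * N <= n * Cn * A0]. *)
Lemma deviation_bound ee : 0 < ee -> exists E, [/\ measurable E,
  (P E <= ee%:E)%E & forall w, ~ E w -> forall g, H g -> rip g g <= delta ^+ 2 ->
  \sum_z cell_prob z * cell_loss z g - 2 * delta * Num.sqrt (A0 * Cn) / ee <=
  n%:R^-1 * \sum_(i < n) cell_loss (sample_cell i w) g].
Proof.
move=> ee0.
have /choice[rep repP] : forall s, exists k : T -> R, H k /\
    ((forall g, H g -> g s = rip g k) /\
     rip k k <= spectral_complexity v H ip lam).
  move=> s; have [k Hk kP] := representer T_compact K_continuous H_rkhs v lam0 s.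
  by exists k.
pose xi z (g : rkhs_ball) := cell_loss z (sval g).
pose l z (g : rkhs_ball) := cell_lip z * sval g (repA z.1.1).
pose k z := fun s => cell_lip z * rep (repA z.1.1) s.
have Hrep s : H (rep s) by case: (repP s).
have Hk z : H (k z) by exact: (hilbertZ hR).
have p0 z : 0 <= cell_prob z by exact: pair_prob_ge0.
have p1 : \sum_z cell_prob z = 1 by apply: pair_prob_sum1 => //; exact: cell_meas.
have bl z : bounded_on (l z).
  exists (cell_lip z * U) => -[g [Hg gd]] /=.
  by rewrite /l /= normrM ger0_norm ?cell_lip_ge0// ler_wpM2l ?cell_lip_ge0// ball_sup.
have xil z g g' : `|xi z g - xi z g'| <= `|l z g - l z g'| by exact: cell_loss_lip.
have xi0 z : xi z zero_ball = 0 by rewrite /xi /cell_loss /= loss_incr0.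
have bxi z : bounded_on (xi z).
  have [C lC] := bl z; exists C => g; apply: le_trans (lC g).
  by have := xil z g zero_ball; rewrite xi0 subr0 /l /= mulr0 subr0.
pose Q := n%:R * Cn * A0.
have A0p : 0 < A0 := lt_le_trans ltr01 A01.
have n0' : 0 < n%:R :> R by rewrite ltr0n.
have Q0 : 0 < Q by rewrite !mulr_gt0.
(* The minimiser of [theta + 4 n Q / theta], namely [sqrt (4 n Q)]. *)
pose theta := 2 * n%:R * Num.sqrt (A0 * Cn).
have theta0 : 0 < theta by rewrite !mulr_gt0// sqrtr_gt0 mulr_gt0.
have thetaE : theta ^+ 2 = n%:R * (4 * Q).
  by rewrite /theta exprMn sqr_sqrtr ?mulr_ge0 ?ltW// /Q; ring.
have kQ : \sum_z cell_prob z * rip (k z) (k z) <= Q.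
  have N0 := complexity_ge0 T_compact K_continuous H_rkhs v lam0.
  apply: (@le_trans _ _ (\sum_z (cell_prob z * cell_lip z ^+ 2) * (n%:R * Cn))).
    apply: ler_sum => z _; rewrite -mulrA ler_wpM2l//.
    rewrite /k (ipZ_l hR)//; last exact: Hk.
    rewrite (ipZ_r hR)// mulrA -expr2 ler_wpM2l ?sqr_ge0//.
    by case: (repP (repA z.1.1)) => _ [_ /le_trans]; apply.
  rewrite -mulr_suml /Q mulrC ler_pM2l; last by rewrite mulr_gt0.
  by apply: (le_trans second_moment); rewrite lerDl.
have bnd : centered_sup cell_prob xi n (fun=> 0) <= delta * theta.
  have b0 : bounded_on (fun _ : rkhs_ball => 0 : R) by exists 0 => _; rewrite normr0.
  apply: (le_trans (rademacher_contraction zero_ball p0 p1 bxi bl xil n b0)).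
  have H0 := hilbert0 hR.
  have := @signed_sup_hilbert _ _ zero_ball _ _ cell_prob l p0 p1 H rip hR
    (fun g => sval g) delta theta Q k theta0 (ltW delta0) _ Hk _ kQ n _ H0.
  have -> : (fun g : rkhs_ball => rip (sval g) (fun=> 0)) = fun=> 0.
    by apply/funext => -[g [Hg gd]] /=; rewrite (ipC hR)// (ip0_l hR).
  have tt : delta * (theta + theta ^+ 2 / theta) / 2 = delta * theta.
    by rewrite expr2 mulfK ?gt_eqF//; field.
  rewrite (ip0_l hR)// add0r -thetaE tt.
  apply.
  - move=> [g [Hg gd]] /=; split => //.
    rewrite -[leRHS](ger0_norm (ltW delta0)) -sqrtr_sqr.
    by rewrite ler_wsqrtr.
  - move=> z [g [Hg gd]]; rewrite /l /k /= (ipZ_r hR)//.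
    by have [_ [repE _]] := repP (repA z.1.1); rewrite -repE.
(* Markov's level for probability [ee]; divided by [n] it is the error term of the statement. *)
pose t := delta * theta / ee.
have tgt0 : 0 < t by rewrite divr_gt0// mulr_gt0.
have zlaw s : measurable [set w | [seq sample_cell i w | i <- iota 0 (size s)] = s] /\
  P [set w | [seq sample_cell i w | i <- iota 0 (size s)] = s] = (weight cell_prob s)%:E.
  apply: (@pair_law _ _ _ P _ _ _ _ x eps v (distribution P (eps 0%N))) => //.
  exact: cell_meas.
have [E [mE PE EP]] := deviation_event p0 bxi xi0 zlaw n tgt0.
exists E; split => //.
  apply: (le_trans PE); rewrite lee_fin ler_pdivrMr//.
  by rewrite /t mulrCA divff ?gt_eqF// mulr1.
move=> w nE g Hg gd.
have := EP w nE (exist _ g (conj Hg gd)).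
rewrite /xi_mean /xi /= big_split/= sumr_const card_ord sumrN.
set S := \sum_(i < n) _; set m := \sum_z _ => hS.
rewrite ler_pdivlMl//; move: hS; rewrite /t /theta -[m *+ n]mulr_natl.
have -> : delta * (2 * n%:R * Num.sqrt (A0 * Cn)) / ee =
  n%:R * (2 * delta * Num.sqrt (A0 * Cn) / ee) by ring.
rewrite mulrBr.
by rewrite lerBlDr => /le_trans; rewrite lerBlDl; apply; rewrite addrC.
Qed.


(** The conditional bound is integrated over the predictors, with Cauchy-Schwarz for the cross term.
    Passing from cell values back to [g] and [r] changes [g^2] by [2 * h] at most, as [|g| <= 1],
    and the product [|r| * |g|] by [kappa * h] at most. *)
Lemma mean_bound g : H g -> rip g g <= delta ^+ 2 ->
  gamma / 8 * \int[v]_s (g s ^+ 2) -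
  2 * gamma * (Num.sqrt (\int[v]_s (r s ^+ 2)) * Num.sqrt (\int[v]_s (g s ^+ 2)))
  - (M * h + tau + gamma * h / 4 + 2 * gamma * (kappa * h)) <=
  \sum_z cell_prob z * cell_loss z g.
Proof.
move=> Hg gd.
have sm := small; have smt := small_t0; have hh0 := h0; have rbp := rb0.
have Up := U0; have Up1 := U1; have g0 := gamma0.
have gU := ball_sup Hg gd.
pose F (ab : A * B) := gamma / 8 * g (repA ab.1) ^+ 2 -
  2 * gamma * (`|repB ab.2| * `|g (repA ab.1)|) - (M * h + tau).
have sm' : U + rb + h <= kappa by lra.
have [iF EF] := integral_finite_valued v cell_meas F.
apply: (@le_trans _ _ (\int[v]_s F (cell s))); last first.
  rewrite EF pair_prob_sumE; apply: ler_sum => ab _.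
  rewrite ler_wpM2l ?fiber_prob_ge0// /F.
  exact: (conditional_mean sub kappa0 dl_incr dl_sq gamma0 dl_mean (ltW h0) rb0
    U0 U1 sm' small_t0 tail chi2_meas rep2_near).
have sg : sq_int v g := @rkhs_sq_int _ _ x0 _ _ _ T_compact K_continuous H_rkhs v g Hg.
have sr : sq_int v r by exact: (sq_int_bounded v r_meas r_bound).
have [[_ ig2] irg] := (sg, sq_int_mul (sq_int_abs sr) (sq_int_abs sg)).
set C := M * h + tau + gamma * h / 4 + 2 * gamma * (kappa * h).
pose f s := gamma / 8 * g s ^+ 2 + - (2 * gamma) * (`|r s| * `|g s|) + - C.
have i1 := integrable_scale (gamma / 8) ig2.
have i2 := integrable_scale (- (2 * gamma)) irg.
have i3 := integrable_const v (- C).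
have i12 := integrable_add i1 i2.
have fi : v.-integrable [set: borel x0] (EFin \o f) by exact: integrable_add i12 i3.
apply: (@le_trans _ _ (\int[v]_s f s)).
  rewrite /f (RintD i12 i3) (RintD i1 i2) (RintZ (gamma / 8) ig2).
  rewrite (RintZ (- (2 * gamma)) irg) Rint_cst mulNr lerD2r lerD2l lerN2.
  rewrite ler_wpM2l ?mulr_ge0 ?(ltW gamma0)//.
  apply: (le_trans (ler_norm _)).
  apply: (le_trans (Rint_CS_norm (sq_int_abs sr) (sq_int_abs sg))).
  have sq (k : T -> R) : \int[v]_s (`|k s| ^+ 2) = \int[v]_s (k s ^+ 2).
    by apply: eq_Rintegral => s _; rewrite real_normK ?num_real.
  by rewrite !sq.
apply: le_Rint => // s.
rewrite /f /F /cell /=.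
have us := repA_near Hg gd s; have bs := repB_near s.
have g1 := gU s; have g2 := gU (repA (chiA s)).
have rs := r_bound s.
move: us bs g1 g2 rs; set u := g (repA _); set b := repB _.
move=> us bs g1 g2 rs.
have bu : `|b| * `|u| <= `|r s| * `|g s| + kappa * h.
  have b1 : `|b| <= `|r s| + h.
    have := ler_normD (r s) (b - r s); rewrite addrC subrK => /le_trans; apply.
    by rewrite lerD2l distrC.
  have u1 : `|u| <= `|g s| + h.
    have := ler_normD (g s) (u - g s); rewrite addrC subrK => /le_trans; apply.
    by rewrite lerD2l distrC.
  apply: (le_trans (ler_pM (normr_ge0 _) (normr_ge0 _) b1 u1)).
  have -> : (`|r s| + h) * (`|g s| + h) = `|r s| * `|g s| + (`|r s| + `|g s| + h) * h by ring.
  by rewrite lerD2l ler_wpM2r ?(ltW hh0)//; lra.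
have uu : g s ^+ 2 - 2 * h <= u ^+ 2.
  have : `|u - g s| <= h by rewrite distrC.
  move/(mul_norm_ge (u + g s)).
  have -> : (u - g s) * (u + g s) = u ^+ 2 - g s ^+ 2 by ring.
  have : h * `|u + g s| <= h * 2.
    rewrite ler_wpM2l ?(ltW hh0)//; apply: (le_trans (ler_normD _ _)); lra.
  by move: (u ^+ 2) (g s ^+ 2) => X Y; lra.
have h8 : 0 <= gamma / 8 by rewrite divr_ge0// ltW.
have g20 : 0 <= 2 * gamma by rewrite mulr_ge0// ltW.
have := ler_wpM2l h8 uu; have := ler_wpM2l g20 bu; rewrite /C !mulrDr.
move: (`|b| * `|u|) (`|r s| * `|g s|) (u ^+ 2) (g s ^+ 2) (M * h) (kappa * h).
by move=> X1 X2 X3 X4 X5 X6; lra.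
Qed.

(** By monotonicity this bounds [|dl|] on [[- (Te + kappa), Te + kappa]]. *)
Definition dl_range : R := `|dl (Te + kappa)| + `|dl (- (Te + kappa))|.

(** Moving the residual by up to [2 * h] costs [2 * M * h]; moving the value of [g] by up to [h]
    costs [(dl_range + M) * h]. *)
Lemma sample_bound g i w : H g -> rip g g <= delta ^+ 2 -> `|eps i w| <= Te ->
  cell_loss (sample_cell i w) g - h * (3 * M + dl_range) <=
  loss_incr rho (eps i w + r (x i w)) (g (x i w)).
Proof.
move=> Hg gd epsT.
have sm := small; have hh0 := h0; have rbp := rb0.
have Up := U0; have Mp := M0.
have gU := ball_sup Hg gd.
rewrite /cell_loss /sample_cell /=.
have us := repA_near Hg gd (x i w); have bs := repB_near (x i w).
have es := rep2_near (eps i w); rewrite /truncation epsT in es.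
have rbb := repB_bound (chiB (x i w)).
have g1 := gU (x i w); have g2 := gU (repA (chiA (x i w))).
move: us bs es rbb g1 g2; set u' := g (repA _); set b := repB _; set e := rep2 _.
set u := g (x i w) => us bs es rbb g1 g2.
have ee : `|eps i w + r (x i w) - (e + b)| <= h *+ 2.
  have -> : eps i w + r (x i w) - (e + b) = (eps i w - e) + (r (x i w) - b) by ring.
  by apply: (le_trans (ler_normD _ _)); rewrite mulr2n lerD.
have hk : `|u| + `|eps i w + r (x i w) - (e + b)| <= kappa.
  by apply: (le_trans (lerD g1 ee)); lra.
have := loss_incr_shift sub dl_incr hk.
have uk : `|u| <= kappa by lra.
have uk' : `|u'| <= kappa by lra.
have := loss_incr_lip sub dl_incr (e + b) uk uk'.
have eb : `|e + b| <= Te + kappa.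
  have e1 : `|e| <= Te + h.
    have := ler_normD (eps i w) (e - eps i w); rewrite addrC subrK => /le_trans; apply.
    by rewrite distrC lerD.
  by apply: (le_trans (ler_normD _ _)); lra.
have dle : `|dl (e + b)| <= dl_range.
  have mono := subgradient_mono sub.
  move: eb; rewrite ler_norml => /andP[/mono eb1 /mono eb2].
  rewrite /dl_range ler_norml; apply/andP; split.
    rewrite lerNl (le_trans _ (_ : `|dl (- (Te + kappa))| <= _))//; last by rewrite lerDr.
    by apply: (@le_trans _ _ (- dl (- (Te + kappa)))); [rewrite lerN2|rewrite -normrN ler_norm].
  apply: (le_trans eb2); apply: (le_trans (ler_norm _)).
  by rewrite lerDl.
have l1 : (`|dl (e + b)| + M) * `|u - u'| <= (dl_range + M) * h.
  by apply: ler_pM => //; [rewrite addr_ge0|rewrite lerD2r].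
have l2 : M * `|eps i w + r (x i w) - (e + b)| <= M * (h *+ 2).
  by rewrite ler_wpM2l.
rewrite !ler_norml => /andP[k1 k2] /andP[k3 k4].
move: l1 l2 k1 k2 k3 k4.
move: (loss_incr _ _ _) (loss_incr _ _ _) (loss_incr _ _ _) => Y1 Y2 Y3.
move: ((_ + M) * `|_|) (M * `|_|) => Z1 Z2.
have -> : h * (3 * M + dl_range) = 3 * (M * h) + dl_range * h by ring.
rewrite mulrDl mulrnAr mulr2n.
move: (dl_range * h) (M * h) => W1 W2.
lra.
Qed.

Lemma uniform_lower_bound ee : 0 < ee -> exists E, [/\ measurable E,
  (P E <= ee%:E)%E & forall w, ~ E w -> (forall i, (i < n)%N -> `|eps i w| <= Te) ->
  forall g, H g -> rip g g <= delta ^+ 2 ->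
  gamma / 8 * \int[v]_s (g s ^+ 2) -
  2 * gamma * (Num.sqrt (\int[v]_s (r s ^+ 2)) * Num.sqrt (\int[v]_s (g s ^+ 2)))
  - 2 * delta * Num.sqrt (A0 * Cn) / ee
  - (tau + h * (4 * M + gamma / 4 + 2 * gamma * kappa + dl_range)) <=
  n%:R^-1 * \sum_(i < n) loss_incr rho (eps i w + r (x i w)) (g (x i w))].
Proof.
move=> ee0; have [E [mE PE EP]] := deviation_bound ee0.
exists E; split => // w nE epsT g Hg gd.
have n0' : 0 < n%:R :> R by rewrite ltr0n.
have l1 : n%:R^-1 * \sum_(i < n) cell_loss (sample_cell i w) g - h * (3 * M + dl_range) <=
    n%:R^-1 * \sum_(i < n) loss_incr rho (eps i w + r (x i w)) (g (x i w)).
  have -> : h * (3 * M + dl_range) = n%:R^-1 * \sum_(i < n) h * (3 * M + dl_range).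
    have -> : \sum_(i < n) h * (3 * M + dl_range) = n%:R * (h * (3 * M + dl_range)).
      by rewrite sumr_const card_ord [RHS]mulr_natl.
    by rewrite mulKf// gt_eqF.
  rewrite -mulrBr -sumrB ler_wpM2l ?invr_ge0 ?(ltW n0')//.
  by apply: ler_sum => i _; apply: sample_bound => //; exact: epsT.
apply: (le_trans _ l1).
have := EP w nE g Hg gd; have := mean_bound Hg gd.
move: (\sum_z _) (n%:R^-1 * _) (Num.sqrt _ * Num.sqrt _) => X1 X2 X3.
move: (gamma / 8 * _) (2 * gamma * X3) (2 * delta * _ / ee) => X4 X5 X6.
rewrite (_ : h * (4 * M + gamma / 4 + 2 * gamma * kappa + dl_range) =
   M * h + gamma * h / 4 + 2 * gamma * (kappa * h) + h * (3 * M + dl_range)); last first.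
  by ring.
move: (M * h) (gamma * h / 4) (2 * gamma * (kappa * h)) (h * (3 * M + dl_range)).
by move=> X7 X8 X9 X10; lra.
Qed.

End UniformDeviation.

(** * Removal of the discretisation *)

Section Localization.
Context {R : realType}.

Lemma measurable_cut {d} {T : measurableType d} (f : T -> R) (b : R) :
  measurable_fun [set: T] f ->
  measurable [set s | ~~ (`|f s| <= b)] /\
  measurable_fun [set: T] (fun s => if `|f s| <= b then f s else 0).
Proof.
move=> mf; have mA : measurable [set s | ~~ (`|f s| <= b)].
  have -> : [set s | ~~ (`|f s| <= b)] = (fun s => `|f s| : R) @^-1` `]b, +oo[%classic.
    by apply/seteqP; split => s; rewrite /= in_itv/= andbT -ltNge.
  rewrite -[X in measurable X]setTI.
  by apply: (measurableT_comp (@normr_measurable _ setT)); [exact: mf| |exact: measurable_itv].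
split => //.
have -> : (fun s => if `|f s| <= b then f s else 0) =
    (fun s => f s * \1_(~` [set s | ~~ (`|f s| <= b)]) s).
  apply/funext => s; rewrite indicE; case: ifPn => h.
    by rewrite mem_set ?mulr1//=; apply/negP; rewrite negbK.
  by rewrite memNset ?mulr0//= => /negP; rewrite h.
by apply: measurable_funM => //; apply: measurable_indic; exact: measurableC.
Qed.

Context {T : topologicalType} (x0 : T).
Variables (K : T -> T -> R) (H : set (T -> R)) (ip : (T -> R) -> (T -> R) -> R).
Hypothesis T_compact : compact [set: T].
Hypothesis K_continuous : continuous (fun p : T * T => K p.1 p.2).
Hypothesis H_rkhs : is_rkhs K H ip.
Variable v : probability (borel x0) R.
Variable lam : R.
Hypothesis lam0 : 0 < lam.
Context {dO : measure_display} {Om : measurableType dO}.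
Variable P : probability Om R.
Variables (x : nat -> {mfun Om >-> borel x0}) (eps : nat -> {mfun Om >-> R}).
Hypothesis x_law : forall i (B : set (borel x0)), measurable B -> P (x i @^-1` B) = v B.
Hypothesis eps_law : forall i (B : set R), measurable B ->
  P (eps i @^-1` B) = P (eps 0%N @^-1` B).
Hypothesis x_indep : mutually_independent P (fun i => x i).
Hypothesis eps_indep : mutually_independent P (fun i => eps i).
Hypothesis x_eps_indep : independent_sequences P (fun i => x i) (fun i => eps i).
Variables (rho dl : R -> R) (kappa M gamma t0 : R).
Hypothesis sub : forall t u, rho t + dl t * u <= rho (t + u).
Hypothesis kappa0 : 0 < kappa.
Hypothesis dl_incr : forall s t : R, `|s| <= kappa -> `|dl (t + s) - dl t| <= M.
Hypothesis dl_sq : sq_int P (fun w => dl (eps 0%N w)).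
Hypothesis gamma0 : 0 < gamma.
Hypothesis dl_mean : forall t : R, `|t| <= t0 ->
  `|\int[P]_w dl (eps 0%N w + t) - gamma * t| <= gamma / 4 * `|t|.

(** The truncation level and the mesh are chosen last, in terms of [n], [lam], [delta] and [tau],
    since the probability bound and the deviation term are insensitive to them. *)
Lemma localized_lower_bound (n : nat) (delta rb U Cn ee tau : R) (r : T -> R) :
  (0 < n)%N -> 0 < delta -> 0 <= rb -> 0 <= U -> U <= 1 -> 0 < Cn ->
  0 < ee -> 0 < tau -> U + rb < kappa -> rb + U <= t0 ->
  spectral_complexity v H ip lam <= n%:R * Cn ->
  (forall g, H g -> reg_ip ip v lam g g <= delta ^+ 2 -> forall s, `|g s| <= U) ->
  sq_int v r -> {ae v, forall s, `|r s| <= rb} ->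
  exists E, [/\ measurable E, (P E <= ee%:E)%E &
    forall w, ~ E w -> forall g, H g -> reg_ip ip v lam g g <= delta ^+ 2 ->
    gamma / 8 * \int[v]_s (g s ^+ 2) -
    2 * gamma * (Num.sqrt (\int[v]_s (r s ^+ 2)) * Num.sqrt (\int[v]_s (g s ^+ 2)))
    - 4 * delta * Num.sqrt ((\int[P]_w (envelope (eps 0%N) dl M w ^+ 2) + 1) * Cn) / ee
    - tau <=
    n%:R^-1 * \sum_(i < n) loss_incr rho (eps i w + r (x i w)) (g (x i w))].
Proof.
move=> n0 delta0 rb0 U0 U1 Cn0 ee0 tau0 Urb rbU Ncn ballU sr rae.
have [mr ir2] := sr.
have n0' : 0 < n%:R :> R by rewrite ltr0n.
have M0 : 0 <= M.
  by have := @dl_incr 0 0; rewrite normr0 => /(_ (ltW kappa0)); exact: le_trans.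
(* [r] is bounded only almost everywhere, whereas the cells need a bounded function. The sample sees
   the difference with probability 0. *)
pose r' s := if `|r s| <= rb then r s else 0.
have [mbad mr'] := measurable_cut rb mr.
have r'rb s : `|r' s| <= rb by rewrite /r'; case: ifP => //; rewrite normr0.
have sr' : sq_int v r' by exact: (sq_int_bounded v mr' r'rb).
have r'r : \int[v]_s (r' s ^+ 2) <= \int[v]_s (r s ^+ 2).
  apply: le_Rint => //; first by case: sr'.
  by move=> s; rewrite /r'; case: ifP => // _; rewrite expr0n sqr_ge0.
(* [tau / 2] limits the truncated mass of the envelope; [ee / (4 n)] lets a union bound over the [n]
   errors cost only [ee / 4]. *)
pose e1 := Num.min (tau / 2) (ee / (4 * n%:R)).
have e10 : 0 < e1 by rewrite lt_min !divr_gt0 ?mulr_gt0.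
have [Te [Te0 tail Ptail]] := tail_choice (eps 0%N)
   (sq_int_integrable (envelope_sq M dl_sq)) (envelope_ge0 (eps 0%N) kappa0 dl_incr) e10.
pose big := 4 * M + gamma / 4 + 2 * gamma * kappa + dl_range dl kappa Te.
have big0 : 0 <= big.
  by rewrite !addr_ge0 ?mulr_ge0 ?invr_ge0 ?(ltW gamma0) ?(ltW kappa0).
pose h := Num.min ((kappa - U - rb) / 2) (tau / (2 * (big + 1))).
have big1 : 0 < big + 1 by rewrite ltr_wpDl.
have h0 : 0 < h.
  by rewrite lt_min !divr_gt0 ?mulr_gt0//; lra.
have hk : U + rb + h *+ 2 <= kappa.
  have : h <= (kappa - U - rb) / 2 by rewrite ge_min lexx.
  by rewrite ler_pdivlMr//; lra.
have hbig : h * big <= tau / 2.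
  have : h <= tau / (2 * (big + 1)) by rewrite ge_min lexx orbT.
  rewrite ler_pdivlMr ?mulr_gt0// => h1.
  by rewrite ler_pdivlMr//; apply: le_trans h1; rewrite mulrC mulrCA !mulrA ler_wpM2l ?lerDl ?mulr_ge0 ?(ltW h0).
(* On the ball the squared RKHS norm is at most [delta^2 / lam], so this mesh in squared kernel
   distance makes every [g] vary by at most [h] on a cell. *)
pose hx := h ^+ 2 * lam / delta ^+ 2.
have hx0 : 0 < hx by rewrite divr_gt0 ?mulr_gt0 ?exprn_gt0.
have [nA [chiA [repA [mA hA]]]] := compact_partition x0 T_compact
  (kernel_dist_continuous K_continuous) (kernel_dist_diag K) hx0.
have [nB [chiB [repB [mB [hB bB]]]]] := finite_approximation mr' r'rb h0.
have [_ mtr] := @measurable_cut _ (measurableTypeR R) id Te (@measurable_id _ _ setT).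
have trTe t : `|truncation Te t| <= Te.
  by rewrite /truncation; case: ifP => //; rewrite normr0.
have [nC [chi2 [rep2 [m2 [h2 _]]]]] := finite_approximation mtr trTe h0.
have Anear g : H g -> reg_ip ip v lam g g <= delta ^+ 2 ->
    forall s, `|g s - g (repA (chiA s))| <= h.
  move=> Hg gd s; rewrite distrC.
  apply: (le_trans (rkhs_lipschitz H_rkhs _ _ Hg)).
  rewrite /ip_norm -sqrtrM ?(ip_ge0 (rkhs_is_hilbert H_rkhs))//.
  rewrite -[leRHS](ger0_norm (ltW h0)) -sqrtr_sqr ler_wsqrtr//.
  have ipg : ip g g <= delta ^+ 2 / lam.
    by rewrite ler_pdivlMr// mulrC; apply: (le_trans _ gd); exact: reg_ip_ge.
  have d1 := ltW (hA s).
  apply: (@le_trans _ _ (delta ^+ 2 / lam * hx)).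
    apply: ler_pM => //; first exact: (ip_ge0 (rkhs_is_hilbert H_rkhs)).
    exact: (kernel_dist_ge0 H_rkhs).
  rewrite le_eqVlt; apply/orP; left; apply/eqP; rewrite /hx; field.
  by rewrite !gt_eqF.
(* Half of the probability goes to the deviations, which turns their constant 2 into 4. *)
have e2 : 0 < ee / 2 by rewrite divr_gt0.
have [E1 [mE1 PE1 hE1]] := uniform_lower_bound T_compact K_continuous H_rkhs
  lam0 x_law eps_law x_indep eps_indep x_eps_indep sub kappa0 dl_incr dl_sq
  gamma0 dl_mean n0 delta0 rb0 U0 U1 Cn0 Ncn ballU mr' r'rb h0 hk rbU tail
  mA mB m2 Anear hB bB h2 e2.
have [|E2 [mE2 PE2 hE2]] := @union_bound _ _ _ P
  (fun i => [set w | ~~ (`|eps i w| <= Te)]) e1 n.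
  move=> i; split; first exact: measurable_tail.
  have mT : measurable [set t : R | ~~ (`|t| <= Te)].
    by have [] := @measurable_cut _ (measurableTypeR R) id Te (@measurable_id _ _ setT).
  by have := eps_law i mT; rewrite /preimage/= => ->.
have [|E3 [mE3 PE3 hE3]] := @union_bound _ _ _ P
  (fun i => x i @^-1` [set s | ~~ (`|r s| <= rb)]) 0 n.
  move=> i; split.
    rewrite -[X in measurable X]setTI.
    by have mf : measurable_fun [set: Om] (x i) by []; exact: mf.
  rewrite x_law//; have [N [mN N0 sN]] := rae.
  apply: (@le_trans _ _ (v N)); last by rewrite N0.
  apply: le_measure; rewrite ?inE//.
  by move=> s /= /negP ns; apply: sN.
exists (E1 `|` (E2 `|` E3)); split.
- by apply: measurableU => //; exact: measurableU.
- apply: (le_trans (measureU2 _ mE1 (measurableU _ _ mE2 mE3))).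
  apply: (@le_trans _ _ ((ee / 2)%:E + (ee / 4)%:E)%E); last first.
    by rewrite -EFinD lee_fin; lra.
  apply: leeD => //; apply: (le_trans (measureU2 _ mE2 mE3)).
  apply: (@le_trans _ _ ((n%:R * e1)%:E + (n%:R * 0)%:E)%E); first exact: leeD.
  rewrite -EFinD lee_fin mulr0 addr0 mulrC -ler_pdivlMr//.
  rewrite ge_min; apply/orP; right; rewrite invfM mulrA//.
move=> w nE g Hg gd.
have nE1 : ~ E1 w by move=> ?; apply: nE; left.
have nE2 : forall i, (i < n)%N -> `|eps i w| <= Te.
  by move=> i ilt; apply: contrapT => /negP h1; apply: nE; right; left; exact: (hE2 i ilt).
have nE3 : forall i, (i < n)%N -> r' (x i w) = r (x i w).
  move=> i ilt; rewrite /r' ifT//.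
  by apply: contrapT => /negP h1; apply: nE; right; right; exact: (hE3 i ilt).
have := hE1 w nE1 nE2 g Hg gd.
have -> : \sum_(i < n) loss_incr rho (eps i w + r' (x i w)) (g (x i w)) =
   \sum_(i < n) loss_incr rho (eps i w + r (x i w)) (g (x i w)).
  by apply: eq_bigr => i _; rewrite nE3.
apply: le_trans.
set A0 := \int[P]_w _ + 1.
have -> : 2 * delta * Num.sqrt (A0 * Cn) / (ee / 2) = 4 * delta * Num.sqrt (A0 * Cn) / ee.
  by field; rewrite gt_eqF.
rewrite -/big.
have e1t : e1 <= tau / 2 by rewrite ge_min lexx.
have : 2 * gamma * (Num.sqrt (\int[v]_s (r' s ^+ 2)) * Num.sqrt (\int[v]_s (g s ^+ 2))) <=
  2 * gamma * (Num.sqrt (\int[v]_s (r s ^+ 2)) * Num.sqrt (\int[v]_s (g s ^+ 2))).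
  rewrite ler_wpM2l ?mulr_ge0 ?(ltW gamma0)// ler_wpM2r ?sqrtr_ge0//.
  exact: ler_wsqrtr.
move: (2 * gamma * _) (2 * gamma * _) (gamma / 8 * _) (4 * delta * _ / ee) (h * big) hbig.
by move=> X1 X2 X3 X4 X5; lra.
Qed.
End Localization.

(** * Localisation of the minimiser *)

Section Argmin.
Context {R : realType} {S : Type}.
Variables (H : set (S -> R)) (ip rip : (S -> R) -> (S -> R) -> R).
Hypothesis hH : is_hilbert H ip.
Hypothesis hR : is_hilbert H rip.
Variable rho : R -> R.
Hypothesis rho_convex : convex_function [set: R^o] rho.
Variables (n : nat) (x : nat -> S) (y : nat -> R) (lam : R).
Hypothesis lam0 : 0 < lam.

Definition objective (f : S -> R) : R :=
  n%:R^-1 * \sum_(i < n) rho (y i - f (x i)) + lam * ip_norm ip f ^+ 2.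

Lemma objective_convex f d t : H f -> H d -> 0 <= t <= 1 ->
  objective (fun s => f s + t * d s) <=
  (1 - t) * objective f + t * objective (fun s => f s + d s).
Proof.
move=> Hf Hd t01; have [t0 t1] := andP t01.
have Htd := hilbertZ hH t Hd.
have n0 : 0 <= n%:R^-1 :> R by rewrite invr_ge0.
have l1 : n%:R^-1 * \sum_(i < n) rho (y i - (f (x i) + t * d (x i))) <=
    (1 - t) * (n%:R^-1 * \sum_(i < n) rho (y i - f (x i))) +
    t * (n%:R^-1 * \sum_(i < n) rho (y i - (f (x i) + d (x i)))).
  rewrite ![_ * (n%:R^-1 * _)]mulrCA -mulrDr ler_wpM2l// !mulr_sumr -big_split/=.
  apply: ler_sum => i _; rewrite [leRHS]addrC.
  have := convex_ineq (y i - (f (x i) + d (x i))) (y i - f (x i)) rho_convex t01.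
  by congr (rho _ <= _); ring.
have l2 : ip_norm ip (fun s => f s + t * d s) ^+ 2 <=
    (1 - t) * ip_norm ip f ^+ 2 + t * ip_norm ip (fun s => f s + d s) ^+ 2.
  rewrite !(sqr_ip_norm hH)//; try exact: (hilbertD hH).
  rewrite (ip_sqrD hH Hf Htd) (ip_sqrD hH Hf Hd) (ipZ_r hH _ Hd Hf).
  rewrite (ipZ_l hH _ Hd Htd) (ipZ_r hH _ Hd Hd).
  have tt : t * (t * ip d d) <= t * ip d d.
    by rewrite ler_wpM2l// ler_piMl// (ip_ge0 hH).
  rewrite -subr_ge0 in tt; rewrite -subr_ge0; apply: (le_trans tt).
  by rewrite le_eqVlt; apply/orP; left; apply/eqP; ring.
have := ler_wpM2l (ltW lam0) l2; rewrite /objective => l3.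
have := lerD l1 l3; move/le_trans; apply.
by rewrite le_eqVlt; apply/orP; left; apply/eqP; ring.
Qed.

(** If [f] were outside the ball, the segment from [fl] to [f] would cross the sphere. By convexity
    and minimality of [f] the objective at the crossing point would not exceed its value at [fl]. *)
Lemma argmin_localized f fl delta : H fl -> 0 < delta ->
  is_argmin H objective f ->
  (forall g, H g -> rip g g = delta ^+ 2 ->
    objective fl < objective (fun s => fl s + g s)) ->
  rip (fun s => f s - fl s) (fun s => f s - fl s) <= delta ^+ 2.
Proof.
move=> Hfl delta0 [Hf fmin] sphere; rewrite leNgt; apply/negP => big.
pose d s := f s - fl s; have Hd : H d by exact: (hilbertB hH).
have d0 : 0 < rip d d by apply: lt_trans big; rewrite exprn_gt0.
pose t := delta / Num.sqrt (rip d d).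
have s0 : 0 < Num.sqrt (rip d d) by rewrite sqrtr_gt0.
have t01 : 0 <= t <= 1.
  rewrite divr_ge0 ?(ltW delta0) ?sqrtr_ge0//= ler_pdivrMr// mul1r.
  rewrite -[leLHS](ger0_norm (ltW delta0)) -sqrtr_sqr ler_wsqrtr//.
  exact: ltW.
have Htd := hilbertZ hR t Hd.
have := sphere _ Htd; rewrite (ipZ_l hR _ Hd Htd) (ipZ_r hR _ Hd Hd) mulrA -expr2.
have -> : t ^+ 2 * rip d d = delta ^+ 2.
  by rewrite expr_div_n sqr_sqrtr ?(ltW d0)// divfK ?gt_eqF.
move=> /(_ erefl); apply/negP; rewrite -leNgt.
apply: (le_trans (objective_convex Hfl Hd t01)).
have -> : (fun s => fl s + d s) = f by apply/funext => s; rewrite /d addrC subrK.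
have [t0 _] := andP t01.
have := ler_wpM2l t0 (fmin fl Hfl); rewrite -/objective.
move: (objective f) (objective fl) => a b; lra.
Qed.

Lemma objective_gap fl g : H fl -> H g ->
  objective (fun s => fl s + g s) - objective fl =
  n%:R^-1 * \sum_(i < n) loss_incr rho (y i - fl (x i)) (g (x i)) +
  lam * (ip fl g *+ 2 + ip g g).
Proof.
move=> Hfl Hg; rewrite /objective !(sqr_ip_norm hH)//; last exact: (hilbertD hH).
rewrite (ip_sqrD hH Hfl Hg) /loss_incr sumrB.
under [X in n%:R^-1 * (X - _)]eq_bigr do rewrite -addrA -opprD.
by ring.
Qed.

End Argmin.

(* The constant 4 leaves room for the discretisation error tau. *)
Lemma sphere_gap {R : realType} (gamma G2 HG delta r2 B s1 C D q cross dev c1 tau : R) :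
  0 < gamma -> 0 <= G2 -> 0 <= HG -> 0 < C -> 0 <= D -> 0 <= s1 -> 0 <= q ->
  G2 + HG = delta ^+ 2 -> delta = D * Num.sqrt C ->
  r2 <= 2 * B -> B <= s1 * C -> 0 <= r2 ->
  `|cross| <= Num.sqrt B * Num.sqrt HG ->
  dev = q * delta * Num.sqrt C ->
  c1 <= gamma / 8 -> c1 <= 1 -> 0 <= c1 ->
  tau <= C -> 
  4 <= c1 * D ^+ 2 - D * (2 * gamma * Num.sqrt (2 * s1) + 2 * Num.sqrt s1 + q) ->
  0 < gamma / 8 * G2 - 2 * gamma * (Num.sqrt r2 * Num.sqrt G2) - dev - tau
     + (cross *+ 2 + HG).
Proof.
move=> gamma0 G20 HG0 C0 D0 s10 q0 GH deltaE r2B BC r20 crossB devE c1g c11 c10 tauC key.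
have sC0 : 0 <= Num.sqrt C by exact: sqrtr_ge0.
have delta0 : 0 <= delta by rewrite deltaE mulr_ge0.
have sG : Num.sqrt G2 <= delta.
  by rewrite -[leRHS](ger0_norm delta0) -sqrtr_sqr ler_wsqrtr// -GH lerDl.
have sHG : Num.sqrt HG <= delta.
  by rewrite -[leRHS](ger0_norm delta0) -sqrtr_sqr ler_wsqrtr// -GH lerDr.
have sB : Num.sqrt B <= Num.sqrt s1 * Num.sqrt C by rewrite -sqrtrM// ler_wsqrtr.
have sr : Num.sqrt r2 <= Num.sqrt (2 * s1) * Num.sqrt C.
  rewrite -sqrtrM ?mulr_ge0// ler_wsqrtr// (le_trans r2B)// -mulrA ler_pM2l//.
have CE : Num.sqrt C * Num.sqrt C = C by rewrite -expr2 sqr_sqrtr// ltW.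
have a1 : Num.sqrt r2 * Num.sqrt G2 <= Num.sqrt (2 * s1) * D * C.
  apply: (le_trans (ler_pM (sqrtr_ge0 _) (sqrtr_ge0 _) sr sG)).
  by rewrite deltaE mulrACA CE.
have a2 : `|cross| <= Num.sqrt s1 * D * C.
  apply: (le_trans crossB); apply: (le_trans (ler_pM (sqrtr_ge0 _) (sqrtr_ge0 _) sB sHG)).
  by rewrite deltaE mulrACA CE.
have a3 : dev = q * D * C by rewrite devE deltaE -!mulrA CE.
(* Curvature controls the [L^2] part of the radius and the penalty controls the other, so together
   they dominate [c1 * delta^2]. *)
have a4 : c1 * D ^+ 2 * C <= gamma / 8 * G2 + HG.
  have -> : c1 * D ^+ 2 * C = c1 * G2 + c1 * HG.
    by rewrite -mulrDr GH deltaE exprMn sqr_sqrtr ?mulrA// ltW.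
  by apply: lerD; [rewrite ler_wpM2r|rewrite ler_piMl].
have g20 : 0 <= 2 * gamma by rewrite mulr_ge0// ltW.
have a1' := ler_wpM2l g20 a1.
have key' := ler_wpM2r (ltW C0) key.
have := lerNnormlW (lexx `|cross|).
rewrite (_ : (c1 * D ^+ 2 - D * (2 * gamma * Num.sqrt (2 * s1) + 2 * Num.sqrt s1 + q)) * C
  = c1 * D ^+ 2 * C - 2 * gamma * (Num.sqrt (2 * s1) * D * C)
    - 2 * (Num.sqrt s1 * D * C) - q * D * C) in key'; last by ring.
rewrite a3; move: key' a1' a2 a4.
move: (Num.sqrt s1 * D * C) (q * D * C) (c1 * D ^+ 2 * C) => X1 X2 X3.
move: (2 * gamma * (Num.sqrt (2 * s1) * D * C)) (2 * gamma * _) (gamma / 8 * G2) => X4 X5 X6.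
by lra.
Qed.

(** * Choice of the radius and rate of convergence *)

Lemma powR_cvg0 (R : realType) (l : nat -> R) (q e : R) :
  (forall n, 0 < l n) -> l n @[n --> \oo] --> (0 : R) -> 0 < q -> 0 < e ->
  \forall n \near \oo, l n `^ q < e.
Proof.
move=> l0 lcvg q0 e0.
have c0 : 0 < e `^ (q^-1) by rewrite powR_gt0.
near=> n; have ln : l n < e `^ (q^-1) by near: n; exact: (cvgr_lt _ lcvg).
have := gt0_ltr_powR q0; move=> /(_ (l n) (e `^ q^-1)).
rewrite !nnegrE (ltW (l0 n)) (ltW c0) => /(_ isT isT ln).
by rewrite -powRrM mulVf ?gt_eqF// powRr1// ltW.
Unshelve. all: by end_near. Qed.

Lemma quarter_sum (R : realType) (k t m b : R) : 0 < k -> 0 < t ->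
  m <= k / 4 -> m <= t / 4 -> b <= m -> m + b < k /\ b + m <= t.
Proof. by move=> *; split; lra. Qed.

Section Rate.
Context {R : realType} {T : topologicalType} (x0 : T).
Variables (K : T -> T -> R) (H : set (T -> R)) (ip : (T -> R) -> (T -> R) -> R).
Hypothesis T_compact : compact [set: T].
Hypothesis K_continuous : continuous (fun p : T * T => K p.1 p.2).
Hypothesis H_rkhs : is_rkhs K H ip.
Variable v : probability (borel x0) R.
Hypothesis v_support : forall O : set T, open O -> O !=set0 -> (0 < v O)%E.
Variables (J : pred nat) (mu : nat -> R) (phi : nat -> T -> R).
Hypothesis phi_continuous : forall j, J j -> continuous (phi j).
Hypothesis mu_phi : eigensystem v K J mu phi.
Context {dO : measure_display} {Om : measurableType dO}.
Variable P : probability Om R.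
Variables (x : nat -> {mfun Om >-> borel x0}) (eps : nat -> {mfun Om >-> R}).
Hypothesis x_law : forall i (B : set (borel x0)), measurable B -> P (x i @^-1` B) = v B.
Hypothesis eps_law : forall i (B : set R), measurable B ->
  P (eps i @^-1` B) = P (eps 0%N @^-1` B).
Hypothesis x_indep : mutually_independent P (fun i => x i).
Hypothesis eps_indep : mutually_independent P (fun i => eps i).
Hypothesis x_eps_indep : independent_sequences P (fun i => x i) (fun i => eps i).
Variables (rho dl : R -> R) (kappa M gamma t0 : R).
Hypothesis rho_convex : convex_function [set: R^o] rho.
Hypothesis sub : forall t u, rho t + dl t * u <= rho (t + u).
Hypothesis kappa0 : 0 < kappa.
Hypothesis dl_incr : forall s t : R, `|s| <= kappa -> `|dl (t + s) - dl t| <= M.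
Hypothesis dl_sq : sq_int P (fun w => dl (eps 0%N w)).
Hypothesis gamma0 : 0 < gamma.
Hypothesis t00 : 0 < t0.
Hypothesis dl_mean : forall t : R, `|t| <= t0 ->
  `|\int[P]_w dl (eps 0%N w + t) - gamma * t| <= gamma / 4 * `|t|.
Variables (alpha beta Cemb : R) (f0 : T -> R) (c : nat -> R).
Hypothesis alpha_beta : 0 < alpha < beta.
Hypothesis beta1 : beta <= 1.
Hypothesis f0_c : power_expansion v J mu phi beta f0 c.
Hypothesis embed : forall f c, power_expansion v J mu phi alpha f c ->
    ('N[v]_+oo[EFin \o f] <= (Cemb * coef_norm J c)%:E)%E.
Variable lam : nat -> R.
Hypothesis lam_gt0 : forall n, 0 < lam n.
Let N n := spectral_complexity v H ip (lam n).
Let C n := N n / n%:R + lam n `^ beta.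
Variable fhat : nat -> Om -> T -> R.
Hypothesis fhat_argmin : forall n w, (0 < n)%N ->
  is_argmin H (objective ip rho n (fun i => x i w)
    (fun i => f0 (x i w) + eps i w) (lam n)) (fhat n w).
Hypothesis lam_cvg0 : lam n @[n --> \oo] --> (0 : R).
Hypothesis complexity_cvg0 : N n ^+ 2 / n%:R @[n --> \oo] --> (0 : R).
Hypothesis bias_cvg0 : lam n `^ beta * N n @[n --> \oo] --> (0 : R).

Let hH := rkhs_is_hilbert H_rkhs.
Let hR n := @reg_ip_hilbert _ _ x0 _ _ _ T_compact K_continuous H_rkhs v _ (lam_gt0 n).

Lemma fhat_H n w : (0 < n)%N -> H (fhat n w).
Proof. by move=> n0; have [] := fhat_argmin w n0. Qed.

Lemma rate_gt0 n : 0 < C n.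
Proof.
have N0 := complexity_ge0 T_compact K_continuous H_rkhs v (lam_gt0 n).
by rewrite ltr_wpDl ?powR_gt0// divr_ge0.
Qed.

Lemma estimation_rate ee : 0 < ee -> exists2 D, 0 < D &
  \forall n \near \oo, exists E, [/\ measurable E, (P E <= ee%:E)%E &
    forall w, ~ E w -> \int[v]_t ((fhat n w t - f0 t) ^+ 2) <= D * C n].
Proof.
move=> ee0.
have beta0 : 0 < beta by case/andP: alpha_beta => /lt_trans; apply.
have kp := kappa0; have gp := gamma0; have t0p := t00.
have approx := spectral_approximation T_compact K_continuous H_rkhs v_support
  phi_continuous mu_phi alpha_beta beta1 f0_c embed.
pose s1 : R := limn (fun n : nat => \sum_(0 <= j < n | J j) c j ^+ 2) + 1.
rewrite -/s1 in approx.
have s10 : 0 <= s1.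
  have := coef_sum_le f0_c 0; rewrite big_nil => /le_trans; apply.
  by rewrite lerDl.
pose A0 := \int[P]_w (envelope (eps 0%N) dl M w ^+ 2) + 1.
pose q := 4 * Num.sqrt A0 / ee.
have q0 : 0 <= q by rewrite divr_ge0 ?mulr_ge0 ?sqrtr_ge0 ?(ltW ee0).
pose c1 := Num.min (gamma / 8) 1.
have c10 : 0 < c1 by rewrite lt_min ltr01 andbT divr_gt0.
have c1g : c1 <= gamma / 8 by rewrite ge_min lexx.
have c11 : c1 <= 1 by rewrite ge_min lexx orbT.
pose Q := 2 * gamma * Num.sqrt (2 * s1) + 2 * Num.sqrt s1 + q.
have Q0 : 0 <= Q by rewrite !addr_ge0// !mulr_ge0 ?sqrtr_ge0 ?(ltW gp).
(* [D] solves [c1 * D - Q = 2], so the left side of the key inequality is [2 * D]; and [D >= 2]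
   because [c1 <= 1]. *)
pose D := (Q + 2) / c1.
have Q2 : 0 < Q + 2 by rewrite ltr_wpDl.
have D0 : 0 < D by rewrite divr_gt0.
have D2 : 2 <= D.
  rewrite ler_pdivlMr//; apply: (@le_trans _ _ (2 * 1)); first by rewrite ler_pM2l.
  by rewrite mulr1 lerDr.
have key : 4 <= c1 * D ^+ 2 - D * Q.
  have -> : c1 * D ^+ 2 - D * Q = D * 2.
    by rewrite /D; field; rewrite gt_eqF.
  lra.
(* A common uniform bound for the ball and for [f0 - fl]; two such bounds still fit strictly inside
   [kappa] and within [t0]. *)
pose m0 := Num.min 1 (Num.min kappa t0) / 4.
have m00 : 0 < m0 by rewrite divr_gt0// !lt_min ltr01 kp t0p.
have m01 : m0 <= 1 / 4 by rewrite ler_pM2r// ge_min lexx.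
have m0k : m0 <= kappa / 4 by rewrite ler_pM2r// !ge_min lexx !orbT.
have m0t : m0 <= t0 / 4 by rewrite ler_pM2r// !ge_min lexx !orbT.
have m0_1 : m0 <= 1 by apply: (le_trans m01); rewrite ler_pdivrMr// mul1r ler1n.
have m0_sum b := quarter_sum kp t0p m0k m0t (b := b).
have m1 : 0 < m0 ^+ 2 / (2 * D ^+ 2).
  by rewrite divr_gt0 ?exprn_gt0// mulr_gt0// exprn_gt0.
have q1 : 0 < beta - alpha by rewrite subr_gt0; case/andP: alpha_beta.
have Cs : 0 < `|Cemb| + 1 by rewrite ltr_wpDl.
have ss1 : 0 < s1 + 1 by rewrite ltr_wpDl.
(* The threshold for [lambda^(beta - alpha)] below which the uniform approximation error is at most
   [m0]. *)
have m2 : 0 < (m0 / (`|Cemb| + 1)) ^+ 2 / (s1 + 1).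
  by rewrite divr_gt0// exprn_gt0// divr_gt0.
have near1 : \forall n \near \oo, N n ^+ 2 / n%:R < m0 ^+ 2 / (2 * D ^+ 2).
  exact: (cvgr_lt _ complexity_cvg0).
have near2 : \forall n \near \oo, lam n `^ beta * N n < m0 ^+ 2 / (2 * D ^+ 2).
  exact: (cvgr_lt _ bias_cvg0).
have near3 := powR_cvg0 lam_gt0 lam_cvg0 q1 m2.
have near4 : \forall n \near \oo, (0 < n)%N by exists 1%N.
exists (2 * D ^+ 2 + 4 * s1).
  by rewrite ltr_wpDr ?mulr_ge0// mulr_gt0// exprn_gt0.
near=> n.
have n0 : (0 < n)%N by near: n.
have n0' : 0 < n%:R :> R by rewrite ltr0n.
have Cn0 := rate_gt0 n.
have N0 : 0 <= N n := complexity_ge0 T_compact K_continuous H_rkhs v (lam_gt0 n).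
have [fl [Hfl flB sr r2 rae]] := approx (lam n) (lam_gt0 n).
set B := lam n `^ beta * s1 in flB r2.
have B0 : 0 <= B by rewrite mulr_ge0 ?powR_ge0.
have BC : B <= s1 * C n.
  by rewrite /B mulrC ler_wpM2l// lerDr divr_ge0.
pose rb := `|Cemb| * Num.sqrt (lam n `^ (beta - alpha) * s1).
have rb0 : 0 <= rb by rewrite mulr_ge0 ?sqrtr_ge0.
have rbm : rb <= m0.
  apply: (@le_trans _ _ ((`|Cemb| + 1) * (m0 / (`|Cemb| + 1)))); last first.
    by rewrite mulrCA divff ?mulr1// gt_eqF.
  apply: ler_pM => //; rewrite ?sqrtr_ge0 ?lerDl//.
  have mc : 0 <= m0 / (`|Cemb| + 1) by rewrite divr_ge0// ltW.
  rewrite -[leRHS](ger0_norm mc) -sqrtr_sqr ler_wsqrtr//.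
  have h3 : lam n `^ (beta - alpha) < (m0 / (`|Cemb| + 1)) ^+ 2 / (s1 + 1).
    by near: n.
  rewrite ltr_pdivlMr// in h3; apply: (le_trans _ (ltW h3)).
  by rewrite ler_wpM2l ?powR_ge0// lerDl.
pose delta := D * Num.sqrt (C n).
have delta0 : 0 < delta by rewrite mulr_gt0// sqrtr_gt0.
have deltaE : delta ^+ 2 = D ^+ 2 * C n by rewrite exprMn sqr_sqrtr// ltW.
(* Both growth conditions enter here: [N * delta^2 = D^2 * (N^2 / n + lambda^beta * N)]. *)
have Um : N n * delta ^+ 2 <= m0 ^+ 2.
  have h1 : N n ^+ 2 / n%:R < m0 ^+ 2 / (2 * D ^+ 2) by near: n.
  have h2 : lam n `^ beta * N n < m0 ^+ 2 / (2 * D ^+ 2) by near: n.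
  have D20 : 0 < 2 * D ^+ 2 by rewrite mulr_gt0// exprn_gt0.
  rewrite ltr_pdivlMr// in h1; rewrite ltr_pdivlMr// in h2.
  have -> : N n * delta ^+ 2 =
     (N n ^+ 2 / n%:R * (2 * D ^+ 2) + lam n `^ beta * N n * (2 * D ^+ 2)) / 2.
    by rewrite deltaE /C; field; rewrite gt_eqF.
  rewrite ler_pdivrMr//; have := ltW (ltrD h1 h2).
  by rewrite mulr_natr mulr2n.
have ballU g : H g -> reg_ip ip v (lam n) g g <= delta ^+ 2 -> forall s, `|g s| <= m0.
  move=> Hg gd s; rewrite -[leRHS](ger0_norm (ltW m00)) -!sqrtr_sqr ler_wsqrtr//.
  apply: (le_trans (complexity_ub T_compact K_continuous H_rkhs v (lam_gt0 n) s Hg)).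
  by apply: (le_trans _ Um); rewrite ler_wpM2l.
have NC : N n <= n%:R * C n.
  rewrite /C mulrDr mulrCA divff ?gt_eqF// mulr1 lerDl.
  by rewrite mulr_ge0 ?powR_ge0.
have [rb_kappa rb_t0] := m0_sum rb rbm.
have rae' : {ae v, forall s, `|f0 s - fl s| <= rb} by [].
(* The tolerance [tau] is [C n] itself, negligible against the surplus in [sphere_gap]. *)
have [E [mE PE hE]] := localized_lower_bound T_compact K_continuous H_rkhs (lam_gt0 n)
  x_law eps_law x_indep eps_indep x_eps_indep sub kappa0 dl_incr dl_sq gamma0
  dl_mean n0 delta0 rb0 (ltW m00) m0_1 Cn0 ee0 Cn0
  rb_kappa rb_t0 NC ballU sr rae'.
exists E; split => // w nE.
have Hf := fhat_H w n0.
have loc := argmin_localized hH (hR n) rho_convex (lam_gt0 n) Hfl delta0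
  (fhat_argmin w n0).
have dd : reg_ip ip v (lam n) (fun s => fhat n w s - fl s)
    (fun s => fhat n w s - fl s) <= delta ^+ 2.
  apply: loc => g Hg gd.
  rewrite -subr_gt0 (objective_gap hH)//.
  have := hE w nE g Hg; rewrite gd lexx => /(_ isT).
  set S := n%:R^-1 * _; set S' := n%:R^-1 * _.
  have -> : S' = S.
    congr (_ * _); apply: eq_bigr => i _; congr (loss_incr _ _ _); ring.
  have G20 : 0 <= \int[v]_s (g s ^+ 2) := Rint_sqr_ge0 v g.
  have HG0 : 0 <= lam n * ip g g by rewrite mulr_ge0 ?(ltW (lam_gt0 n)) ?(ip_ge0 hH).
  have GH : \int[v]_s (g s ^+ 2) + lam n * ip g g = delta ^+ 2 by [].
  (* Cauchy-Schwarz in the RKHS, with [lambda] shared between [fl] and [g], so that the penalty of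
     [fl] enters only through [B]. *)
  have cross : `|lam n * ip fl g| <= Num.sqrt B * Num.sqrt (lam n * ip g g).
    rewrite -sqrtrM// -sqrtr_sqr ler_wsqrtr//.
    apply: (@le_trans _ _ ((lam n * ip fl fl) * (lam n * ip g g))); last first.
      by rewrite ler_wpM2r.
    have -> : lam n * ip fl fl * (lam n * ip g g) = lam n ^+ 2 * (ip fl fl * ip g g).
      by ring.
    rewrite exprMn ler_wpM2l ?sqr_ge0//.
    exact: (ip_CS hH).
  have devE : 4 * delta * Num.sqrt (A0 * C n) / ee = q * delta * Num.sqrt (C n).
    rewrite /q sqrtrM; last by rewrite addr_ge0// Rint_sqr_ge0.
    ring.
  have := sphere_gap gamma0 G20 HG0 Cn0 (ltW D0) s10 q0 GH erefl r2 BC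
    (Rint_sqr_ge0 v _) cross devE c1g c11 (ltW c10) (lexx _) key.
  rewrite -mulrnAr -mulrDr.
  move: (lam n * (_ + _)) => X gap low; apply: (lt_le_trans gap).
  by rewrite lerD2r.
have sd : sq_int v (fun s => fhat n w s - fl s).
  by apply: (rkhs_sq_int T_compact K_continuous H_rkhs); exact: (hilbertB hH).
have dL2 : \int[v]_s ((fhat n w s - fl s) ^+ 2) <= delta ^+ 2.
  apply: le_trans dd; rewrite lerDl mulr_ge0 ?(ltW (lam_gt0 n))//.
  by apply: (ip_ge0 hH); exact: (hilbertB hH).
have sr' : sq_int v (fun s => fl s - f0 s).
  have := sq_int_lin (-1) sr (sq_int_cst v 0).
  by congr sq_int; apply/funext => s; ring.
have r2' : \int[v]_s ((fl s - f0 s) ^+ 2) <= 2 * B.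
  by apply: le_trans r2; rewrite le_eqVlt; apply/orP; left; apply/eqP;
    apply: eq_Rintegral => s _; ring.
have -> : \int[v]_t (fhat n w t - f0 t) ^+ 2 =
    \int[v]_t ((fhat n w t - fl t) + (fl t - f0 t)) ^+ 2.
  by apply: eq_Rintegral => s _; congr (_ ^+ 2); ring.
apply: (le_trans (Rint_sqrD2 sd sr')).
apply: (@le_trans _ _ (2 * delta ^+ 2 + 2 * (2 * (s1 * C n)))).
  by rewrite lerD// ler_pM2l// (le_trans r2')// ler_pM2l.
by rewrite deltaE le_eqVlt; apply/orP; left; apply/eqP; ring.
Unshelve. all: by end_near. Qed.

End Rate.

(** A bound by a multiple of [s] becomes one by the same multiple of [u] once [Z] is reduced to its
    share [u / s]. With [s = u + v] the two shares add up to [Z]. *)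
Lemma big_O_P_share {R : realType} {dO : measure_display}
    {Om : measurableType dO} (P : probability Om R) (Z : nat -> Om -> R)
    (u s : nat -> R) :
  (forall n w, 0 <= Z n w) -> (forall n, 0 <= u n) -> (forall n, 0 < s n) ->
  (forall e, 0 < e -> exists2 D, 0 < D & \forall n \near \oo, exists E,
     [/\ measurable E, (P E <= e%:E)%E & forall w, ~ E w -> Z n w <= D * s n]) ->
  big_O_P P (fun n w => Z n w * (u n / s n)) u.
Proof.
move=> Z0 u0 s0 rate e e0; have [D D0 rateD] := rate e e0; exists D => //.
case: rateD => k _ hk; exists k => // n kn.
have [E [mE PE hE]] := hk n kn.
exists E; split => // w /= Zbig; apply: contrapT => /hE Zsmall.
move: Zbig; apply/negP; rewrite -leNgt.
have q0 : 0 <= u n / s n by rewrite divr_ge0// ltW.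
rewrite (ger0_norm (mulr_ge0 (Z0 n w) q0)).
apply: (le_trans (ler_wpM2r q0 Zsmall)).
by rewrite mulrA mulrAC mulfK// gt_eqF.
Qed.

(** * The theorem *)

Unset Implicit Arguments.

Theorem theorem1 (R : realType) (d : nat) (X : set 'rV[R]_d) (x0 : X)
  (K : X -> X -> R)
  (K_continuous : continuous (fun p : X * X => K p.1 p.2))
  (K_symmetric : symmetric_kernel K)
  (K_positive : positive_definite K)
  (H : set (X -> R)) (ip : (X -> R) -> (X -> R) -> R)
  (H_rkhs : is_rkhs K H ip)
  (v : probability (borel x0) R)
  (J : pred nat) (mu : nat -> R) (phi : nat -> X -> R)
  (phi_continuous : forall j, J j -> continuous (phi j))
  (mu_phi : eigensystem v K J mu phi)
  (rho psi : R -> R)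
  (psi_measurable : measurable_fun [set: R] psi)
  (f0 : X -> R)
  (dO : measure_display) (Omega : measurableType dO) (P : probability Omega R)
  (x : nat -> {RV P >-> borel x0}) (eps : nat -> {RV P >-> R})
  (y : nat -> Omega -> R)
  (y_model : forall i w, y i w = f0 (x i w) + eps i w)
  (* A1 *)
  (X_compact : compact X)
  (x_independent : mutually_independent P (fun i => x i))
  (x_law : forall i (B : set (borel x0)), measurable B ->
     distribution P (x i) B = v B)
  (v_support : forall O : set X, open O -> O !=set0 -> (0 < v O)%E)
  (* A2 *)
  (rho_convex : convex_function [set: R^o] rho)
  (rho_ac : absolutely_continuous rho)
  (rho_psi : {ae @lebesgue_measure R, forall t, is_derive t (1 : R) rho (psi t)})
  (* A3 *)
  (psi_increments : exists kappa M1 : R, [/\ 0 < kappa, 0 < M1 &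
     forall s, `|s| <= kappa -> forall t, `|psi (t + s) - psi t| <= M1])
  (* A4 *)
  (eps_independent : mutually_independent P (fun i => eps i))
  (eps_identical : identically_distributed P (fun i => eps i))
  (x_eps_independent : independent_sequences P (fun i => x i) (fun i => eps i))
  (psi_eps_mean : ('E_P[psi \o eps 0%N] = 0)%E)
  (psi_eps_square : ('E_P[fun w => (`|psi (eps 0%N w)| ^+ 2)%R] < +oo)%E)
  (psi_eps_shift : exists2 gamma : R, 0 < gamma &
     (fun t : R => \int[P]_w psi (eps 0%N w + t) : R^o)
     = (fun t : R => gamma * t : R^o) +o_ (0 : R) (fun t : R => t : R^o))
  (* A5 *)
  (beta : R) (beta01 : 0 < beta <= 1)
  (f0_power : power_space v J mu phi beta f0)
  (* A6 *)
  (power_embedding : exists2 alpha : R, 0 < alpha < beta &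
     power_embeds_Linfty v J mu phi alpha)
  (lambda : nat -> R) (lambda_gt0 : forall n, 0 < lambda n)
  (fhat : nat -> Omega -> X -> R)
  (fhat_argmin : forall n w, (0 < n)%N ->
     is_argmin H (fun f => n%:R^-1 * \sum_(i < n) rho (y i w - f (x i w))
                           + lambda n * ip_norm ip f ^+ 2) (fhat n w))
  (lambda_cvg0 : lambda n @[n --> \oo] --> (0 : R))
  (complexity_cvg0 :
     spectral_complexity v H ip (lambda n) ^+ 2 / n%:R @[n --> \oo] --> (0 : R))
  (bias_cvg0 :
     lambda n `^ beta * spectral_complexity v H ip (lambda n)
       @[n --> \oo] --> (0 : R)) :
  exists U V : nat -> Omega -> R,
    [/\ big_O_P P U (fun n => spectral_complexity v H ip (lambda n) / n%:R),
        big_O_P P V (fun n => lambda n `^ beta) &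
        forall n w, (0 < n)%N ->
          (\int[v]_t ((fhat n w t - f0 t) ^+ 2)%:E <= (U n w + V n w)%:E)%E].
Proof.
have T_compact := compact_set_type X_compact.
pose dl := left_slope rho.
have sub t u : rho t + dl t * u <= rho (t + u) by exact: left_slope_subgradient.
have [kappa [M1 [kappa0 M10 psiM]]] := psi_increments.
have dl_incr := subgradient_increments sub rho_psi kappa0 psiM.
have dl_near := subgradient_near sub rho_psi kappa0 psiM.
have meps : measurable_fun [set: Omega] (eps 0%N) by [].
have psi_sq : sq_int P (fun w => psi (eps 0%N w)).
  split; first exact: (measurableT_comp psi_measurable meps).
  apply/integrableP; split.
    apply/measurable_EFinP; apply: measurable_funX.
    exact: (measurableT_comp psi_measurable meps).
  apply: le_lt_trans psi_eps_square; rewrite unlock.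
  rewrite le_eqVlt; apply/orP; left; apply/eqP; apply: eq_integral => w _ /=.
  by rewrite normrX.
have dl_sq : sq_int P (fun w => dl (eps 0%N w)).
  have mdl : measurable_fun [set: R] dl.
    by apply: nondecreasing_measurable => //; exact: subgradient_mono sub.
  have bnd := sq_int_lin 1 (sq_int_abs psi_sq) (sq_int_cst P M1).
  split; first exact: (measurableT_comp mdl meps).
  apply: (@integrable_bound _ _ _ _ _ (fun w => (1 * `|psi (eps 0%N w)| + M1) ^+ 2)).
  - by apply: measurable_funX; exact: (measurableT_comp mdl meps).
  - by case: bnd.
  - move=> w; rewrite normrX lerXn2r ?nnegrE ?addr_ge0 ?mulr_ge0 ?(ltW M10)//.
    rewrite mul1r; have := dl_near (eps 0%N w); rewrite -lerBlDl; apply: le_trans.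
    exact: lerB_dist.
have [gamma gamma0 lo] := psi_eps_shift.
(* This relative precision in the expansion of the mean keeps half of the curvature [gamma / 4]
   obtained from the two half steps. *)
have g4 : 0 < gamma / 4 by rewrite divr_gt0.
have [t0 t00 dl_mean] := mean_subgradient meps psi_measurable sub rho_psi
  kappa0 psiM (sq_int_integrable psi_sq) lo g4.
have [beta0 beta1] := andP beta01.
have [c f0_c] := f0_power.
have [alpha alpha_beta [C embed]] := power_embedding.
have eps_law i (B : set R) : measurable B -> P (eps i @^-1` B) = P (eps 0%N @^-1` B).
  exact: eps_identical.
have argmin n w : (0 < n)%N -> is_argmin H (objective ip rho n (fun i => x i w)
    (fun i => f0 (x i w) + eps i w) (lambda n)) (fhat n w).
  move=> n0; have := fhat_argmin n w n0.
  congr is_argmin; apply/funext => f; rewrite /objective.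
  by congr (_ * _ + _); apply: eq_bigr => i _; rewrite y_model.
have rate := estimation_rate T_compact K_continuous H_rkhs v_support
  phi_continuous mu_phi x_law eps_law x_independent eps_independent
  x_eps_independent rho_convex sub kappa0 dl_incr dl_sq gamma0 t00 dl_mean
  alpha_beta beta1 f0_c embed lambda_gt0 argmin lambda_cvg0 complexity_cvg0
  bias_cvg0.
pose a n := spectral_complexity v H ip (lambda n) / n%:R.
pose b n := lambda n `^ beta.
pose Z n w := \int[v]_t ((fhat n w t - f0 t) ^+ 2).
have a0 n : 0 <= a n.
  rewrite divr_ge0//.
  exact: (complexity_ge0 T_compact K_continuous H_rkhs v (lambda_gt0 n)).
have b0 n : 0 < b n by rewrite powR_gt0.
have ab0 n : 0 < a n + b n by rewrite ltr_wpDl.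
have Z0 n w : 0 <= Z n w by exact: Rint_sqr_ge0.
exists (fun n w => Z n w * (a n / (a n + b n))).
exists (fun n w => Z n w * (b n / (a n + b n))); split.
- by apply: big_O_P_share => //.
- by apply: big_O_P_share => // n; exact: ltW.
- move=> n w n0; rewrite -mulrDr -mulrDl divff ?gt_eqF// mulr1.
  have Hf : H (fhat n w) by have [] := argmin n w n0.
  have sf := @rkhs_sq_int _ _ x0 _ _ _ T_compact K_continuous H_rkhs v _ Hf.
  have sf0 : sq_int v f0 by apply/Lfun2P; case: f0_c.
  have [_ i] := sq_int_lin (-1) sf0 sf.
  (* The conclusion concerns an extended real integral, so its finiteness is required before it can
     be identified with [Z]. *)
  rewrite /Z /Rintegral fineK; last first.
    have := integrable_fin_num measurableT i.
    by congr (_ \is a fin_num); apply: eq_integral => s _; congr (_ ^+ 2)%:E; ring.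
  exact: lexx.
Qed.
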